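(* Let $d\ge 1$ and let $W:\mathbb{R}^d\to\mathbb{R}\cup\{+\infty\}$ be lower semicontinuous, bounded from below by a finite constant, locally integrable and symmetric ($W(-x)=W(x)$ for all $x$). Suppose that the limit $W_\infty:=\lim_{|x|\to\infty}W(x)$ exists in $\mathbb{R}\cup\{+\infty\}$ and that there is $R_W>0$ such that $W$ is radially strictly increasing on $\mathbb{R}^d\setminus B_{R_W}$. (A) If $W$ is bounded from above and upper semicontinuous, then: $W$ is unstable $\iff$ $W$ is discretely unstable $\iff$ $W$ is $H$-unstable. (B) If $W$ is $\beta$-repulsive for some $2<\beta<d$, $W\in C^1(\mathbb{R}^d\setminus\{0\})$, and there is $C_W>0$ such that $\Delta^0W(x)\le C_W$ for all $x\in\mathbb{R}^d$, $W(x)\le C_W|x|^{2-\beta}$ for all $|x|\le 1$, and $|\nabla W(x)|\le C_W|x|^{1-\beta}$ for all $0<|x|\le 1$, then: $W$ is unstable $\iff$ $W$ is discretely unstable; and if $W$ is discretely unstable then $W$ is $H$-unstable.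
   Context: $B_R$ is the open ball of radius $R$ centred at $0$. $\mathcal{P}(\mathbb{R}^d)$ is the set of Borel probability measures on $\mathbb{R}^d$. ''Radially strictly increasing on $\mathbb{R}^d\setminus B_{R_W}$'' means $W(x)<W(y)$ whenever $R_W\le|x|<|y|$. For $N\ge2$ and $\boldsymbol{X}=(x_1,\dots,x_N)\in\mathbb{R}^{Nd}$, $E_N(\boldsymbol{X})=\frac{1}{2N^2}\sum_{i=1}^N\sum_{j\ne i}W(x_i-x_j)$. For $\rho\in\mathcal{P}(\mathbb{R}^d)$, $E(\rho)=\frac12\int\int W(x-y)\,d\rho(x)\,d\rho(y)$. $W$ is unstable if there is $\rho\in\mathcal{P}(\mathbb{R}^d)$ with $E(\rho)<\frac12W_\infty$. $W$ is discretely unstable if there exist $s>0$ and $\bar N\ge2$ such that for all $N>\bar N$ there is $\boldsymbol{X}\in\mathbb{R}^{Nd}$ with $E_N(\boldsymbol{X})<\frac12W_\infty-s$. $W$ is $H$-unstable if for all $B\in\mathbb{R}$ there exist $N\ge2$ and $\boldsymbol{X}\in\mathbb{R}^{Nd}$ with $E_N(\boldsymbol{X})<\frac12W_\infty-\frac{B}{2N}$. Generalised Laplacian: $\Delta^\varepsilon W(x)=\frac{2(d+2)}{\varepsilon^2}\left(\frac{1}{|B_\varepsilon|}\int_{B_\varepsilon}W(x+y)\,dy-W(x)\right)$ for $\varepsilon>0$ (equal to $-\infty$ if $W(x)=+\infty$), and $\Delta^0W(x)=\liminf_{\varepsilon\to0}\Delta^\varepsilon W(x)\in[-\infty,+\infty]$.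 $W$ is $\beta$-repulsive if it is locally integrable and there exist $\delta>0$, $C>0$ with $-\Delta^0W(x)\ge C|x|^{-\beta}$ for all $0<|x|<\delta$ and $-\Delta^0W(0)=+\infty$. In (B), $|0|^{2-\beta}=+\infty$. *)

(* Defs.v *)
From HB Require Import structures.
From mathcomp Require Import all_boot all_order all_algebra.
From mathcomp Require Import all_classical all_reals all_analysis.
From mathcomp Require Import measurable_realfun.

Set Implicit Arguments.
Unset Strict Implicit.
Unset Printing Implicit Defensive.

Import Order.TTheory GRing.Theory Num.Theory.
Import numFieldNormedType.Exports.

Local Open Scope classical_set_scope.
Local Open Scope ring_scope.

(* R^d is 'rV[R]_d with its canonical topology.  The library norm on 'rV[R]_d
   is the sup norm, hence the separate Euclidean norm enorm below. *)

Section euclidean.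
Context {R : realType} {d : nat}.

Definition enorm (x : 'rV[R]_d) : R := Num.sqrt (\sum_i x 0 i ^+ 2).

Definition eball (r : R) : set 'rV[R]_d := [set x | enorm x < r].

(* neighbourhoods of infinity: the filter generated by the complements of the
   Euclidean balls *)
Definition at_infinity : set_system 'rV[R]_d :=
  filter_from [set: R] (fun r => [set x | r <= enorm x]).

End euclidean.

(* R^d with the Borel sigma-algebra; convertible to 'rV[R]_d. *)
Notation borelRn R d := (g_sigma_algebraType (@open 'rV[R]_d)).

Section tuple_measure.
Context {R : realType} {n : nat}.
Let T := measurableTypeR R.
Variable m : {sigma_finite_measure set (n.-tuple T) -> \bar R}.

Definition tuple_cons (p : T * n.-tuple T) : n.+1.-tuple T :=
  [tuple of p.1 :: p.2].

Let measurable_tuple_cons : measurable_fun setT tuple_cons.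
Proof. by apply: measurable_cons. Qed.

HB.instance Definition _ :=
  isMeasurableFun.Build _ _ _ _ tuple_cons measurable_tuple_cons.

Definition cons_measure : set (n.+1.-tuple T) -> \bar R :=
  pushforward (@lebesgue_measure R \x m)%E tuple_cons.

Let cons_measure0 : cons_measure set0 = 0%E.
Proof. exact: measure0. Qed.

Let cons_measure_ge0 A : (0 <= cons_measure A)%E.
Proof. exact: measure_ge0. Qed.

Let cons_measure_sigma_additive : semi_sigma_additive cons_measure.
Proof. exact: measure_semi_sigma_additive. Qed.

HB.instance Definition _ := isMeasure.Build _ _ _ cons_measure
  cons_measure0 cons_measure_ge0 cons_measure_sigma_additive.

Let cons_measure_sigma_finite : sigma_finite setT cons_measure.
Proof.
have [F TF mF] : sigma_finite setT (@lebesgue_measure R \x m)%E.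
  have /sigma_finiteP[F [TF ndF Foo]] := sigma_finiteT (@lebesgue_measure R).
  have /sigma_finiteP[G [TG ndG Goo]] := sigma_finiteT m.
  exists (fun k => F k `*` G k).
    rewrite -setXTT TF TG predeqE => -[x y]; split.
      move=> [/= [i _ Fix] [k _ Gky]]; exists (maxn i k) => //; split.
      - by move: x Fix; exact/subsetPset/ndF/leq_maxl.
      - by move: y Gky; exact/subsetPset/ndG/leq_maxr.
    by move=> [i _ []/= ? ?]; split; exists i.
  move=> k; have [? ?] := Foo k; have [? ?] := Goo k.
  split; first exact: measurableX.
  by rewrite product_measure1E// lte_mul_pinfty// ge0_fin_numE.
pose uncons (t : n.+1.-tuple T) : T * n.-tuple T := (thead t, [tuple of behead t]).
have unconsK : cancel tuple_cons uncons.
  by move=> [a t]; rewrite /uncons /tuple_cons theadE; congr pair; apply: val_inj.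
exists (fun k => uncons @^-1` F k).
  by rewrite -preimage_bigcup -TF preimage_setT.
move=> k; have [mFk Fk] := mF k; split.
  rewrite -[X in measurable X]setTI.
  apply: (measurable_fun_pair _ _ measurableT mFk) => //=.
    exact: measurable_tnth.
  exact: measurable_behead.
rewrite /cons_measure /pushforward -comp_preimage.
by rewrite (_ : uncons \o tuple_cons = idfun) //; apply/funext => x /=; rewrite unconsK.
Qed.

HB.instance Definition _ := Measure_isSigmaFinite.Build _ _ _ cons_measure
  cons_measure_sigma_finite.

End tuple_measure.

Section lebesgue_Rn.
Context {R : realType}.

Fixpoint lebesgue_tuple (n : nat) :
    {sigma_finite_measure set (n.-tuple (measurableTypeR R)) -> \bar R} :=
  if n is k.+1 then cons_measure (lebesgue_tuple k)
  else @dirac _ (0.-tuple (measurableTypeR R)) [tuple] R.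

Lemma lebesgue_tuple_prod n (A : 'I_n -> set (measurableTypeR R)) :
  (forall i, measurable (A i)) ->
  lebesgue_tuple n [set t | forall i, A i (tnth t i)] =
  (\prod_(i < n) lebesgue_measure (A i))%E.
Proof.
elim: n A => [A _|n ih A mA].
  by rewrite big_ord0 /= diracE mem_set//= => -[].
rewrite big_ord_recl -ih//= /cons_measure /pushforward -product_measure1E//.
  congr (_ _); apply/seteqP; split => [[x t] /= At|[x t] /= [A0 At] i].
    split; first exact: (At ord0).
    by move=> i; have := At (lift ord0 i); rewrite tnthS.
  by case: (unliftP ord0 i) => [j ->|->//]; rewrite tnthS; exact: At.
rewrite (_ : [set _ | _] = \bigcap_(i in [set: 'I_n])
    ((fun t : n.-tuple (measurableTypeR R) => tnth t i) @^-1`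
     (A (lift ord0 i)))); last first.
  by apply/seteqP; split => [t At i _|t At i]; [exact: At|exact: (At i I)].
apply: fin_bigcap_measurable => // i _.
rewrite -[X in measurable X]setTI.
exact: (@measurable_tnth _ (measurableTypeR R) n i).
Qed.

Variable d : nat.

Definition row_of_tuple (t : d.-tuple (measurableTypeR R)) : borelRn R d :=
  \row_i (tnth t i : R).

Let measurable_row_of_tuple : measurable_fun setT row_of_tuple.
Proof.
apply: (@measurability _ _ _ (borelRn R d) setT row_of_tuple (@open 'rV[R]_d)) => // _ [U oU <-].
rewrite setTI.
pose B (p : 'rV[rat]_d * nat) : set 'rV[R]_d :=
  [set y | forall i, `|ratr (p.1 0 i) - y 0 i| < p.2.+1%:R^-1].
pose C p := if `[< B p `<=` U >] then B p else set0.
have -> : U = \bigcup_p C p.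
  apply/seteqP; split => [x Ux|x [p _]]; last first.
    by rewrite /C; case: ifPn => // /asboolP; apply.
  have /nbhs_ballP[e /= e0 xeU] := open_nbhs_nbhs (conj oU Ux).
  have [k ke] : exists k, k.+1%:R^-1 < e / 2.
    have e20 : 0 < e / 2 by rewrite divr_gt0.
    exists (Num.truncn (e / 2)^-1); rewrite -[ltRHS]invrK ltf_pV2 ?posrE ?invr_gt0//.
    exact: truncnS_gt.
  have qP i : {q : rat | `|ratr q - x 0 i| < k.+1%:R^-1}.
    apply/cid.
    have : x 0 i - k.+1%:R^-1 < x 0 i + k.+1%:R^-1.
      by rewrite ltrBlDr -addrA ltrDl addr_gt0// invr_gt0.
    move=> /rat_in_itvoo[q]; rewrite in_itv/= => /andP[q1 q2]; exists q.
    by rewrite ltr_distlC -ltr_distlC distrC ltr_distlC q1 q2.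
  exists (\row_i sval (qP i), k) => //.
  have Bx : B (\row_i sval (qP i), k) x.
    by move=> i /=; rewrite mxE; exact: (svalP (qP i)).
  rewrite /C; case: asboolP => // -[] y By; apply: xeU; split => // i j.
  rewrite (ord1 i) /ball/=.
  rewrite (_ : x 0 j - y 0 j =
    (ratr ((\row_i sval (qP i)) 0 j) - y 0 j)
    - (ratr ((\row_i sval (qP i)) 0 j) - x 0 j)); last by rewrite opprB [RHS]addrC subrKA.
  rewrite (le_lt_trans (ler_normB _ _))// (splitr e) ltrD//.
    exact: lt_trans (By j) ke.
  exact: lt_trans (Bx j) ke.
rewrite preimage_bigcup; apply: countable_bigcupT_measurable => // p.
rewrite /C; case: ifPn => _; last by rewrite preimage_set0; exact: measurable0.
rewrite (_ : _ @^-1` _ = \bigcap_(i in [set: 'I_d])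
    ((fun t : d.-tuple (measurableTypeR R) => tnth t i) @^-1`
     (ball (ratr (p.1 0 i) : R) p.2.+1%:R^-1))); last first.
  apply/seteqP; split => [t Bt i _|t Bt i] /=.
    by have := Bt i; rewrite mxE.
  by rewrite mxE; exact: (Bt i).
apply: fin_bigcap_measurable => // i _.
rewrite -[X in measurable X]setTI.
apply: (@measurable_tnth _ (measurableTypeR R) d i) => //.
by apply: open_measurable; exact: ball_open.
Qed.

HB.instance Definition _ :=
  isMeasurableFun.Build _ _ _ _ row_of_tuple measurable_row_of_tuple.

(* the d-dimensional Lebesgue measure, as the image of the d-fold product of
   lebesgue_measure; lebesgue_Rn_prod below gives its value on boxes *)
Definition lebesgue_Rn : set (borelRn R d) -> \bar R :=
  pushforward (lebesgue_tuple d) row_of_tuple.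

Let lebesgue_Rn0 : lebesgue_Rn set0 = 0%E.
Proof. exact: measure0. Qed.

Let lebesgue_Rn_ge0 A : (0 <= lebesgue_Rn A)%E.
Proof. exact: measure_ge0. Qed.

Let lebesgue_Rn_sigma_additive : semi_sigma_additive lebesgue_Rn.
Proof. exact: measure_semi_sigma_additive. Qed.

HB.instance Definition _ := isMeasure.Build _ _ _ lebesgue_Rn
  lebesgue_Rn0 lebesgue_Rn_ge0 lebesgue_Rn_sigma_additive.

Lemma lebesgue_Rn_prod (A : 'I_d -> set (measurableTypeR R)) :
  (forall i, measurable (A i)) ->
  lebesgue_Rn [set x : 'rV[R]_d | forall i, A i (x 0 i)] =
  (\prod_(i < d) lebesgue_measure (A i))%E.
Proof.
move=> mA; rewrite -lebesgue_tuple_prod// /lebesgue_Rn /pushforward.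
by congr (_ _); apply/seteqP; split => t /= At i;
  have := At i; rewrite mxE.
Qed.

End lebesgue_Rn.
Arguments lebesgue_Rn {R d}.

Section potential.
Context {R : realType} {d : nat}.
Implicit Types (W : 'rV[R]_d -> \bar R) (Winf : \bar R).
Local Open Scope ereal_scope.

(* W : R^d -> R U {+oo} is a \bar R-valued function; the value -oo is excluded
   by the lower bounds assumed on W. *)

Definition bounded_below W := exists m : R, forall x, m%:E <= W x.

Definition bounded_above W := exists M : R, forall x, W x <= M%:E.

Definition upper_semicontinuous W := forall x a, W x < a%:E ->
  exists2 V, nbhs x V & forall y, V y -> W y < a%:E.

Definition loc_integrable W := forall K : set (borelRn R d),
  compact (K : set 'rV[R]_d) -> lebesgue_Rn.-integrable K W.

Definition radially_strictly_increasing W (r : R) :=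
  forall x y : 'rV[R]_d, (r <= enorm x)%R -> (enorm x < enorm y)%R -> W x < W y.

Definition discrete_energy W (N : nat) (X : 'I_N -> 'rV[R]_d) : \bar R :=
  ((2 * N%:R ^+ 2)^-1)%:E * \sum_(i < N) \sum_(j < N | j != i) W (X i - X j)%R.

Definition energy W (rho : probability (borelRn R d) R) : \bar R :=
  2^-1%:E * \int[rho]_y \int[rho]_x W ((x : 'rV[R]_d) - (y : 'rV[R]_d))%R.

Definition unstable W Winf :=
  exists rho : probability (borelRn R d) R, energy W rho < 2^-1%:E * Winf.

Definition discretely_unstable W Winf :=
  exists s : R, (0 < s)%R /\ exists Nbar : nat, (2 <= Nbar)%N /\
    forall N, (Nbar < N)%N -> exists X : 'I_N -> 'rV[R]_d,
      discrete_energy W X < 2^-1%:E * Winf - s%:E.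

Definition H_unstable W Winf :=
  forall B : R, exists N : nat, (2 <= N)%N /\ exists X : 'I_N -> 'rV[R]_d,
    discrete_energy W X < 2^-1%:E * Winf - (B / (2 * N%:R))%:E.

(* When W x = +oo this is -oo, since y - +oo = -oo for all y : \bar R. *)
Definition gen_laplacian_eps (eps : R) W (x : 'rV[R]_d) : \bar R :=
  (2 * (d + 2)%:R / eps ^+ 2)%:E *
  (((fine (lebesgue_Rn (eball eps : set (borelRn R d))))^-1)%:E *
     (\int[lebesgue_Rn]_(y in eball eps) W (x + (y : 'rV[R]_d))%R) - W x).

Definition gen_laplacian W (x : 'rV[R]_d) : \bar R :=
  limf_einf (fun eps : R => gen_laplacian_eps eps W x) 0^'+.

Definition beta_repulsive (beta : R) W :=
  loc_integrable W /\
  (exists delta C : R, [/\ (0 < delta)%R, (0 < C)%R &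
    forall x, (0 < enorm x < delta)%R ->
      (C * enorm x `^ (- beta))%:E <= - gen_laplacian W x]) /\
  - gen_laplacian W 0%R = +oo.

(* the power r^a for r >= 0 and a < 0, with 0^a = +oo (whereas powR gives
   0 `^ a = 0) *)
Definition neg_pow (r a : R) : \bar R :=
  if r == 0%R then +oo else (r `^ a)%:E.

Definition gradient (f : 'rV[R]_d -> R) (x : 'rV[R]_d) : 'rV[R]_d :=
  (\row_i 'D_(delta_mx 0 i) f x)%R.

(* fine turns the \bar R-valued W into a real-valued function; this is faithful
   on U because W is required to be finite there *)
Definition C1_on (U : set 'rV[R]_d) W :=
  forall x, U x -> [/\ W x \is a fin_num,
    differentiable (fine \o W) x & {for x, continuous (gradient (fine \o W))}].

End potential.

(* Main.v *)
(* The substance is in two averaging arguments.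

   Continuous to discrete.  If the mean of W(x - y) under rho x rho is below
   Winf, then N points can be chosen one at a time, each time not exceeding the
   conditional expectation of the interaction with the points still to be drawn
   from rho; the resulting configuration has off-diagonal energy at most
   (N - 1)/N times the energy of rho.

   Discrete to continuous.  When W is bounded, the empirical measure only adds
   the diagonal terms W(0)/(2N).  When W is singular, each point mass is
   replaced by a Gaussian of variance of order T.  If Delta^0 W <= C, then a
   Gaussian average of W at time T exceeds W by at most O(CT): this is the
   parabolic maximum principle, comparing W with the heat potentials of
   Lipschitz minorants of W in small time steps.  At a minimum of W - h the
   second differences of W dominate those of the smooth function h, so the bound
   on Delta^0 W is inherited by the Laplacian of h, that is, by its time
   derivative.  The self-energy of a Gaussian is finite because its density at 0
   is dominated by one centred at a point where W is finite; it enters with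
   weight 1/N. *)

Require Import Defs.
From mathcomp Require Import all_boot all_order all_algebra.
From mathcomp Require Import all_classical all_reals all_analysis.
From mathcomp Require Import fingroup perm measurable_realfun ring lra.

From HB Require Import structures.

Set Implicit Arguments.
Unset Strict Implicit.
Unset Printing Implicit Defensive.

Import Order.TTheory GRing.Theory Num.Theory.
Import numFieldNormedType.Exports.

Local Open Scope classical_set_scope.
Local Open Scope ring_scope.

(** * Borel structure and affine changes of variables in R^d *)

(** The obstacle is that [W] is only lower semicontinuous and may be [+oo] at the origin, so nothing
    about it can be differentiated. The maximum principle is therefore run on inequalities alone:
    symmetric second differences of the heat kernel are bounded below up to a quartic error in the
    space increment, and its backward time differences are bounded above up to a quadratic error in
    the time step. The first error disappears in the limit defining [gen_laplacian]; the second,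
    summed over a number of steps of order 1/tau, disappears as tau tends to 0. Both constants blow
    up at time 0, so the comparison starts at a positive time a. This is what the Lipschitz property
    of the minorants is for: it makes the error at the start of order sqrt a. The resulting bound
    does not contain the Lipschitz constant, so monotone convergence carries it over to [W].

    Throughout, [k] is a constant with [W + k] nonnegative: Tonelli and monotone convergence then
    apply to [W + k] even where integrals are infinite, and the shift is removed only at the end. *)

Section borel.
Context {R : realType} {d : nat}.
Implicit Types (W : 'rV[R]_d -> \bar R).

Lemma open_borelRn (A : set 'rV[R]_d) : open A ->
  measurable (A : set (borelRn R d)).
Proof. exact: sub_sigma_algebra. Qed.

Lemma continuous_measurable_row (f : 'rV[R]_d -> 'rV[R]_d) : continuous f ->
  measurable_fun setT (f : borelRn R d -> borelRn R d).
Proof.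
move=> cf.
apply: (@measurability _ _ _ (borelRn R d) setT _ (@open 'rV[R]_d)) => // _ [U oU <-].
by rewrite setTI; apply: open_borelRn; move/continuousP: cf; exact.
Qed.

Lemma continuous_measurable_real (f : 'rV[R]_d -> R) : continuous f ->
  measurable_fun setT (f : borelRn R d -> measurableTypeR R).
Proof.
move=> cf; apply: (measurability _ (RGenOpens.measurableE R)) => //.
move=> _ [_ [a [b ->]] <-]; rewrite setTI; apply: open_borelRn.
by move: cf => /continuousP; apply; apply: interval_open.
Qed.

Lemma continuous_addZ (x : 'rV[R]_d) (e : R) :
  continuous (fun y : 'rV[R]_d => x + e *: y).
Proof. by move=> y; exact: (cvgD (cvg_cst x) (@scaler_continuous _ _ e y)). Qed.

Lemma lsc_measurable W : lower_semicontinuous W ->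
  measurable_fun setT (W : borelRn R d -> \bar R).
Proof.
move=> lW; apply: (measurability _ (ErealGenOInfty.measurableE R)) => //.
move=> _ [_ [a ->] <-]; rewrite setTI preimage_itvoy; apply: open_borelRn.
by move/lower_semicontinuousP : lW; exact.
Qed.

Lemma coord_cts (i : 'I_d) : continuous (fun x : 'rV[R]_d => x 0 i).
Proof. exact: coord_continuous. Qed.

Lemma ler_coord_norm (x : 'rV[R]_d) i : `|x 0 i| <= `|x|.
Proof.
rewrite [leRHS]/Num.norm/= mx_normrE.
by apply/bigmax_geP; right => /=; exists (0, i).
Qed.

Lemma norm_row_le (x : 'rV[R]_d) (r : R) : 0 <= r ->
  (forall i, `|x 0 i| <= r) -> `|x| <= r.
Proof.
move=> r0 xr; rewrite [leLHS]/Num.norm/= mx_normrE.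
by apply/bigmax_leP; split => // -[i j] _ /=; rewrite (ord1 i).
Qed.

Lemma measurable_coord (i : 'I_d) :
  measurable_fun setT (fun x : borelRn R d => (x : 'rV[R]_d) 0 i : measurableTypeR R).
Proof. by apply: continuous_measurable_real; exact: coord_cts. Qed.

(** The sigma-algebra on R^d is generated by open sets, not by coordinates. Coordinatewise
    measurability suffices because [row_of_tuple] is measurable from the product sigma-algebra. *)
Lemma measurable_row d' (T : measurableType d') (f : T -> 'rV[R]_d) :
  (forall i, measurable_fun setT (fun x => f x 0 i : measurableTypeR R)) ->
  measurable_fun setT (f : T -> borelRn R d).
Proof.
move=> mf.
rewrite (_ : f = @row_of_tuple R d \o
    (fun x => [tuple (f x 0 i : measurableTypeR R) | i < d])); last first.
  by apply/funext => x; apply/rowP => i; rewrite mxE tnth_mktuple.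
apply: measurableT_comp; first exact: measurable_funPT.
apply/measurable_fun_tnthP => i.
by rewrite [X in measurable_fun _ X](_ : _ = fun x => f x 0 i)//; 
  apply/funext => x /=; rewrite tnth_mktuple.
Qed.

(** Tonelli calls for the product sigma-algebra, whereas continuity would only give measurability
    for the Borel sets of the product space; hence the passage through coordinates. *)
Lemma measurable_subRn :
  measurable_fun setT (fun z : borelRn R d * borelRn R d =>
    ((z.1 : 'rV[R]_d) - (z.2 : 'rV[R]_d) : borelRn R d)).
Proof.
apply: measurable_row => i.
rewrite [X in measurable_fun _ X](_ : _ = fun z : borelRn R d * borelRn R d =>
  (z.1 : 'rV[R]_d) 0 i - (z.2 : 'rV[R]_d) 0 i); last first.
  by apply/funext => z; rewrite !mxE.
apply: measurable_funB.
  exact: measurableT_comp (measurable_coord i) (measurable_fst).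
exact: measurableT_comp (measurable_coord i) (measurable_snd).
Qed.

End borel.

Section lebesgue_Rn_affine.
Context {R : realType} {d : nat}.
Implicit Types (l u : 'rV[R]_d).
Local Notation mu := (@lebesgue_Rn R d).

Definition box l u : set 'rV[R]_d :=
  [set x | forall i, [set` `]l 0 i, u 0 i]] (x 0 i)].

Definition boxes : set (set (borelRn R d)) :=
  [set A | exists l u, A = box l u].

Lemma setI_closed_boxes : setI_closed boxes.
Proof.
move=> _ _ [l [u ->]] [l' [u' ->]].
exists (\row_i Num.max (l 0 i) (l' 0 i)), (\row_i Num.min (u 0 i) (u' 0 i)).
apply/seteqP; split => [x [/= h h'] i|x /= h].
  have := h i; have := h' i; rewrite /= !in_itv/= !mxE.
  move=> /andP[a1 a2] /andP[b1 b2]; rewrite gt_max le_min.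
  by rewrite a1 a2 b1 b2.
split => i; have := h i; rewrite /= !in_itv/= !mxE;
  by rewrite gt_max le_min => /andP[/andP[a1 a2] /andP[b1 b2]]; rewrite ?a1 ?a2 ?b1 ?b2.
Qed.

Lemma measurable_box l u : measurable (box l u : set (borelRn R d)).
Proof.
rewrite (_ : box l u = \bigcap_(i in [set: 'I_d])
    ((fun x : borelRn R d => (x : 'rV[R]_d) 0 i : measurableTypeR R) @^-1`
      `]l 0 i, u 0 i]%classic)); last first.
  by apply/seteqP; split => [x h i _|x h i]; [exact: h|exact: (h i I)].
apply: fin_bigcap_measurable => // i _.
by rewrite -[X in measurable X]setTI; exact: measurable_coord.
Qed.

(** An open set is the countable union of those boxes with rational centre and half-side 1/(n+1)
    that it contains. *)
Lemma measurable_boxesE : @measurable _ (borelRn R d) = <<s boxes >>.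
Proof.
apply/seteqP; split; last first.
  apply: smallest_sub; first exact: sigma_algebra_measurable.
  by move=> _ [l [u ->]]; exact: measurable_box.
apply: smallest_sub; first exact: smallest_sigma_algebra.
move=> U oU.
pose B (p : 'rV[rat]_d * nat) : set 'rV[R]_d :=
  box (\row_i (ratr (p.1 0 i) - p.2.+1%:R^-1))
      (\row_i (ratr (p.1 0 i) + p.2.+1%:R^-1)).
have BE p y : B p y -> forall i, `|ratr (p.1 0 i) - y 0 i| <= p.2.+1%:R^-1.
  move=> + i => /(_ i)/=; rewrite in_itv/= !mxE => /andP[h1 h2].
  by rewrite ler_distlC (ltW h1).
pose C p := if `[< B p `<=` U >] then B p else set0.
have -> : U = \bigcup_p C p.
  apply/seteqP; split => [x Ux|x [p _]]; last first.
    by rewrite /C; case: ifPn => // /asboolP; apply.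
  have /nbhs_ballP[e /= e0 xeU] := open_nbhs_nbhs (conj oU Ux).
  have [k ke] : exists k, k.+1%:R^-1 < e / 2.
    have e20 : 0 < e / 2 by rewrite divr_gt0.
    exists (Num.truncn (e / 2)^-1); rewrite -[ltRHS]invrK ltf_pV2 ?posrE ?invr_gt0//.
    exact: truncnS_gt.
  have k0 : (0 : R) < k.+1%:R^-1 by rewrite invr_gt0.
  have qP i : {q : rat | `|ratr q - x 0 i| < k.+1%:R^-1}.
    apply/cid.
    have : x 0 i - k.+1%:R^-1 < x 0 i + k.+1%:R^-1.
      by rewrite ltrBlDr -addrA ltrDl addr_gt0.
    move=> /rat_in_itvoo[q]; rewrite in_itv/= => /andP[q1 q2]; exists q.
    by rewrite ltr_distlC ltrBlDr q2 -ltrBlDr q1.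
  exists (\row_i sval (qP i), k) => //.
  have Bx : B (\row_i sval (qP i), k) x.
    move=> i /=; rewrite !mxE in_itv/=; have := svalP (qP i).
    by rewrite ltr_distlC => /andP[-> /ltW ->].
  rewrite /C; case: asboolP => // -[] y By; apply: xeU; split => // i j.
  rewrite (ord1 i) /ball/=.
  have /= := BE _ _ By j; have := svalP (qP j).
  rewrite mxE; set q : R := ratr _ => qx qy; rewrite -[x 0 j](subrK q) -addrA.
  rewrite (le_lt_trans (ler_normD _ _))// (splitr e) ltrD//.
    by rewrite distrC (lt_trans qx).
  exact: le_lt_trans ke.
apply: (@countable_bigcupT_measurable _ (g_sigma_algebraType boxes)) => // p.
rewrite /C; case: ifPn => _; last exact: (@measurable0 _ (g_sigma_algebraType boxes)).
by apply: (@sub_sigma_algebra _ _ boxes); eexists; eexists.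
Qed.

Lemma lebesgue_Rn_box l u : mu (box l u) =
  (\prod_(i < d) lebesgue_measure (`]l 0%R i, u 0%R i]%classic : set R))%E.
Proof.
by rewrite -lebesgue_Rn_prod.
Qed.

Lemma lebesgue_Rn_unique (m : {measure set (borelRn R d) -> \bar R}) :
  (forall l u, m (box l u) = mu (box l u)) ->
  forall A, measurable A -> m A = mu A.
Proof.
move=> mE A mA; apply/esym.
apply: (measure_unique boxes (fun k : nat => box (const_mx (- k%:R)) (const_mx k%:R))) => //.
- exact: measurable_boxesE.
- exact: setI_closed_boxes.
- by move=> k; eexists; eexists.
- apply/seteqP; split => // x _.
  exists (Num.truncn `|x|).+1 => // i /=; rewrite in_itv/= !mxE.
  have xk : `|x 0 i| < (Num.truncn `|x|).+1%:R.
    by apply: le_lt_trans (truncnS_gt _); apply: ler_coord_norm.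
  by move: xk; rewrite ltr_norml => /andP[-> /ltW ->].
- by move=> _ [l [u ->]].
- move=> k; change ((mu (box (const_mx (- k%:R)) (const_mx k%:R) : set 'rV[R]_d)%R < +oo)%E).
  rewrite lebesgue_Rn_box.
  under eq_bigr => i _.
    rewrite (_ : lebesgue_measure _ =
      (fine (lebesgue_measure (`]- k%:R, k%:R]%classic : set R)))%:E).
      over.
    rewrite !mxE fineK// lebesgue_measure_itv/=; case: ifP => _ //.
  by rewrite /= prodEFin ltry.
Qed.

(** For negative [a] the preimage of []l, u]] is half-open on the other side; both kinds of interval
    have the same measure. *)
Lemma lebesgue_measure_affine (a b l u : R) : a != 0 ->
  lebesgue_measure ([set t | l < a * t + b <= u] : set R) =
  (`|a|^-1%:E * lebesgue_measure (`]l, u]%classic : set R))%E.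
Proof.
move=> a0; have [a_gt0|a_lt0|/eqP] := ltgtP 0 a; last by rewrite eq_sym (negbTE a0).
- transitivity (lebesgue_measure (`](l - b) / a, (u - b) / a]%classic : set R)).
    congr (lebesgue_measure _); apply/seteqP; split => t /=; rewrite in_itv/= ltr_pdivrMr// ler_pdivlMr//;
    by move=> /andP[? ?]; apply/andP; split; lra.
  rewrite !lebesgue_measure_itv/= !lte_fin ltr_pM2r ?invr_gt0// ltrD2r.
  case: ifP => _; last by rewrite mule0.
  by rewrite -!EFinB -EFinM gtr0_norm//; congr EFin; field; rewrite gt_eqF.
- transitivity (lebesgue_measure (`[(u - b) / a, (l - b) / a[%classic : set R)).
    congr (lebesgue_measure _); apply/seteqP; split => t /=; rewrite in_itv/= ltr_ndivlMr// ler_ndivrMr//;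
    by move=> /andP[? ?]; apply/andP; split; lra.
  rewrite !lebesgue_measure_itv/= !lte_fin ltr_nM2r ?invr_lt0// ltrD2r.
  case: ifP => _; last by rewrite mule0.
  by rewrite -!EFinB -EFinM ltr0_norm//; congr EFin; field; rewrite lt_eqF.
Qed.

(** Coordinate scalings, permutations and translations send boxes to boxes, so the product formula
    on boxes determines the image of Lebesgue measure. They cover dilations, reflections and
    transpositions of coordinates. *)
Definition affine (a : 'I_d -> R) (s : 'S_d) (b : 'rV[R]_d) (x : 'rV[R]_d) : 'rV[R]_d :=
  \row_i (a i * x 0 (s i) + b 0 i).

Lemma measurable_affine a s b :
  measurable_fun setT (affine a s b : borelRn R d -> borelRn R d).
Proof.
apply: measurable_row => i.
rewrite [X in measurable_fun _ X](_ : _ = fun x : borelRn R d =>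
  a i * (x : 'rV[R]_d) 0 (s i) + b 0 i); last by apply/funext => x; rewrite mxE.
apply: measurable_funD => //; apply: measurable_funM => //.
exact: measurable_coord.
Qed.

Lemma ge0_integral_affine a s b (g : borelRn R d -> \bar R) :
  (forall i, a i != 0) -> measurable_fun setT g -> (forall x, 0 <= g x)%E ->
  (\int[mu]_x g x = (\prod_i `|a i|)%:E * \int[mu]_x g (affine a s b x))%E.
Proof.
move=> a0 mg g0.
have k0 : 0 <= \prod_i `|a i| by apply: prodr_ge0.
pose m := mscale (NngNum k0)
  (measure_function_pushforward__canonical__measure_function_Measure mu
    (measurable_affine a s b)).
rewrite (@eq_measure_integral _ _ _ _ m); last first.
  move=> A' mA' _; apply/esym; apply: (@lebesgue_Rn_unique m) => // l u.
  change ((\prod_i `|a i|)%R%:E * mu (affine a s b @^-1` box l u) = mu (box l u))%E.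
  (* The preimage of a box is again a product set: coordinate [j] is constrained by the condition of
     index [i] with [s i = j], whence the inverse permutation. *)
  pose A j : set (measurableTypeR R) := let i := (s^-1)%g j in
    [set t : R | l 0 i < a i * t + b 0 i <= u 0 i].
  rewrite (_ : affine a s b @^-1` box l u =
      [set x : 'rV[R]_d | forall j, A j (x 0 j)]); last first.
    apply/seteqP; split => x h i /=.
      by have := h ((s^-1)%g i); rewrite /= in_itv/= mxE permKV.
    by rewrite in_itv/= mxE; have := h (s i); rewrite /A/= permK.
  rewrite (lebesgue_Rn_prod (A := A)); last first.
    move=> j; set i := (s^-1)%g j.
    rewrite (_ : A j = (fun t : measurableTypeR R => a i * t + b 0 i) @^-1`
        `]l 0 i, u 0 i]%classic); last first.
      by apply/seteqP; split => t /=; rewrite in_itv.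
    rewrite -[X in measurable X]setTI.
    have mf : measurable_fun setT (fun t : measurableTypeR R => a i * t + b 0 i).
      by apply: measurable_funD => //; apply: measurable_funM.
    by apply: mf.
  rewrite lebesgue_Rn_box [X in (_ * X)%E](reindex_inj (@perm_inj _ s))/=.
  under [X in (_ * X)%E]eq_bigr => i _ do rewrite /A/= permK lebesgue_measure_affine//.
  rewrite big_split/= muleA.
  rewrite prodEFin -EFinM -big_split/= big1 ?mul1e// => i _.
  by rewrite divff// normr_eq0.
rewrite ge0_integral_mscale//=.
rewrite ge0_integral_pushforward//; last exact: measurable_affine.
Qed.

End lebesgue_Rn_affine.

(** * Integration over Euclidean balls and second moments of the unit ball *)

Section integral_shift.
Local Open Scope ereal_scope.
Context d (T : measurableType d) (R : realType) (mu : {measure set T -> \bar R}).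

(** The negative part of [g] is at most [k] on a set of finite measure, hence has a finite integral;
    the constant can be split off even when the integral of [g] is [+oo]. *)
Lemma integral_shift (D : set T) (g : T -> \bar R) (k : R) :
  measurable D -> mu D < +oo -> measurable_fun D g -> (0 <= k)%R ->
  (forall x, D x -> (- k)%:E <= g x) ->
  \int[mu]_(x in D) (g x + k%:E) = \int[mu]_(x in D) g x + k%:E * mu D.
Proof.
move=> mD Doo mg k0 gk.
have kmg x : D x -> g^\- x <= k%:E.
  move=> Dx; rewrite funenegE ge_max lee_fin k0 andbT.
  by have := gk _ Dx; rewrite EFinN leeNl.
have mgn : measurable_fun D g^\- by exact: measurable_funeneg.
have mgp : measurable_fun D g^\+ by exact: measurable_funepos.
have fn x : D x -> g^\- x \is a fin_num.
  move=> Dx; rewrite ge0_fin_numE// ?(le_lt_trans (kmg _ Dx)) ?ltry//.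
transitivity (\int[mu]_(x in D) (g^\+ x + (k%:E - g^\- x))).
  apply: eq_integral => x /set_mem Dx.
  rewrite [in LHS](congr1 (@^~ x) (funeposneg g))/= -addeA; congr (_ + _).
  by rewrite addeC.
rewrite ge0_integralD//; last 2 first.
  by move=> x Dx; rewrite sube_ge0 ?kmg// fn.
  by apply: emeasurable_funB.
have E : \int[mu]_(x in D) (k%:E - g^\- x) + \int[mu]_(x in D) g^\- x = k%:E * mu D.
  rewrite -ge0_integralD//; last 2 first.
    by move=> x Dx; rewrite sube_ge0 ?kmg// fn.
    by apply: emeasurable_funB.
  rewrite -integral_cst//; apply: eq_integral => x /set_mem Dx.
  by rewrite subeK// fn.
have fI : \int[mu]_(x in D) g^\- x \is a fin_num.
  rewrite ge0_fin_numE; last by apply: integral_ge0.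
  apply: (@le_lt_trans _ _ (\int[mu]_(x in D) cst k%:E x)).
    by apply: ge0_le_integral => //= x Dx; exact: kmg.
  by rewrite integral_cst// lte_mul_pinfty.
rewrite -E [X in _ = X + _]integralE.
by rewrite [X in _ = _ + X]addeC addeA subeK.
Qed.

End integral_shift.

Section ball.
Context {R : realType} {d : nat}.
Implicit Types (x y : 'rV[R]_d).
Local Notation mu := (@lebesgue_Rn R d).
Local Notation B := (@eball R d 1).

Definition sqn x : R := \sum_i x 0 i ^+ 2.

Lemma sqn_ge0 x : 0 <= sqn x.
Proof. by apply: sumr_ge0 => i _; exact: sqr_ge0. Qed.

Lemma sqnZ (a : R) x : sqn (a *: x) = a ^+ 2 * sqn x.
Proof.
by rewrite /sqn mulr_sumr; apply: eq_bigr => i _; rewrite !mxE exprMn.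
Qed.

Lemma sqnN x : sqn (- x) = sqn x.
Proof. by apply: eq_bigr => i _; rewrite mxE sqrrN. Qed.

Lemma eballE (r : R) x : 0 < r -> eball r x = (sqn x < r ^+ 2) :> Prop.
Proof.
move=> r0; rewrite /eball/= /enorm -/(sqn x); apply/propext; split.
  by rewrite -(@ltr_pXn2r _ 2)// ?nnegrE ?sqrtr_ge0 ?(ltW r0)// sqr_sqrtr ?sqn_ge0.
by move=> h; rewrite -(@ltr_pXn2r _ 2)// ?nnegrE ?sqrtr_ge0 ?(ltW r0)// sqr_sqrtr ?sqn_ge0.
Qed.

Lemma sqr_coord_le x i : x 0 i ^+ 2 <= sqn x.
Proof.
rewrite /sqn (bigD1 i)//= lerDl; apply: sumr_ge0 => j _; exact: sqr_ge0.
Qed.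

Lemma continuous_sqn : continuous sqn.
Proof.
apply: continuous_big => [|i _]; first exact: add_continuous.
by move=> x; apply: (@cvg_comp _ _ _ _ (fun t : R => t ^+ 2)); [exact: coord_cts|exact: exprn_continuous].
Qed.

Lemma measurable_sqn : measurable_fun setT (sqn : borelRn R d -> measurableTypeR R).
Proof. by apply: continuous_measurable_real; exact: continuous_sqn. Qed.

Lemma measurable_eball (r : R) : 0 < r -> measurable (eball r : set (borelRn R d)).
Proof.
move=> r0; apply: open_borelRn.
rewrite (_ : eball r = sqn @^-1` [set t | t < r ^+ 2]).
  apply: open_comp; last exact: open_lt.
  by move=> x _; exact: continuous_sqn.
by apply/seteqP; split => x /=; rewrite eballE.
Qed.

Lemma ge0_integral_scale (e : R) (g : borelRn R d -> \bar R) : 0 < e ->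
  measurable_fun setT g -> (forall x, 0 <= g x)%E ->
  (\int[mu]_x g x = (e ^+ d)%:E * \int[mu]_x g (e *: (x : 'rV[R]_d))%R)%E.
Proof.
move=> e0 mg g0.
rewrite (@ge0_integral_affine _ _ (fun=> e) 1%g 0 g)//; last by move=> _; rewrite gt_eqF.
rewrite prodr_const card_ord gtr0_norm//; congr (_ * _)%E.
apply: eq_integral => x _; congr g.
by apply/rowP => i; rewrite !mxE perm1 addr0.
Qed.

(** Signed permutations preserve the Euclidean norm, hence the ball, and have Jacobian one. The
    integrand is split into positive and negative parts because the mixed moments below change
    sign. *)
Lemma integral_ball_isometry (a : 'I_d -> R) (s : 'S_d) (g : borelRn R d -> \bar R) :
  (forall i, `|a i| = 1) -> measurable_fun setT g ->
  (\int[mu]_(x in B) g (affine a s 0 x) = \int[mu]_(x in B) g x)%E.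
Proof.
move=> a1 mg.
have mB : measurable (B : set (borelRn R d)) by exact: measurable_eball.
have sqnT x : sqn (affine a s 0 x) = sqn x.
  rewrite /sqn [RHS](reindex_inj (@perm_inj _ s))/=; apply: eq_bigr => i _.
  by rewrite !mxE addr0 exprMn -[a i ^+ 2]real_normK ?num_real// a1 expr1n mul1r.
have pos (h : borelRn R d -> \bar R) : measurable_fun setT h -> (forall x, 0 <= h x)%E ->
  (\int[mu]_(x in B) h (affine a s 0 x) = \int[mu]_(x in B) h x)%E.
  move=> mh h0; rewrite [RHS]integral_mkcond [LHS]integral_mkcond.
  rewrite [RHS](@ge0_integral_affine _ _ a s 0)//; last 3 first.
  - by move=> i; rewrite -normr_eq0 a1 oner_eq0.
  - by apply/(measurable_restrictT _ _).1 => //; exact: measurable_funS mh.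
  - by move=> x; apply: erestrict_ge0.
  rewrite big1 ?mul1e//; apply: eq_integral => x _ /=.
  rewrite /patch; congr (if _ then _ else _).
  by apply/idP/idP => /set_mem h1; apply/mem_set; move: h1; rewrite !eballE// sqnT.
rewrite [RHS]integralE [LHS]integralE; congr (_ - _)%E.
  rewrite -(pos g^\+)%E//; last exact: measurable_funepos.
  by apply: eq_integral => x _; rewrite !funeposE.
rewrite -(pos g^\-)%E//; last exact: measurable_funeneg.
by apply: eq_integral => x _; rewrite !funenegE.
Qed.

Lemma integral_ball_scale (e : R) (g : borelRn R d -> \bar R) : 0 < e ->
  measurable_fun setT g -> (forall x, 0 <= g x)%E ->
  (\int[mu]_(x in eball e) g x =
   (e ^+ d)%:E * \int[mu]_(x in B) g (e *: (x : 'rV[R]_d))%R)%E.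
Proof.
move=> e0 mg g0; rewrite [LHS]integral_mkcond [X in (_ * X)%E]integral_mkcond.
rewrite (ge0_integral_scale e0)//; last 2 first.
- apply/(measurable_restrictT _ _).1; first exact: measurable_eball.
  exact: measurable_funS mg.
- by move=> x; apply: erestrict_ge0.
congr (_ * _)%E; apply: eq_integral => x _; rewrite /patch; congr (if _ then _ else _).
have E : e ^+ 2 * sqn x < e ^+ 2 = (sqn x < 1).
  by rewrite -{2}(mulr1 (e ^+ 2)) ltr_pM2l// exprn_gt0.
by apply/idP/idP => /set_mem h; apply/mem_set; move: h;
  rewrite !eballE// sqnZ expr1n E.
Qed.

Lemma measurable_ball1 : measurable (B : set (borelRn R d)).
Proof. exact: measurable_eball. Qed.

Lemma ball1_lty : (mu B < +oo)%E.
Proof.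
have sub : B `<=` box (const_mx (- 2)) (const_mx 2).
  move=> x; rewrite eballE// expr1n => x1 i /=; rewrite in_itv/= !mxE.
  have xi : x 0 i ^+ 2 < 1 by apply: le_lt_trans x1; exact: sqr_coord_le.
  by apply/andP; split; nra.
apply: (@le_lt_trans _ _ (mu (box (const_mx (- 2)) (const_mx 2)))).
  by apply: le_measure => //; apply: mem_set; [exact: measurable_ball1|exact: measurable_box].
rewrite lebesgue_Rn_box.
under eq_bigr => i _.
  rewrite (_ : lebesgue_measure _ = 4%:E).
    over.
  by rewrite !mxE lebesgue_measure_itv/= lte_fin ifT ?ltrN10//; [congr EFin; lra|lra].
by rewrite prodEFin ltry.
Qed.

Lemma ball1_gt0 : (0 < mu B)%E.
Proof.
(* On the cube of side [c] each squared coordinate is at most [c], since [c <= 1], and [d c < 1];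
   taking [d.+1] makes this strict. *)
pose c : R := (d.+1%:R)^-1.
have c0 : 0 < c by rewrite invr_gt0.
have sub : box 0 (const_mx c) `<=` B.
  move=> x xc; rewrite eballE// expr1n.
  apply: (@le_lt_trans _ _ (\sum_(i < d) c)).
    apply: ler_sum => i _; have := xc i; rewrite /= in_itv/= !mxE => /andP[x0 x1].
    have c1 : c <= 1 by rewrite invf_le1// ler1n.
    nra.
  rewrite sumr_const card_ord -mulr_natl ltr_pdivrMr// mul1r ltr_nat//.
apply: (@lt_le_trans _ _ (mu (box 0 (const_mx c)))); last first.
  by apply: le_measure => //; apply: mem_set; [exact: measurable_box|exact: measurable_ball1].
rewrite lebesgue_Rn_box.
under eq_bigr => i _.
  rewrite (_ : lebesgue_measure _ = c%:E).
    over.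
  by rewrite !mxE lebesgue_measure_itv/= lte_fin c0 sube0.
by rewrite prodEFin lte_fin prodr_gt0.
Qed.

Definition vball : R := fine (mu B).

Lemma vballE : mu B = vball%:E.
Proof. by rewrite fineK// ge0_fin_numE ?ball1_lty. Qed.

Lemma vball_gt0 : 0 < vball.
Proof. by rewrite -lte_fin -vballE ball1_gt0. Qed.

Lemma lebesgue_eball (e : R) : 0 < e -> mu (eball e) = (e ^+ d * vball)%:E.
Proof.
move=> e0; rewrite EFinM -vballE -[LHS]mul1e -integral_cst; last exact: measurable_eball.
by rewrite (@integral_ball_scale e (cst 1%E))// integral_cst ?mul1e//; exact: measurable_ball1.
Qed.

Lemma lebesgue_eball_lty (e : R) : 0 < e -> (mu (eball e) < +oo)%E.
Proof. by move=> e0; rewrite lebesgue_eball// ltry. Qed.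

Lemma integrable_ball (g : 'rV[R]_d -> R) (M : R) : continuous g ->
  (forall x, B x -> `|g x| <= M) ->
  mu.-integrable B (EFin \o (g : borelRn R d -> R)).
Proof.
move=> cg gM; apply: measurable_bounded_integrable.
- exact: measurable_ball1.
- exact: ball1_lty.
- by apply: measurable_funTS; exact: continuous_measurable_real.
- exists M; split; first exact: num_real.
  by move=> y My x Bx; apply: le_trans (gM x Bx) (ltW My).
Qed.

(** Second moments of the unit ball. What enters later is their structure: zero off the diagonal by
    a reflection, constant on the diagonal by a transposition, and positive there. So the ball
    average of a quadratic form is a positive multiple of its trace. *)
Definition bmom (i j : 'I_d) : R :=
  fine (\int[mu]_(y in B) (((y : 'rV[R]_d) 0 i * (y : 'rV[R]_d) 0 j)%R%:E))%E.

Lemma continuous_coordM i j : continuous (fun y : 'rV[R]_d => y 0 i * y 0 j).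
Proof. by move=> y; exact: (cvgM (@coord_cts R d i y) (@coord_cts R d j y)). Qed.

Lemma ball_coordM_le i j y : B y -> `|y 0 i * y 0 j| <= 1.
Proof.
rewrite eballE// expr1n => y1.
have yi := le_lt_trans (sqr_coord_le y i) y1.
have yj := le_lt_trans (sqr_coord_le y j) y1.
rewrite normrM mulr_ile1//.
  by rewrite -(@expr_le1 _ 2)// real_normK ?num_real// ltW.
by rewrite -(@expr_le1 _ 2)// real_normK ?num_real// ltW.
Qed.

Lemma integrable_coordM i j :
  mu.-integrable B (EFin \o (fun y : borelRn R d => (y : 'rV[R]_d) 0 i * (y : 'rV[R]_d) 0 j)).
Proof.
exact: (integrable_ball (@continuous_coordM i j) (@ball_coordM_le i j)).
Qed.

Lemma bmomE i j :
  (\int[mu]_(y in B) (((y : 'rV[R]_d) 0 i * (y : 'rV[R]_d) 0 j)%R%:E))%E = (bmom i j)%:E.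
Proof.
by rewrite fineK//; apply: integrable_fin_num; [exact: measurable_ball1|exact: integrable_coordM].
Qed.

Lemma measurable_coordM i j : measurable_fun setT
  (fun y : borelRn R d => ((y : 'rV[R]_d) 0 i * (y : 'rV[R]_d) 0 j)%:E).
Proof.
by apply/measurable_EFinP; apply: continuous_measurable_real; exact: continuous_coordM.
Qed.

Lemma bmom_offdiag i j : i != j -> bmom i j = 0.
Proof.
move=> ij; have := bmomE i j.
rewrite -(@integral_ball_isometry (fun k => if k == i then -1 else 1) 1%g
   (fun y : borelRn R d => ((y : 'rV[R]_d) 0 i * (y : 'rV[R]_d) 0 j)%:E))//; last 2 first.
- by move=> k; case: ifP => _; rewrite ?normrN normr1.
- exact: measurable_coordM.
under eq_integral => y _.
  rewrite !mxE !perm1 eqxx eq_sym (negbTE ij) !addr0 mul1r mulN1r mulNr EFinN.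
  over.
rewrite integralN/=; last by apply: fin_num_adde_defr; rewrite integrable_pos_fin_num//; 
  [exact: measurable_ball1|exact: integrable_coordM].
by rewrite bmomE -EFinN => -[]; lra.
Qed.

Lemma bmom_diag i j : bmom i i = bmom j j.
Proof.
apply: EFin_inj; rewrite -!bmomE.
rewrite -(@integral_ball_isometry (fun=> 1) (tperm i j)
   (fun y : borelRn R d => ((y : 'rV[R]_d) 0 i * (y : 'rV[R]_d) 0 i)%:E))//; last 2 first.
- by move=> k; rewrite normr1.
- exact: measurable_coordM.
by apply: eq_integral => y _; rewrite !mxE tpermL mul1r addr0.
Qed.

(** The diagonal moments are equal, so it is enough that their sum, the integral of |y|^2 over the
    ball, be positive; it is at least 1/4 times the volume of the ball minus the concentric ball of
    radius 1/2. *)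
Lemma bmom_gt0 i : 0 < bmom i i.
Proof.
have d0 : (0 < d)%N by apply: leq_ltn_trans (ltn_ord i).
suff : 0 < \sum_j bmom j j.
  under eq_bigr do rewrite (bmom_diag _ i).
  by rewrite sumr_const card_ord pmulrn_lgt0.
rewrite -lte_fin -sumEFin.
under eq_bigr do rewrite -bmomE.
rewrite -ge0_integral_sum//; last 3 first.
- exact: measurable_ball1.
- by move=> j; apply: measurable_funTS; exact: measurable_coordM.
- by move=> j y _; rewrite lee_fin -expr2 sqr_ge0.
have mh := @measurable_eball (2^-1) ltac:(by rewrite invr_gt0).
have subh : eball 2^-1 `<=` B.
  move=> x; rewrite !eballE ?invr_gt0// expr1n => h; apply: (lt_trans h).
  by rewrite exprVn invf_lt1// expr2; lra.
have mBh : measurable (B `\` eball 2^-1 : set (borelRn R d)).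
  by apply: measurableD => //; exact: measurable_ball1.
apply: (@lt_le_trans _ _ (\int[mu]_(y in B `\` eball 2^-1) (4^-1)%:E)%E).
  rewrite integral_cst// mule_gt0// ?lte_fin ?invr_gt0//.
  rewrite measureD//; [|exact: measurable_ball1|exact: ball1_lty].
  rewrite setIidr// [X in (X - _)%E]vballE [X in (_ - X)%E]lebesgue_eball ?invr_gt0// -EFinB lte_fin subr_gt0.
  rewrite -{2}(mul1r vball) ltr_pM2r ?vball_gt0// exprVn invf_lt1 ?exprn_gt0//.
  by rewrite exprn_egt1// ?ltr1n// -lt0n.
apply: (@le_trans _ _ (\int[mu]_(y in B `\` eball 2^-1) (sqn (y : 'rV[R]_d))%:E)%E).
  apply: ge0_le_integral => //.
  - by apply/measurable_EFinP; apply: measurable_funTS; exact: measurable_sqn.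
  - move=> y [_]; rewrite eballE ?invr_gt0// => /negP; rewrite -leNgt lee_fin exprVn.
    by rewrite expr2 -natrM.
apply: (@le_trans _ _ (\int[mu]_(y in B) (sqn (y : 'rV[R]_d))%:E)%E).
  apply: ge0_subset_integral => //.
  - exact: measurable_ball1.
  - by apply/measurable_EFinP; apply: measurable_funTS; exact: measurable_sqn.
  - by move=> y _; rewrite lee_fin sqn_ge0.
rewrite le_eqVlt; apply/orP; left; apply/eqP; apply: eq_integral => y _.
by rewrite /sqn -sumEFin; apply: eq_bigr => j _; rewrite expr2.
Qed.

End ball.

(** * The generalised Laplacian and second differences *)

Section gen_laplacian_lower_bound.
Context {R : realType} {d : nat}.
Implicit Types (x y : 'rV[R]_d) (W : 'rV[R]_d -> \bar R).
Local Notation mu := (@lebesgue_Rn R d).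
Local Notation B := (@eball R d 1).

Definition quad (Q : 'I_d -> 'I_d -> R) y : R :=
  \sum_i \sum_j Q i j * (y 0 i * y 0 j).

Lemma quadZ Q (e : R) y : quad Q (e *: y) = e ^+ 2 * quad Q y.
Proof.
rewrite /quad mulr_sumr; apply: eq_bigr => i _; rewrite mulr_sumr.
by apply: eq_bigr => j _; rewrite !mxE; ring.
Qed.

Lemma continuous_quad Q : continuous (quad Q).
Proof.
apply: continuous_big => [|i _]; first exact: add_continuous.
apply: continuous_big => [|j _]; first exact: add_continuous.
by move=> y; exact: (cvgM (cvg_cst (Q i j)) (@continuous_coordM R d i j y)).
Qed.

Lemma integrable_quad Q : mu.-integrable B (EFin \o (quad Q : borelRn R d -> R)).
Proof.
rewrite (_ : _ \o _ = fun y : borelRn R d => (\sum_i \sum_j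
   (Q i j)%:E * ((y : 'rV[R]_d) 0%R i * (y : 'rV[R]_d) 0%R j)%:E)%E); last first.
  apply/funext => y /=; rewrite -sumEFin; apply: eq_bigr => i _.
  by rewrite -sumEFin; apply: eq_bigr => j _; rewrite EFinM.
apply: integrable_sum => [|i _]; first exact: measurable_ball1.
apply: integrable_sum => [|j _]; first exact: measurable_ball1.
apply: integrableZl; [exact: measurable_ball1|exact: integrable_coordM].
Qed.

Lemma integral_quad Q (i0 : 'I_d) :
  (\int[mu]_(y in B) (quad Q (y : 'rV[R]_d))%:E)%E = (bmom i0 i0 * \sum_i Q i i)%:E.
Proof.
have mB := @measurable_ball1 R d.
transitivity (\int[mu]_(y in B) (\sum_i \sum_j
   (Q i j)%:E * ((y : 'rV[R]_d) 0%R i * (y : 'rV[R]_d) 0%R j)%:E))%E.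
  apply: eq_integral => y _; rewrite -sumEFin; apply: eq_bigr => i _.
  by rewrite -sumEFin; apply: eq_bigr => j _; rewrite EFinM.
rewrite integral_sum//; last first.
  move=> i; apply: integrable_sum => // j _.
  by apply: integrableZl => //; exact: integrable_coordM.
rewrite mulr_sumr -sumEFin; apply: eq_bigr => i _.
rewrite integral_sum//; last first.
  by move=> j; apply: integrableZl => //; exact: integrable_coordM.
transitivity (\sum_(j < d) (Q i j * bmom i j)%:E)%E.
  apply: eq_bigr => j _; rewrite integralZl//; last exact: integrable_coordM.
  by rewrite bmomE -EFinM.
rewrite sumEFin; congr EFin.
rewrite (bigD1 i)//= big1 ?addr0; first by rewrite mulrC (bmom_diag i i0).
by move=> j ji; rewrite bmom_offdiag ?mulr0// eq_sym.
Qed.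

Lemma le_integral_EFin (p : borelRn R d -> R) (g : borelRn R d -> \bar R) :
  measurable_fun setT p -> measurable_fun setT g -> (forall y, B y -> 0 <= g y)%E ->
  (forall y, B y -> (p y)%:E <= g y)%E ->
  (\int[mu]_(y in B) (p y)%:E <= \int[mu]_(y in B) g y)%E.
Proof.
move=> mp mg g0 pg; have mB := @measurable_ball1 R d.
have mpE : measurable_fun (B : set (borelRn R d)) (EFin \o p).
  by apply/measurable_EFinP; exact: measurable_funTS.
rewrite integralE; apply: (@le_trans _ _ (\int[mu]_(y in B) (EFin \o p)^\+ y)%E).
  by rewrite -[leRHS]sube0; apply: leeB => //; apply: integral_ge0.
apply: ge0_le_integral => //; [exact: measurable_funepos|exact: measurable_funTS|].
by move=> y By; rewrite funeposE ge_max pg// g0.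
Qed.

(* Only symmetric second differences of [W] are controlled, so [W] itself may
   be discontinuous; the averages over the ball of [quad Q] reduce to the trace
   of [Q] by symmetry. *)
Lemma gen_laplacian_eps_ge W (k w0 C e : R) x0 Q (i0 : 'I_d) :
  lower_semicontinuous W -> 0 <= k -> (forall x, (- k)%:E <= W x)%E ->
  W x0 = w0%:E -> 0 <= C -> 0 < e < 1 ->
  (forall y, B y -> (2 * w0 + 2 * quad Q y - C * sqn y ^+ 2)%:E <= W (x0 + y)%R + W (x0 - y)%R)%E ->
  ((2 * (d + 2)%:R * (bmom i0 i0 / @vball R d) * (\sum_i Q i i) - (d + 2)%:R * C * e ^+ 2)%:E
    <= gen_laplacian_eps e W x0)%E.
Proof.
move=> lW k0 Wk Wx0 C0 /andP[e0 e1] WQ.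
have mB := @measurable_ball1 R d.
have mBe := @measurable_eball R d e e0.
have v0 := @vball_gt0 R d.
have mW (f : 'rV[R]_d -> 'rV[R]_d) : continuous f ->
    measurable_fun setT (fun y : borelRn R d => W (f y)).
  move=> cf; apply: (measurableT_comp (lsc_measurable lW)).
  exact: continuous_measurable_row.
have mWk (f : 'rV[R]_d -> 'rV[R]_d) : continuous f ->
    measurable_fun setT (fun y : borelRn R d => W (f y) + k%:E)%E.
  by move=> cf; exact: (emeasurable_funD (mW _ cf) (measurable_cst _)).
have cp : continuous (fun y : 'rV[R]_d => x0 + y).
  by rewrite (_ : (fun y => _) = fun y => x0 + 1 *: y); [exact: continuous_addZ|
    apply/funext => y; rewrite scale1r].
have cpe := @continuous_addZ R d x0 e.
have cme : continuous (fun y : 'rV[R]_d => x0 - e *: y).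
  by rewrite (_ : (fun y => _) = fun y => x0 + (- e) *: y); [exact: continuous_addZ|
    apply/funext => y; rewrite scaleNr].
have wge0 x : (0 <= W x + k%:E)%E.
  by rewrite -leeBlDr// sub0e -EFinN.
pose K := (\int[mu]_(y in B) (W (x0 + e *: (y : 'rV[R]_d))%R + k%:E))%E.
(* The ball is invariant under y -> -y, so [K + K] is an integral of symmetric second differences of
   [W]. *)
have KN : K = (\int[mu]_(y in B) (W (x0 - e *: (y : 'rV[R]_d))%R + k%:E))%E.
  rewrite /K -(@integral_ball_isometry _ _ (fun=> -1) 1%g)//.
  - apply: eq_integral => y _; congr (W _ + _)%E; congr (_ + _).
    by apply/rowP => i; rewrite !mxE perm1; ring.
  - by move=> _; rewrite normrN normr1.
  - exact: (mWk _ cpe).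
have JE : (\int[mu]_(y in eball e) W (x0 + (y : 'rV[R]_d))%R
    + (k * (e ^+ d * @vball R d))%:E = (e ^+ d)%:E * K)%E.
  rewrite EFinM -lebesgue_eball// -integral_shift//; last 2 first.
  - exact: lebesgue_eball_lty.
  - exact: (measurable_funTS (mW _ cp)).
  rewrite (@integral_ball_scale _ _ e (fun y : borelRn R d => W (x0 + (y : 'rV[R]_d))%R + k%:E)%E)//.
  exact: (mWk _ cp).
pose P := @vball R d * (2 * (w0 + k) - C * e ^+ 4) + 2 * e ^+ 2 * (bmom i0 i0 * \sum_i Q i i).
have KP : (P%:E <= K + K)%E.
  rewrite {2}KN -ge0_integralD//; last 2 first.
  - exact: (measurable_funTS (mWk _ cpe)).
  - exact: (measurable_funTS (mWk _ cme)).
  pose p (y : borelRn R d) : R := (2 * (w0 + k) - C * e ^+ 4) + 2 * e ^+ 2 * quad Q y.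
  have mq : measurable_fun setT (quad Q : borelRn R d -> measurableTypeR R).
    by apply: continuous_measurable_real; exact: continuous_quad.
  have -> : P%:E = (\int[mu]_(y in B) (p y)%:E)%E.
    rewrite /p; under eq_integral do rewrite EFinD EFinM.
    rewrite integralD//; last 2 first.
    - have cc : continuous (fun _ : 'rV[R]_d => 2 * (w0 + k) - C * e ^+ 4).
        exact: cst_continuous.
      exact: (integrable_ball cc (fun x _ => lexx _)).
    - by apply: integrableZl => //; exact: integrable_quad.
    rewrite integral_cst// integralZl//; last exact: integrable_quad.
    by rewrite [X in (_ + _ * X)%E](integral_quad Q i0) [X in (_ * X + _)%E]vballE -!EFinM -EFinD /P; congr EFin; ring.
  apply: le_integral_EFin.
  - by apply: measurable_funD => //; apply: measurable_funM.
  - exact: (emeasurable_funD (mWk _ cpe) (mWk _ cme)).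
  - by move=> y _; apply: adde_ge0.
  move=> y By.
  have Bey : B (e *: y).
    move: By; rewrite !eballE// sqnZ expr1n => y1.
    have := sqn_ge0 y; nra.
  have := WQ _ Bey; rewrite quadZ sqnZ => h.
  rewrite addeACA -EFinD.
  apply: le_trans (leeD h (lexx _)).
  rewrite -EFinD lee_fin /p.
  have s1 : sqn y ^+ 2 <= 1.
    by move: By; rewrite eballE// expr1n => /ltW ?; rewrite expr_le1// sqn_ge0.
  have : C * e ^+ 4 * sqn y ^+ 2 <= C * e ^+ 4.
    by apply: ler_piMr => //; rewrite mulr_ge0// exprn_ge0// ltW.
  lra.
rewrite /gen_laplacian_eps lebesgue_eball// Wx0.
have c0 : 0 < 2 * (d + 2)%:R / e ^+ 2 :> R.
  by rewrite divr_gt0 ?exprn_gt0// mulr_gt0// ltr0n addn2.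
have K0 : (0 <= K)%E by apply: integral_ge0 => y _; exact: wge0.
have ed0 : 0 < e ^+ d by rewrite exprn_gt0.
set I := (\int[mu]_(y in eball e) _)%E in JE *.
have IE : I = ((e ^+ d)%:E * K - (k * (e ^+ d * @vball R d))%:E)%E.
  by rewrite -JE addeK.
rewrite IE.
(* If the mean of [W] over the ball is infinite, the difference quotient is [+oo] and the bound is
   trivial. *)
move: K0 KP; case: K {IE JE KN} => [r| |]// r0 rP; last first.
  rewrite gt0_muley ?lte_fin// addye// gt0_muley ?lte_fin ?invr_gt0 ?mulr_gt0//.
  by rewrite addye// gt0_muley ?lte_fin// leey.
move: rP; rewrite -EFinD lee_fin => rP.
rewrite -!(EFinM, EFinB) lee_fin.
rewrite (_ : (e ^+ d * @vball R d)^-1 * (e ^+ d * r - k * (e ^+ d * @vball R d))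
   = r / @vball R d - k); last by field; rewrite !gt_eqF.
have -> : 2 * (d + 2)%:R * (bmom i0 i0 / @vball R d) * \sum_i Q i i - (d + 2)%:R * C * e ^+ 2
  = 2 * (d + 2)%:R / e ^+ 2 * (P / 2 / @vball R d - k - w0).
  by rewrite /P; field; rewrite !gt_eqF.
rewrite ler_pM2l// !lerD2r ler_pM2r ?invr_gt0//.
lra.
Qed.

Lemma gen_laplacian_ge W (k w0 C : R) x0 Q (i0 : 'I_d) :
  lower_semicontinuous W -> 0 <= k -> (forall x, (- k)%:E <= W x)%E ->
  W x0 = w0%:E -> 0 <= C ->
  (forall y, B y -> (2 * w0 + 2 * quad Q y - C * sqn y ^+ 2)%:E <= W (x0 + y)%R + W (x0 - y)%R)%E ->
  ((2 * (d + 2)%:R * (bmom i0 i0 / @vball R d) * (\sum_i Q i i))%:E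
    <= gen_laplacian W x0)%E.
Proof.
move=> lW k0 Wk Wx0 C0 WQ; rewrite /gen_laplacian limf_einfE.
apply/lee_subgt0Pr => eta eta0.
(* For e < 1 the error (d+2) C e^2 is at most D e, which is below eta once e < eta / D; the added 1
   keeps [D] positive when C = 0. *)
pose D : R := (d + 2)%:R * C + 1.
have D0 : 0 < D by rewrite ltr_wpDl// mulr_ge0.
pose del := Num.min 1 (eta / D).
have del0 : 0 < del by rewrite lt_min ltr01 divr_gt0.
apply: (@le_trans _ _ (ereal_inf ((fun e : R => gen_laplacian_eps e W x0) @` [set e | 0 < e < del]))).
  apply: le_ereal_inf_tmp => _ [e /= /andP[e0 ed] <-].
  have [e1 eD] : e < 1 /\ e < eta / D by move: ed; rewrite lt_min => /andP.
  apply: le_trans (gen_laplacian_eps_ge i0 lW k0 Wk Wx0 C0 _ WQ); last by rewrite e0.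
  rewrite -EFinB lee_fin lerD2l lerN2.
  apply: (@le_trans _ _ (D * e)); last by rewrite mulrC -ler_pdivlMr// ltW.
  have : 0 <= (d + 2)%:R * C by rewrite mulr_ge0.
  move=> A0; rewrite expr2 mulrA ler_wpM2r ?(ltW e0)// /D.
  by rewrite (le_trans (ler_piMr A0 (ltW e1)))// lerDl.
apply: ereal_sup_ubound; exists [set e | 0 < e < del] => //.
have h1 := nbhs_right_gt (0 : R); have h2 := nbhs_right_lt del0.
near=> t; apply/andP; split; near: t => //.
Unshelve. all: by end_near. Qed.

End gen_laplacian_lower_bound.

(** * Heat kernel, heat potentials and the comparison principle *)

Section exponential_bounds.
Context {R : realType}.
Implicit Types (u v : R).

Lemma expR_ge1DxDx2 v : 0 <= v -> 1 + v + v ^+ 2 / 2 <= expR v.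
Proof.
move=> v0; rewrite /expR.
have := nondecreasing_cvgn_le _ (is_cvg_series_exp_coeff v) 0.+3%N.
rewrite [X in X <= _](_ : _ = 1 + v + v ^+ 2 / 2); last first.
  rewrite !seriesSr seriesEnat/= big_nil add0r /exp_coeff/=.
  by rewrite !factE/= expr0 expr1 divr1 divr1.
apply; apply/nondecreasing_seqP => n.
by rewrite -subr_ge0 seriesSB; exact: exp_coeff_ge0.
Qed.

(** With v = u/2 one has 2 cosh u = 2 + (exp v - exp (-v))^2, which reduces the claim to exp v - exp
    (-v) >= u for u >= 0; this follows from the quadratic lower bound on exp v. *)
Lemma expR_cosh_ge u : 2 + u ^+ 2 <= expR u + expR (- u).
Proof.
wlog u0 : u / 0 <= u => [hw|].
  have [/hw//|/ltW u0] := leP 0 u.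
  by have := hw (- u); rewrite oppr_ge0 sqrrN opprK [expR (- u) + _]addrC; exact.
set v := u / 2.
have v0 : 0 <= v by rewrite divr_ge0.
have uE : u = v + v by rewrite /v; lra.
have E : expR u + expR (- u) = 2 + (expR v - expR (- v)) ^+ 2.
  rewrite uE opprD !expRD; have := expRxMexpNx_1 v.
  set a := expR v; set b := expR (- v) => ab.
  by rewrite sqrrB -mulr_natl [a * b]ab; ring.
rewrite E lerD2l.
suff h : u <= expR v - expR (- v).
  by rewrite lerXn2r ?nnegrE// (le_trans u0 h).
have h1 := expR_ge1DxDx2 v0.
have h2 := expRxMexpNx_1 v.
have h3 := expR_gt0 v; have h4 := expR_gt0 (- v).
set a := expR v in h1 h2 h3 *; set b := expR (- v) in h2 h4 *.
set s : R := 1 + v + v ^+ 2 / 2 in h1.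
have s1 : 1 <= s by rewrite /s; nra.
have bs : b * s <= 1 by rewrite -h2 mulrC ler_wpM2r ?(ltW h4).
have ss : 1 + u * s <= s ^+ 2 by rewrite uE /s; nra.
have : u + b <= s.
  rewrite -(@ler_pM2r _ s); last lra.
  by rewrite mulrDl; lra.
lra.
Qed.

Lemma expR_mulN_le1 u : u * expR (- u) <= 1.
Proof.
rewrite expRN ler_pdivrMr ?expR_gt0// mul1r.
by apply: le_trans (expR_ge1Dx u); lra.
Qed.

End exponential_bounds.

Section heat_kernel.
Context {R : realType} {d : nat}.
Implicit Types (x y z : 'rV[R]_d) (t tau : R).

Definition dotp x y : R := \sum_i x 0 i * y 0 i.

Lemma sqnD x y : sqn (x + y) = sqn x + 2 * dotp x y + sqn y.
Proof.
rewrite /sqn /dotp mulr_sumr -!big_split/=; apply: eq_bigr => i _.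
by rewrite mxE; ring.
Qed.

Lemma dotpNr x y : dotp x (- y) = - dotp x y.
Proof. by rewrite /dotp -sumrN; apply: eq_bigr => i _; rewrite mxE mulrN. Qed.

Lemma sqnB x y : sqn (x - y) = sqn x - 2 * dotp x y + sqn y.
Proof. by rewrite sqnD dotpNr sqnN; ring. Qed.

Lemma dotpZr x y (a : R) : dotp x (a *: y) = a * dotp x y.
Proof.
by rewrite /dotp mulr_sumr; apply: eq_bigr => i _; rewrite mxE; ring.
Qed.

Lemma dotp_sqr_le x y : dotp x y ^+ 2 <= sqn x * sqn y.
Proof.
have [y0|y0] := eqVneq (sqn y) 0.
  (* When |y|^2 = 0 this nonnegative quantity equals -(|x|^2 + 2) (x.y)^2, which forces x.y = 0. *)
  have : 0 <= sqn (dotp x y *: x - (sqn x + 1) *: y) by exact: sqn_ge0.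
  rewrite sqnB dotpZr !sqnZ y0.
  have -> : dotp (dotp x y *: x) y = dotp x y ^+ 2.
    by rewrite /dotp expr2 mulr_sumr; apply: eq_bigr => i _; rewrite mxE; ring.
  have := sqn_ge0 x; have := sqr_ge0 (dotp x y); nra.
have y1 : 0 < sqn y by rewrite lt0r y0 sqn_ge0.
have : 0 <= sqn (x - (dotp x y / sqn y) *: y) by exact: sqn_ge0.
rewrite sqnB dotpZr sqnZ => h.
rewrite -subr_ge0.
rewrite (_ : _ - _ = sqn y * (sqn x - 2 * (dotp x y / sqn y * dotp x y) +
  (dotp x y / sqn y) ^+ 2 * sqn y)); first by rewrite mulr_ge0// ltW.
by field.
Qed.

Lemma dotp_le x y (e : R) : 0 < e -> 2 * dotp x y <= e * sqn x + sqn y / e.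
Proof.
move=> e0; have : 0 <= sqn (x - e^-1 *: y) by exact: sqn_ge0.
rewrite sqnB dotpZr sqnZ => h.
rewrite -subr_ge0 (_ : _ - _ = e * (sqn x - 2 * (e^-1 * dotp x y) + e^-1 ^+ 2 * sqn y)).
  by rewrite mulr_ge0// ltW.
by field; rewrite gt_eqF.
Qed.

(* Without normalising constant and with the time scale of
   [exp (- |x|^2 / t)], so that the heat equation reads [4 dg/dt = Laplacian g]. *)
Definition gk t x : R := (Num.sqrt t)^-1 ^+ d * expR (- (sqn x / t)).

Lemma gk_ge0 t x : 0 <= gk t x.
Proof. by rewrite mulr_ge0 ?expR_ge0// exprn_ge0// invr_ge0 sqrtr_ge0. Qed.

Lemma gk_pref_ge0 t : 0 <= (Num.sqrt t)^-1 ^+ d :> R.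
Proof. by rewrite exprn_ge0// invr_ge0 sqrtr_ge0. Qed.

Lemma gk_le t x : 0 < t -> gk t x <= (Num.sqrt t)^-1 ^+ d.
Proof.
move=> t0; apply: ler_piMr; first exact: gk_pref_ge0.
by rewrite expR_le1 oppr_le0 divr_ge0 ?sqn_ge0// ltW.
Qed.

(** From u exp (-u) <= 1 with u = |x|^2 / t. This is what makes the expansions of the kernel below
    uniform in [x]: every factor |x|^2 / t is absorbed by the kernel. *)
Lemma gk_sqn_le t x : gk t x * (sqn x / t) <= (Num.sqrt t)^-1 ^+ d.
Proof.
rewrite /gk -mulrA; apply: ler_piMr; first exact: gk_pref_ge0.
by rewrite mulrC; exact: expR_mulN_le1.
Qed.

(* The term [gk t x * (2 (x.y / t)^2 - |y|^2 / t)] is half the Hessian of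
   [gk t] at [x] evaluated at [y]. *)
Lemma gkDB t x y : 0 < t ->
  2 * gk t x + 2 * (gk t x * (2 * (dotp x y / t) ^+ 2 - sqn y / t))
    - 4 * (Num.sqrt t)^-1 ^+ d / t ^+ 2 * sqn y ^+ 2
  <= gk t (x + y) + gk t (x - y).
Proof.
move=> t0.
set B := sqn x / t; set Y := sqn y / t; set D := dotp x y / t; set s := _^-1 ^+ d.
have B0 : 0 <= B by rewrite divr_ge0 ?sqn_ge0// ltW.
have Y0 : 0 <= Y by rewrite divr_ge0 ?sqn_ge0// ltW.
have DBY : D ^+ 2 <= B * Y.
  rewrite /D /B /Y (_ : sqn x / t * (sqn y / t) = (sqn x * sqn y) / t ^+ 2); last first.
    by field; rewrite gt_eqF.
  by rewrite expr_div_n ler_pM2r ?invr_gt0 ?exprn_gt0//; exact: dotp_sqr_le.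
have g0 := gk_ge0 t x.
have gB : gk t x * B <= s by exact: gk_sqn_le.
have -> : gk t (x + y) = gk t x * (expR (- Y) * expR (- (2 * D))).
  rewrite /gk -mulrA -!expRD; congr (_ * expR _).
  by rewrite sqnD /D /Y; field; rewrite gt_eqF.
have -> : gk t (x - y) = gk t x * (expR (- Y) * expR (2 * D)).
  rewrite /gk -mulrA -!expRD; congr (_ * expR _).
  by rewrite sqnB /D /Y; field; rewrite gt_eqF.
have c := expR_cosh_ge (2 * D).
have eY := expR_ge1Dx (- Y).
set eD := expR (2 * D) in c *; set eD' := expR (- (2 * D)) in c *.
set E := expR (- Y) in eY *.
have E0 : 0 <= E by exact: expR_ge0.
(* The symmetric sum is [gk t x] times exp (-Y) times 2 cosh (2D), and the bound also holds when 1 -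
   Y is negative. Expanding the left side gives the second-order part minus 4 Y D^2; Cauchy-Schwarz
   and [gk_sqn_le] turn this last term into the quartic error. *)
have h1 : (1 - Y) * (2 + (2 * D) ^+ 2) <= E * (eD + eD').
  apply: (@le_trans _ _ (E * (2 + (2 * D) ^+ 2))).
    by rewrite ler_wpM2r//; have := sqr_ge0 (2 * D); lra.
  by rewrite ler_wpM2l.
have h2 : gk t x * ((1 - Y) * (2 + (2 * D) ^+ 2)) <= gk t x * (E * (eD + eD')).
  by rewrite ler_wpM2l.
have h3 : gk t x * (Y * D ^+ 2) <= s * Y ^+ 2.
  apply: (@le_trans _ _ (gk t x * B * Y ^+ 2)).
    rewrite -mulrA ler_wpM2l// (_ : B * Y ^+ 2 = Y * (B * Y)); last by ring.
    by rewrite ler_wpM2l.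
  by rewrite ler_wpM2r// sqr_ge0.
have -> : 4 * s / t ^+ 2 * sqn y ^+ 2 = 4 * (s * Y ^+ 2).
  by rewrite /Y; field; rewrite gt_eqF.
move: h2 h3; set g := gk t x; set G := s * Y ^+ 2.
lra.
Qed.

(** A modulus of continuity uniform in [x]. The quotient of the kernels is exp (-(2D + Y)) >= 1 - 2D
    - Y; Young's inequality with parameter [e] splits 2D into e |x|^2 / t, absorbed by the kernel,
    and a multiple of |y|^2 / t. *)
Lemma gk_ge t x y (e : R) : 0 < t -> 0 < e ->
  gk t x - (Num.sqrt t)^-1 ^+ d * (e + sqn y / t * (1 + e^-1)) <= gk t (x + y).
Proof.
move=> t0 e0; set s := _^-1 ^+ d.
set B := sqn x / t; set Y := sqn y / t; set D := dotp x y / t.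
have Y0 : 0 <= Y by rewrite divr_ge0 ?sqn_ge0// ltW.
have s0 : 0 <= s by exact: gk_pref_ge0.
have DB : 2 * D <= e * B + Y / e.
  rewrite /D /B /Y -(ler_pM2r t0).
  rewrite (_ : 2 * _ * t = 2 * dotp x y); last by field; rewrite gt_eqF.
  rewrite (_ : (_ + _) * t = e * sqn x + sqn y / e); last by field; rewrite !gt_eqF.
  exact: dotp_le.
have g0 := gk_ge0 t x; have gB : gk t x * B <= s by exact: gk_sqn_le.
have gs : gk t x <= s by exact: gk_le.
have -> : gk t (x + y) = gk t x * expR (- (2 * D + Y)).
  rewrite /gk -mulrA -!expRD; congr (_ * expR _).
  by rewrite sqnD /D /Y; field; rewrite gt_eqF.
have h := expR_ge1Dx (- (2 * D + Y)).
apply: (@le_trans _ _ (gk t x * (1 - (e * B + Y / e + Y)))); last first.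
  by rewrite ler_wpM2l//; apply: le_trans h; lra.
have h2 : gk t x * B * e <= s * e by rewrite ler_wpM2r// ltW.
have Ye : 0 <= Y * (1 + e^-1) by rewrite mulr_ge0// addr_ge0// invr_ge0 ltW.
have h3 : gk t x * (Y * (1 + e^-1)) <= s * (Y * (1 + e^-1)) by rewrite ler_wpM2r.
move: h2 h3; rewrite mulrDr mulr1; set g := gk t x; lra.
Qed.

(** With th = tau / t and B = |x|^2 / t, the quotient of the kernel at t - tau by the one at t is (1
    - th)^(-d/2) exp (-B th / (1 - th)). The bounds 1 - th <= exp (-th) and, for th <= 1/2, 1/(1 -
    th) <= 1 + th + 2 th^2, followed by exp u >= 1 + u, leave tau times the time derivative and an
    error quadratic in th. *)
Lemma gk_time t tau x : 0 < tau -> tau <= t / 2 ->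
  gk t x - gk (t - tau) x <=
  tau / t * (gk t x * (sqn x / t - d%:R / 2)) + 2 * (tau / t) ^+ 2 * (Num.sqrt t)^-1 ^+ d.
Proof.
move=> tau0 taut.
have t0 : 0 < t by lra.
set th := tau / t; set B := sqn x / t; set s := _^-1 ^+ d.
have th0 : 0 < th by rewrite divr_gt0.
have th1 : th <= 2^-1 by rewrite /th ler_pdivrMr//; lra.
have B0 : 0 <= B by rewrite divr_ge0 ?sqn_ge0// ltW.
have tE : t - tau = t * (1 - th) by rewrite /th; field; rewrite gt_eqF.
have g0 := gk_ge0 t x; have gB : gk t x * B <= s by exact: gk_sqn_le.
have t'0 : 0 < t - tau by lra.
have h1 : gk t x * expR (th * (d%:R / 2) - B * th - 2 * B * th ^+ 2) <= gk (t - tau) x.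
  have -> : gk t x * expR (th * (d%:R / 2) - B * th - 2 * B * th ^+ 2) =
    (s * expR (th / 2 * d%:R)) * expR (- B - B * th - 2 * B * th ^+ 2).
    by rewrite /gk -!mulrA -!expRD; congr (_ * expR _); rewrite /B; ring.
  rewrite /gk; apply: ler_pM.
  - by rewrite mulr_ge0 ?expR_ge0//; exact: gk_pref_ge0.
  - exact: expR_ge0.
  - rewrite expRM_natr /s -exprMn lerXn2r ?nnegrE//.
    rewrite mulrC ler_pdivrMr ?sqrtr_gt0// -ler_pdivrMl ?invr_gt0 ?sqrtr_gt0// invrK.
    rewrite -(@ler_pXn2r _ 2)// ?nnegrE ?mulr_ge0 ?sqrtr_ge0 ?expR_ge0//.
    rewrite exprMn !sqr_sqrtr ?(ltW t0) ?(ltW t'0)// tE mulrC -expRM_natl.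
    rewrite (_ : 2%:R * (th / 2) = th); last by field.
    apply: (@le_trans _ _ (expR th * (t * expR (- th)))).
      rewrite ler_wpM2l ?expR_ge0// ler_wpM2l ?(ltW t0)//.
      by have := expR_ge1Dx (- th); lra.
    by rewrite mulrCA expRxMexpNx_1 mulr1.
  - rewrite ler_expR tE.
    have -> : sqn x / (t * (1 - th)) = B / (1 - th).
      by rewrite /B; field; rewrite !gt_eqF//; lra.
    suff : B / (1 - th) <= B + B * th + 2 * B * th ^+ 2 by lra.
    rewrite ler_pdivrMr; last lra.
    rewrite -subr_ge0 (_ : _ - _ = B * th ^+ 2 * (1 - 2 * th)); last by ring.
    have h5 : 0 <= 1 - 2 * th by lra.
    exact: mulr_ge0 (mulr_ge0 B0 (sqr_ge0 th)) h5.
have h2 := expR_ge1Dx (th * (d%:R / 2) - B * th - 2 * B * th ^+ 2).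
have h3 : gk t x * (1 + (th * (d%:R / 2) - B * th - 2 * B * th ^+ 2)) <= gk (t - tau) x.
  by apply: le_trans h1; rewrite ler_wpM2l.
have h4 : gk t x * B * th ^+ 2 <= s * th ^+ 2 by rewrite ler_wpM2r// sqr_ge0.
move: h3 h4; set g := gk t x; set g' := gk (t - tau) x; lra.
Qed.

End heat_kernel.

(** * Minimisers of lower semicontinuous functions *)

Section lsc_minimum.
Context {R : realType} {d : nat}.
Implicit Types (F : 'rV[R]_d -> \bar R) (A : set 'rV[R]_d).

Lemma seq_argmin (T : eqType) (F : T -> \bar R) (s : seq T) (x : T) : x \in s ->
  exists2 y, y \in s & forall z, z \in s -> (F y <= F z)%E.
Proof.
elim: s x => // a s ih x _; case: s ih => [_|b s /(_ b) ih].
  by exists a; rewrite ?mem_head// => z; rewrite inE => /eqP ->.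
have [|y ys yle] := ih; first exact: mem_head.
have [ay|/ltW ya] := leP (F a) (F y).
  exists a; first exact: mem_head.
  by move=> z; rewrite inE => /predU1P[->//|/yle]; exact: le_trans.
exists y; first by rewrite inE ys orbT.
by move=> z; rewrite inE => /predU1P[->//|/yle].
Qed.

(** Without a minimiser, the open sets where F exceeds F(y), for y in A, cover A. In a finite
    subcover, the y with the least value of F lies in none of the sets. *)
Lemma lsc_compact_min F A (k : R) : compact A -> A !=set0 ->
  lower_semicontinuous F -> (forall x, k%:E <= F x)%E ->
  exists2 x, A x & forall y, A y -> (F x <= F y)%E.
Proof.
move=> cA [a Aa] lF Fk; apply: contrapT => noF.
have {}noF x : A x -> exists2 y, A y & (F y < F x)%E.
  move=> Ax; apply: contrapT => h; apply: noF; exists x => // y Ay.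
  by rewrite leNgt; apply/negP => yx; apply: h; exists y.
have oF y : A y -> open [set x | (F y < F x)%E].
  move=> Ay; have := Fk y; case: (F y) => [r| |]// _; last first.
    rewrite (_ : [set x | _] = set0); first exact: open0.
    by apply/seteqP; split => x //=; rewrite ltNge leey.
  by move/lower_semicontinuousP : lF; exact.
move: cA; rewrite compact_cover => /(_ _ A (fun y => [set x | (F y < F x)%E]) oF).
case; first by move=> x /noF[y Ay yx]; exists y.
move=> D DA AD.
have [b /= Db _] := AD _ Aa.
have [y Dy yle] := @seq_argmin _ F (finmap.enum_fset D) b Db.
have Ay : A y by have := DA _ Dy => /set_mem.
have [z /= Dz zy] := AD _ Ay.
by have := yle _ Dz; rewrite leNgt zy.
Qed.

Lemma norm_sqr_le_sqn (x : 'rV[R]_d) : `|x| ^+ 2 <= sqn x.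
Proof.
rewrite -[leRHS]sqr_sqrtr ?sqn_ge0// lerXn2r ?nnegrE ?sqrtr_ge0//.
apply: norm_row_le; first exact: sqrtr_ge0.
by move=> i; rewrite -sqrtr_sqr ler_wsqrtr// sqr_coord_le.
Qed.

Lemma lsc_coercive_min F (x1 : 'rV[R]_d) (k g : R) : lower_semicontinuous F ->
  0 < g -> (forall x, (g * sqn x - k)%:E <= F x)%E -> (F x1 < +oo)%E ->
  exists x, forall y, (F x <= F y)%E.
Proof.
move=> lF g0 Fk Fx1.
have [m Fx1m] : exists m : R, (F x1 <= m%:E)%E.
  by move: Fx1; case: (F x1) => [r _|//|_]; [exists r|exists 0; rewrite leNye].
(* Outside the ball of radius [rho] the quadratic lower bound exceeds m >= F(x1), so minimising over
   the ball is enough; rho >= 1 is what allows rho <= rho^2. *)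
pose rho : R := `|(k + m) / g| + 1.
have rho1 : 1 <= rho by rewrite lerDr.
pose A : set 'rV[R]_d := [set x | `|x| <= rho].
have Aout x : ~ A x -> (m%:E < F x)%E.
  move=> /negP; rewrite -ltNge => xrho.
  apply: lt_le_trans (Fk x); rewrite lte_fin.
  have h1 : rho < sqn x.
    apply: lt_le_trans (norm_sqr_le_sqn x).
    apply: (@le_lt_trans _ _ (rho ^+ 2)); first by rewrite expr2 ler_peMl//; lra.
    by rewrite ltrXn2r//; lra.
  have h2 : (k + m) / g < sqn x.
    by apply: le_lt_trans h1; apply: le_trans (ler_norm _) _; rewrite lerDl.
  by move: h2; rewrite ltr_pdivrMr// mulrC => h2; lra.
have Ax1 : A x1 by apply: contrapT => /Aout; rewrite ltNge Fx1m.
have cA : compact A.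
  apply: bounded_closed_compact.
    by exists rho; split; [exact: num_real|move=> M rM x Ax; exact: le_trans Ax (ltW rM)].
  apply: (@closed_comp _ _ (fun x : 'rV[R]_d => `|x|) [set r | r <= rho]).
    by move=> x _; exact: norm_continuous.
  exact: closed_le.
have [|x Ax xmin] := @lsc_compact_min F A (- k) cA (ex_intro _ x1 Ax1) lF.
  by move=> x; apply: le_trans (Fk x); rewrite lee_fin lerDr mulr_ge0 ?sqn_ge0// ltW.
exists x => y; have [Ay|/Aout my] := pselect (A y); first exact: xmin.
exact: le_trans (xmin _ Ax1) (le_trans Fx1m (ltW my)).
Qed.

End lsc_minimum.

(** * Heat potentials of finite measures *)

Section heat_potential.
Context {R : realType} {d : nat} (nu : {finite_measure set (borelRn R d) -> \bar R}).
Implicit Types (x y z : 'rV[R]_d) (t tau : R) (f g : 'rV[R]_d -> R).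

(** Bounded continuous functions are integrable for the finite measure [nu]; closure of this class
    under sums and multiples discharges the integrability conditions of the linearity lemmas. *)
Definition bcont f := continuous f /\ exists M, forall z, `|f z| <= M.

Lemma bcont_integrable f : bcont f -> nu.-integrable setT (EFin \o (f : borelRn R d -> R)).
Proof.
move=> [cf [M fM]]; apply: measurable_bounded_integrable => //.
- by rewrite -ge0_fin_numE//; exact: fin_num_measure.
- exact: continuous_measurable_real.
- by exists M; split; [exact: num_real|move=> y My x _; exact: le_trans (fM x) (ltW My)].
Qed.

Lemma bcont_cst (c : R) : bcont (fun=> c).
Proof. by split; [exact: cst_continuous|exists `|c|]. Qed.

Lemma bcontD f g : bcont f -> bcont g -> bcont (fun z => f z + g z).
Proof.
move=> [cf [M fM]] [cg [N gN]]; split; first by move=> x; exact: (cvgD (cf x) (cg x)).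
by exists (M + N) => z; apply: le_trans (ler_normD _ _) _; rewrite lerD.
Qed.

Lemma bcontZ (c : R) f : bcont f -> bcont (fun z => c * f z).
Proof.
move=> [cf [M fM]]; split; first by move=> x; exact: (cvgM (cvg_cst c) (cf x)).
by exists (`|c| * M) => z; rewrite normrM ler_wpM2l.
Qed.

Lemma bcont_sum (I : finType) (f : I -> 'rV[R]_d -> R) : (forall i, bcont (f i)) ->
  bcont (fun z => \sum_i f i z).
Proof.
move=> bf; elim: (index_enum I) => [|i s ih].
  by rewrite (_ : (fun z => _) = fun=> 0); [exact: bcont_cst|apply/funext => z; rewrite big_nil].
rewrite (_ : (fun z => _) = fun z => f i z + \sum_(j <- s) f j z); first exact: bcontD.
by apply/funext => z; rewrite big_cons.
Qed.

Local Notation J f := (\int[nu]_z (f : borelRn R d -> R) z).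

Lemma RintegralD_bcont f g : bcont f -> bcont g -> J (fun z => f z + g z) = J f + J g.
Proof. by move=> bf bg; rewrite RintegralD//; exact: bcont_integrable. Qed.

Lemma RintegralZ_bcont (c : R) f : bcont f -> J (fun z => c * f z) = c * J f.
Proof. by move=> bf; rewrite RintegralZl//; exact: bcont_integrable. Qed.

Lemma Rintegral_cst_setT (c : R) : J (fun=> c) = c * fine (nu setT).
Proof. by rewrite Rintegral_cst. Qed.

Lemma le_Rintegral_bcont f g : bcont f -> bcont g -> (forall z, f z <= g z) -> J f <= J g.
Proof. by move=> bf bg fg; apply: le_Rintegral => //; exact: bcont_integrable. Qed.

Lemma Rintegral_sum_bcont (I : finType) (f : I -> 'rV[R]_d -> R) : (forall i, bcont (f i)) ->
  J (fun z => \sum_i f i z) = \sum_i J (f i).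
Proof.
move=> bf; elim: (index_enum I) => [|i s ih].
  by rewrite big_nil; under eq_Rintegral do rewrite big_nil; rewrite Rintegral_cst_setT mul0r.
rewrite big_cons -ih -RintegralD_bcont//; last first.
  rewrite (_ : (fun z => _) = fun z => \sum_(j <- s) f j z)//.
  elim: s {ih} => [|j s ih].
    by rewrite (_ : (fun z => _) = fun=> 0); [exact: bcont_cst|apply/funext => z; rewrite big_nil].
  rewrite (_ : (fun z => _) = fun z => f j z + \sum_(l <- s) f l z); first exact: bcontD.
  by apply/funext => z; rewrite big_cons.
by apply: eq_Rintegral => z _; rewrite big_cons.
Qed.

Lemma continuousMR f g : continuous f -> continuous g -> continuous (fun x => f x * g x).
Proof. by move=> cf cg x; exact: (cvgM (cf x) (cg x)). Qed.

Lemma continuousDR f g : continuous f -> continuous g -> continuous (fun x => f x + g x).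
Proof. by move=> cf cg x; exact: (cvgD (cf x) (cg x)). Qed.

Lemma continuous_gk t : continuous (gk t : 'rV[R]_d -> R).
Proof.
apply: (@continuousMR (fun=> _) (fun x => expR (- (sqn x / t)))).
  exact: cst_continuous.
move=> x; apply: (@continuous_comp _ _ _ (fun x : 'rV[R]_d => - (sqn x / t)) expR).
  rewrite (_ : (fun x => _) = fun x => (- t^-1) * sqn x).
    exact: (continuousMR (@cst_continuous _ _ (- t^-1)) (@continuous_sqn R d)).
  by apply/funext => y; rewrite mulNr mulrC.
exact: continuous_expR.
Qed.

Lemma continuous_subl x : continuous (fun z : 'rV[R]_d => x - z).
Proof.
rewrite (_ : (fun z => _) = fun z => x + (-1) *: z); first exact: continuous_addZ.
by apply/funext => z; rewrite scaleN1r.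
Qed.

Lemma continuous_comp_subl x (f : 'rV[R]_d -> R) : continuous f ->
  continuous (fun z => f (x - z)).
Proof.
move=> cf z; apply: (@cvg_comp _ _ _ (fun z => x - z) f _ (nbhs (x - z))).
  exact: continuous_subl.
exact: cf.
Qed.

Lemma bcont_subl x (f : 'rV[R]_d -> R) : bcont f -> bcont (fun z => f (x - z)).
Proof.
move=> [cf [M fM]]; split; first exact: continuous_comp_subl.
by exists M.
Qed.

Lemma bcont_gk t : 0 < t -> bcont (gk t).
Proof.
move=> t0; split; first exact: continuous_gk.
by exists ((Num.sqrt t)^-1 ^+ d) => z; rewrite ger0_norm ?gk_ge0// gk_le.
Qed.

(** Half the Hessian of [gk t], so that [quad] of it is the second-order Taylor term. *)
Definition gkQ t i j x : R :=
  gk t x * (2 * (x 0 i / t) * (x 0 j / t) - (i == j)%:R / t).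

Lemma bcont_gkQ t i j : 0 < t -> bcont (gkQ t i j).
Proof.
move=> t0; split.
  rewrite (_ : gkQ t i j = fun x => gk t x *
      (2 / t / t * (x 0 i * x 0 j) + (- ((i == j)%:R / t)))); last first.
    by apply/funext => x; rewrite /gkQ; congr (_ * (_ + _)); ring.
  apply: (continuousMR (@continuous_gk t)).
  apply: (continuousDR _ (@cst_continuous _ _ (- ((i == j)%:R / t)))).
  exact: (continuousMR (@cst_continuous _ _ (2 / t / t)) (@continuous_coordM R d i j)).
set s := (Num.sqrt t)^-1 ^+ d.
exists (s * (3 / t)) => x; rewrite /gkQ.
have B : gk t x * (sqn x / t) <= s := gk_sqn_le t x.
have g0 := gk_ge0 t x; have gs : gk t x <= s := gk_le x t0.
rewrite normrM (ger0_norm g0).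
have h : `|2 * (x 0 i / t) * (x 0 j / t) - (i == j)%:R / t| <= (2 * (sqn x / t) + 1) / t.
  have hij : `|x 0 i * x 0 j| <= sqn x.
    have := sqr_coord_le x i; have := sqr_coord_le x j => hi hj.
    by rewrite ler_norml; apply/andP; split; nra.
  apply: le_trans (ler_normB _ _) _.
  rewrite (_ : 2 * _ * _ = 2 / t ^+ 2 * (x 0 i * x 0 j)); last by field; rewrite gt_eqF.
  rewrite normrM [`|2 / t ^+ 2|]ger0_norm ?divr_ge0 ?exprn_ge0// ?(ltW t0)//.
  rewrite (_ : (2 * _ + 1) / t = 2 / t ^+ 2 * sqn x + 1 / t); last by field; rewrite gt_eqF.
  apply: lerD; first by rewrite ler_wpM2l// divr_ge0// exprn_ge0// ltW.
  rewrite ger0_norm ?divr_ge0// ?(ltW t0)// ler_wpM2r// ?invr_ge0 ?(ltW t0)//.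
  by case: (i == j).
apply: (@le_trans _ _ (gk t x * ((2 * (sqn x / t) + 1) / t))); first by rewrite ler_wpM2l.
rewrite !mulrA ler_wpM2r ?invr_ge0 ?(ltW t0)//.
by move: B gs; rewrite mulrA; set u := gk t x * sqn x / t => B gs; rewrite mulrDr mulr1; 
  rewrite (_ : gk t x * (2 * sqn x / t) = 2 * u); [lra|rewrite /u; ring].
Qed.

Lemma quad_gkQ t x y : quad (fun i j => gkQ t i j x) y =
  gk t x * (2 * (dotp x y / t) ^+ 2 - sqn y / t).
Proof.
rewrite /quad /gkQ.
transitivity (\sum_i (gk t x * (2 / t * (x 0 i * y 0 i) * (dotp x y / t) - y 0 i ^+ 2 / t))).
  apply: eq_bigr => i _.
  transitivity (\sum_j (gk t x * (2 / t * (x 0 i * y 0 i) / t) * (x 0 j * y 0 j)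
     - (if i == j then gk t x * (y 0 i * y 0 j) / t else 0))).
    by apply: eq_bigr => j _; case: eqVneq => [->|_] /=; ring.
  rewrite sumrB -mulr_sumr -/(dotp x y) -big_mkcond/= (big_pred1 i); last by move=> j; rewrite eq_sym.
  by ring.
rewrite -mulr_sumr sumrB -mulr_suml -mulr_sumr -mulr_suml -/(dotp x y) -/(sqn y).
by ring.
Qed.

(** The heat equation for the kernel: the bracket is the one in [gk_time], so half the Laplacian is
    twice the time derivative. *)
Lemma trace_gkQ t x : t != 0 -> \sum_i gkQ t i i x = 2 / t * (gk t x * (sqn x / t - d%:R / 2)).
Proof.
move=> t0; rewrite /gkQ -mulr_sumr sumrB.
rewrite [X in _ * (_ - X)](_ : _ = d%:R / t); last first.
  under eq_bigr do rewrite eqxx mul1r.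
  by rewrite sumr_const card_ord mulr_natl.
rewrite [X in _ * (X - _)](_ : _ = 2 / t ^+ 2 * sqn x); last first.
  by rewrite /sqn mulr_sumr; apply: eq_bigr => i _; rewrite [t ^+ 2]expr2 invfM; ring.
by field.
Qed.

Definition hp t x : R := J (fun z => gk t (x - z)).

(** Half the Hessian of [hp], obtained by integrating that of the kernel. [hp] itself is never
    differentiated: [hpDB] and [hp_time] stand in for its expansions in space and time. *)
Definition hpQ t x i j : R := J (fun z => gkQ t i j (x - z)).

Let bgk t x : 0 < t -> bcont (fun z => gk t (x - z)).
Proof. by move=> t0; apply: bcont_subl; exact: bcont_gk. Qed.

Let bgkQ t x i j : 0 < t -> bcont (fun z => gkQ t i j (x - z)).
Proof. by move=> t0; apply: (@bcont_subl x (gkQ t i j)); exact: bcont_gkQ. Qed.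

Lemma hpDB t x y : 0 < t ->
  2 * hp t x + 2 * quad (hpQ t x) y
    - 4 * (Num.sqrt t)^-1 ^+ d / t ^+ 2 * fine (nu setT) * sqn y ^+ 2
  <= hp t (x + y) + hp t (x - y).
Proof.
move=> t0.
set c := 4 * (Num.sqrt t)^-1 ^+ d / t ^+ 2 * sqn y ^+ 2.
have qE : quad (hpQ t x) y = J (fun z => quad (fun i j => gkQ t i j (x - z)) y).
  rewrite /quad; rewrite Rintegral_sum_bcont; last first.
    move=> i; apply: bcont_sum => j.
    rewrite (_ : (fun z => _) = fun z => (y 0 i * y 0 j) * gkQ t i j (x - z)).
      by apply: bcontZ; exact: bgkQ.
    by apply/funext => z; rewrite mulrC.
  apply: eq_bigr => i _; rewrite Rintegral_sum_bcont; last first.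
    move=> j; rewrite (_ : (fun z => _) = fun z => (y 0 i * y 0 j) * gkQ t i j (x - z)).
      by apply: bcontZ; exact: bgkQ.
    by apply/funext => z; rewrite mulrC.
  apply: eq_bigr => j _; rewrite mulrC -RintegralZ_bcont; last exact: bgkQ.
  by apply: eq_Rintegral => z _; rewrite mulrC.
have bq : bcont (fun z => quad (fun i j => gkQ t i j (x - z)) y).
  rewrite /quad; apply: bcont_sum => i; apply: bcont_sum => j.
  rewrite (_ : (fun z => _) = fun z => (y 0 i * y 0 j) * gkQ t i j (x - z)).
    by apply: bcontZ; exact: bgkQ.
  by apply/funext => z; rewrite mulrC.
have -> : 2 * hp t x + 2 * quad (hpQ t x) y - 4 * (Num.sqrt t)^-1 ^+ d / t ^+ 2 *
    fine (nu setT) * sqn y ^+ 2 =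
  J (fun z => (2 * gk t (x - z) + 2 * quad (fun i j => gkQ t i j (x - z)) y) + (- c)).
  rewrite RintegralD_bcont; [|by apply: bcontD; apply: bcontZ => //; exact: bgk|exact: bcont_cst].
  rewrite RintegralD_bcont; [|by apply: bcontZ; exact: bgk|exact: bcontZ].
  rewrite RintegralZ_bcont; last exact: bgk.
  by rewrite RintegralZ_bcont// Rintegral_cst_setT -qE /c /hp; ring.
rewrite /hp -RintegralD_bcont; [|exact: bgk|exact: bgk].
apply: le_Rintegral_bcont.
- by apply: bcontD; [apply: bcontD; apply: bcontZ => //; exact: bgk|exact: bcont_cst].
- by apply: bcontD; exact: bgk.
move=> z; rewrite quad_gkQ.
by rewrite [x + y - z]addrAC [x - y - z]addrAC; exact: gkDB.
Qed.

Lemma hp_time t tau x : 0 < tau -> tau <= t / 2 ->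
  hp t x - hp (t - tau) x <= tau / 2 * (\sum_i hpQ t x i i)
    + 2 * (tau / t) ^+ 2 * (Num.sqrt t)^-1 ^+ d * fine (nu setT).
Proof.
move=> tau0 taut; have t0 : 0 < t by lra.
have t'0 : 0 < t - tau by lra.
set c := 2 * (tau / t) ^+ 2 * (Num.sqrt t)^-1 ^+ d.
rewrite (_ : \sum_i hpQ t x i i = J (fun z => \sum_i gkQ t i i (x - z))); last first.
  by rewrite Rintegral_sum_bcont// => i; exact: bgkQ.
have bs : bcont (fun z => \sum_i gkQ t i i (x - z)) by apply: bcont_sum => i; exact: bgkQ.
rewrite /hp.
have h : J (fun z => gk t (x - z)) <= J (fun z => (gk (t - tau) (x - z) +
    tau / 2 * (\sum_i gkQ t i i (x - z))) + c).
  apply: le_Rintegral_bcont.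
  - exact: bgk.
  - by apply: bcontD; [apply: bcontD; [exact: bgk|exact: bcontZ]|exact: bcont_cst].
  move=> z; rewrite trace_gkQ ?gt_eqF//.
  have := gk_time (x - z) tau0 taut; rewrite -/c.
  rewrite (_ : tau / 2 * (2 / t * _) = tau / t * (gk t (x - z) * (sqn (x - z) / t - d%:R / 2))).
    by lra.
  by field; rewrite gt_eqF.
move: h; rewrite RintegralD_bcont; [|by apply: bcontD; [exact: bgk|exact: bcontZ]|exact: bcont_cst].
rewrite RintegralD_bcont; [|exact: bgk|exact: bcontZ].
rewrite RintegralZ_bcont// Rintegral_cst_setT; lra.
Qed.

Lemma hp_ge t x y (e : R) : 0 < t -> 0 < e ->
  hp t x - (Num.sqrt t)^-1 ^+ d * (e + sqn y / t * (1 + e^-1)) * fine (nu setT) <= hp t (x + y).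
Proof.
move=> t0 e0; set c := _ * (e + _).
have h : J (fun z => gk t (x - z) + (- c)) <= J (fun z => gk t (x + y - z)).
  apply: le_Rintegral_bcont; [by apply: bcontD; [exact: bgk|exact: bcont_cst]|exact: bgk|].
  by move=> z; have := gk_ge (x - z) y t0 e0; rewrite addrAC.
move: h; rewrite RintegralD_bcont; [|exact: bgk|exact: bcont_cst].
by rewrite Rintegral_cst_setT mulNr.
Qed.

Lemma hp_le t x : 0 < t -> hp t x <= (Num.sqrt t)^-1 ^+ d * fine (nu setT).
Proof.
move=> t0; rewrite -Rintegral_cst_setT; apply: le_Rintegral_bcont; [exact: bgk|exact: bcont_cst|].
by move=> z; exact: gk_le.
Qed.

End heat_potential.

(** * Maximum principle in small time steps *)

Section heat_comparison.
Context {R : realType} {d : nat} (nu : {finite_measure set (borelRn R d) -> \bar R}).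
Variables (W : 'rV[R]_d -> \bar R) (k C : R) (i0 : 'I_d).
Hypotheses (lW : lower_semicontinuous W) (k0 : 0 <= k).
Hypothesis Wk : forall x, ((- k)%:E <= W x)%E.
Hypothesis (WC : forall x, (gen_laplacian W x <= C%:E)%E).
Implicit Types (x y z : 'rV[R]_d) (t tau c : R).

(* The generalised Laplacian of the quadratic form [quad Q] at [0] is
   [lap_const] times the trace of [Q]. *)
Definition lap_const : R := 2 * (d + 2)%:R * (bmom i0 i0 / @vball R d).

Lemma lap_const_gt0 : 0 < lap_const.
Proof.
by rewrite /lap_const !mulr_gt0// ?invr_gt0 ?vball_gt0 ?bmom_gt0// ltr0n addn2.
Qed.

Let sT t : R := (Num.sqrt t)^-1 ^+ d * fine (nu setT).

Let sT_ge0 t : 0 <= sT t.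
Proof. by rewrite mulr_ge0 ?gk_pref_ge0// fine_ge0. Qed.

(** [hp_ge] is used with centre [y] and increment [x - y], so that its lower bound at [x] becomes an
    upper bound at [y]. This is the semicontinuity that makes [W - hp] lower semicontinuous. *)
Lemma hp_usc t x (e : R) : 0 < t -> 0 < e -> \forall y \near x, hp nu t y < hp nu t x + e.
Proof.
move=> t0 e0; pose A := sT t; have A0 : 0 <= A by exact: sT_ge0.
pose h := e / (2 * (A + 1)).
have h0 : 0 < h by rewrite divr_gt0// mulr_gt0//; lra.
pose f y := A * (h + sqn (x - y) / t * (1 + h^-1)).
have cf : continuous f.
  rewrite (_ : f = fun y => A * h + (A * (1 + h^-1) / t) * sqn (x - y)).
    exact: (continuousDR (@cst_continuous _ _ (A * h)) (continuousMR
      (@cst_continuous _ _ (A * (1 + h^-1) / t)) (continuous_comp_subl (@continuous_sqn R d)))).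
  by apply/funext => y; rewrite /f; ring.
have fx : f x < e.
  rewrite /f subrr (_ : sqn 0 = 0); last by rewrite -(scale0r x) sqnZ; ring.
  rewrite mul0r mul0r addr0 /h mulrA ltr_pdivrMr; last by rewrite mulr_gt0//; lra.
  nra.
have : nbhs x (f @^-1` [set r | r < e]).
  apply: open_nbhs_nbhs; split => //.
  by apply: open_comp; [move=> y _; exact: cf|exact: open_lt].
apply: filterS => y /= fy.
have := hp_ge nu y (x - y) t0 h0; rewrite [y + _]addrC subrK.
have -> : (Num.sqrt t)^-1 ^+ d * (h + sqn (x - y) / t * (1 + h^-1)) * fine (nu setT) = f y.
  by rewrite /f /A /sT; ring.
by move=> H; rewrite -ltrBlDr; apply: lt_le_trans H; rewrite ltrD2l ltrN2.
Qed.

Lemma lscD_EFin (F : 'rV[R]_d -> \bar R) (g : 'rV[R]_d -> R) : lower_semicontinuous F ->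
  (forall x, -oo < F x)%E ->
  (forall x (e : R), 0 < e -> \forall y \near x, g x - e < g y) ->
  lower_semicontinuous (fun x => F x + (g x)%:E)%E.
Proof.
move=> lF Fny hg x a ax.
have [r [ar rF]] : exists r : R, a - g x < r /\ (r%:E < F x)%E.
  move: ax (Fny x); case: (F x) => [u| |]//.
    rewrite -EFinD lte_fin => h _; exists ((a - g x + u) / 2).
    by rewrite lte_fin; split; lra.
  by move=> _ _; exists (a - g x + 1); rewrite ltry; split => //; lra.
have [V Vx VF] := lF _ _ rF.
pose e := r - (a - g x); have e0 : 0 < e by rewrite /e; lra.
exists (V `&` [set y | g x - e < g y]); first by apply: filterI => //; exact: hg.
move=> y [/VF rFy /= gy]; rewrite -lteBlDr//.
by apply: le_lt_trans rFy; rewrite -EFinB lee_fin; move: gy; rewrite /e; lra.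
Qed.

(* Maximum principle: at a minimum [x0] of [W + gam |.|^2 - hp t], with [gam]
   small, [gen_laplacian W x0 <= C] bounds the trace of the Hessian of [hp t],
   hence the increment [hp t x0 - hp (t - tau) x0]. *)
Lemma heat_step t tau c : 0 < tau -> tau <= t / 2 ->
  (forall x, (hp nu (t - tau) x)%:E <= W x + c%:E)%E ->
  forall x, ((hp nu t x)%:E <=
    W x + (c + tau * (C / (2 * lap_const)) + 2 * (tau / t) ^+ 2 * sT t)%:E)%E.
Proof.
move=> tau0 taut hc x1; have t0 : 0 < t by lra.
set c' := c + _ + _; rewrite leNgt; apply/negP => h1.
have [w1 Ww1] : exists w1, W x1 = w1%:E.
  by move: h1 (Wk x1); case: (W x1) => [r| |]//; exists r.
move: h1; rewrite Ww1 -EFinD lte_fin => h1.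
pose g := hp nu t x1 - c' - w1; have g0 : 0 < g by rewrite /g; lra.
have sq1 := sqn_ge0 x1.
(* The perturbation gam |.|^2 costs gam |x1|^2 in the comparison of values at [x0] and [x1], and gam
   tau d / 2 through the trace. With gam D = g/2 these are at most g/2 and g/4, together less than
   the violation [g]. *)
pose D := sqn x1 + tau * d%:R + 1.
have td0 : 0 <= tau * d%:R by rewrite mulr_ge0// ltW.
have D0 : 0 < D by rewrite /D; lra.
pose gam := g / 2 / D; have gam0 : 0 < gam by rewrite !divr_gt0.
have gamD : gam * D = g / 2 by rewrite /gam; field; rewrite gt_eqF.
have gamx1 : gam * sqn x1 <= g / 2.
  by rewrite -gamD ler_wpM2l ?(ltW gam0)// /D; lra.
have gamtau : gam * (tau * d%:R) <= g / 2.
  by rewrite -gamD ler_wpM2l ?(ltW gam0)// /D; lra.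
pose F x := (W x + (gam * sqn x - hp nu t x)%:E)%E.
have lF : lower_semicontinuous F.
  apply: lscD_EFin => //.
    by move=> x; apply: lt_le_trans (Wk x); rewrite ltNyr.
  move=> x e e0; have e20 : 0 < e / 2 by rewrite divr_gt0.
  have h2 : \forall y \near x, gam * sqn x - e / 2 < gam * sqn y.
    have cs : continuous (fun y : 'rV[R]_d => gam * sqn y).
      exact: (continuousMR (@cst_continuous _ _ gam) (@continuous_sqn R d)).
    have : nbhs x ((fun y : 'rV[R]_d => gam * sqn y) @^-1` [set r | gam * sqn x - e / 2 < r]).
      apply: open_nbhs_nbhs; split; last by rewrite /=; lra.
      by apply: open_comp; [move=> y _; exact: cs|exact: open_gt].
    by [].
  have h3 := @hp_usc t x _ t0 e20.
  near=> y.
  have : gam * sqn x - e / 2 < gam * sqn y by near: y.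
  have : hp nu t y < hp nu t x + e / 2 by near: y.
  generalize (hp nu t y) (hp nu t x) (gam * sqn x) (gam * sqn y).
  by clear - e i0 lW k0 Wk WC sT_ge0; move=> *; lra.
have Fk x : ((gam * sqn x - (k + sT t))%:E <= F x)%E.
  rewrite /F; apply: le_trans (leeD (Wk x) (lexx _)).
  by rewrite -EFinD lee_fin opprD addrCA !lerD2l lerN2; exact: hp_le.
have Fx1y : (F x1 < +oo)%E by rewrite /F Ww1 -EFinD ltry.
have [x0 x0min] := lsc_coercive_min lF gam0 Fk Fx1y.
have Fx1 : F x1 = (w1 + (gam * sqn x1 - hp nu t x1))%:E by rewrite /F Ww1 -EFinD.
have [w0 Ww0] : exists w0, W x0 = w0%:E.
  have := x0min x1; rewrite Fx1 /F; move: (Wk x0).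
  by case: (W x0) => [r| |]//; exists r.
have Fx0 : F x0 = (w0 + (gam * sqn x0 - hp nu t x0))%:E.
  by rewrite /F Ww0 EFinD; reflexivity.
have Flow x : ((w0 + (gam * sqn x0 - hp nu t x0) - (gam * sqn x - hp nu t x))%:E <= W x)%E.
  by have := x0min x; rewrite Fx0 /F => h; rewrite EFinB leeBlDr.
(* Half the Hessian at [x0] of hp - gam |.|^2, which up to an additive constant touches [W] from
   below at [x0]. *)
pose Q i j := hpQ nu t x0 i j - gam * (i == j)%:R.
have quadQ y : quad Q y = quad (hpQ nu t x0) y - gam * sqn y.
  rewrite /quad /Q /sqn mulr_sumr -sumrB; apply: eq_bigr => i _.
  transitivity (\sum_j (hpQ nu t x0 i j * (y 0 i * y 0 j) -
      (if j == i then gam * (y 0 i * y 0 j) else 0))).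
    by apply: eq_bigr => j _; rewrite eq_sym; case: eqVneq => [->|_] /=; ring.
  by rewrite sumrB -big_mkcond/= big_pred1_eq expr2.
have trQ : \sum_i Q i i = \sum_i hpQ nu t x0 i i - gam * d%:R.
  rewrite /Q sumrB; congr (_ - _); under eq_bigr do rewrite eqxx mulr1.
  by rewrite sumr_const card_ord mulr_natr.
pose C1 := 4 * (Num.sqrt t)^-1 ^+ d / t ^+ 2 * fine (nu setT).
have C10 : 0 <= C1.
  by rewrite /C1 !mulr_ge0 ?gk_pref_ge0 ?fine_ge0// invr_ge0 exprn_ge0// ltW.
have := @gen_laplacian_ge R d W k w0 C1 x0 Q i0 lW k0 Wk Ww0 C10.
rewrite -/lap_const => /(_ _)/wrap[].
  move=> y _.
  apply: le_trans (leeD (Flow (x0 + y)) (Flow (x0 - y))).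
  rewrite -EFinD lee_fin quadQ.
  have := hpDB nu x0 y t0; rewrite -/C1 !sqnD sqnN dotpNr.
  generalize (hp nu t x0) (hp nu t (x0 + y)) (hp nu t (x0 - y)) (quad (hpQ nu t x0) y)
    (sqn x0) (sqn y) (dotp x0 y) C1.
  by clear - gam w0 i0 lW k0 Wk WC sT_ge0; move=> *; lra.
move=> /le_trans/(_ (WC x0)); rewrite lee_fin trQ => hL.
have L0 := lap_const_gt0.
have hQ : \sum_i hpQ nu t x0 i i <= C / lap_const + gam * d%:R.
  rewrite -lerBlDr ler_pdivlMr// mulrC; exact: hL.
have ht := hp_time nu x0 tau0 taut.
have := hc x0; rewrite Ww0 -EFinD lee_fin => hc0.
have := x0min x1; rewrite Fx0 Fx1 lee_fin => hm.
have sq0 : 0 <= gam * sqn x0 by rewrite mulr_ge0 ?sqn_ge0// ltW.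
have h5 : tau / 2 * (\sum_i hpQ nu t x0 i i) <=
    tau * (C / (2 * lap_const)) + gam * (tau * d%:R) / 2.
  apply: le_trans (ler_wpM2l _ hQ) _; first by rewrite divr_ge0// ltW.
  by rewrite le_eqVlt; apply/orP; left; apply/eqP; field; rewrite gt_eqF.
move: ht h5 hc0 hm h1 gamx1 gamtau sq0; rewrite -[2 * _ * _ * _]mulrA -/(sT t) /g /c'.
generalize (hp nu t x0) (hp nu (t - tau) x0) (hp nu t x1) (gam * sqn x0) (gam * sqn x1)
  (gam * (tau * d%:R)) (tau / 2 * (\sum_i hpQ nu t x0 i i)) (tau * (C / (2 * lap_const)))
  (2 * (tau / t) ^+ 2 * sT t).
by clear - w0 w1 c i0 lW k0 Wk WC sT_ge0; move=> *; lra.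
Unshelve. all: by end_near. Qed.

(** All steps take place at times t >= a, where tau / t and [sT t] are at most their values at [a];
    the error per step is therefore bounded uniformly. *)
Lemma heat_iter a tau c n : 0 < tau -> tau <= a / 2 ->
  (forall x, (hp nu a x)%:E <= W x + c%:E)%E ->
  forall x, ((hp nu (a + tau * n%:R) x)%:E <=
    W x + (c + n%:R * (tau * (C / (2 * lap_const)) + 2 * (tau / a) ^+ 2 * sT a))%:E)%E.
Proof.
move=> tau0 taua hc; have a0 : 0 < a by lra.
elim: n => [x|n ih x]; first by rewrite mulr0 mul0r !addr0.
have n0 : 0 <= tau * n%:R by rewrite mulr_ge0// ltW.
set t := a + tau * n.+1%:R.
have tE : t - tau = a + tau * n%:R by rewrite /t -natr1; ring.
have at_ : a <= t by rewrite lerDl mulr_ge0// ltW.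
have taut : tau <= t / 2 by lra.
have t0 : 0 < t by lra.
have := @heat_step t tau _ tau0 taut; rewrite tE => /(_ _ ih x) /le_trans; apply.
apply: leeD => //; rewrite lee_fin.
have h1 : (tau / t) ^+ 2 <= (tau / a) ^+ 2.
  rewrite lerXn2r ?nnegrE ?divr_ge0 ?(ltW tau0) ?(ltW t0) ?(ltW a0)//.
  by rewrite ler_pM2l// lef_pV2// posrE.
have h2 : sT t <= sT a.
  rewrite ler_wpM2r ?fine_ge0// lerXn2r ?nnegrE ?invr_ge0 ?sqrtr_ge0//.
  by rewrite lef_pV2 ?posrE ?sqrtr_gt0// ler_wsqrtr.
have h3 : (tau / t) ^+ 2 * sT t <= (tau / a) ^+ 2 * sT a.
  by apply: ler_pM => //; exact: sqr_ge0.
rewrite -natr1 mulrDl mul1r -!mulrA; lra.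
Qed.

(** The error of one step is quadratic in tau and there are (T - a) / tau of them, so refining the
    steps removes it. *)
Lemma heat_comparison a T c : 0 < a -> a < T ->
  (forall x, (hp nu a x)%:E <= W x + c%:E)%E ->
  forall x, ((hp nu T x)%:E <= W x + (c + (T - a) * (C / (2 * lap_const)))%:E)%E.
Proof.
move=> a0 aT hc x.
have [Wx|Wx] := eqVneq (W x) +oo%E; first by rewrite Wx addye// leey.
have [w Ww] : exists w, W x = w%:E.
  by move: Wx (Wk x); case: (W x) => [r| |]//; exists r.
rewrite Ww -EFinD lee_fin; apply/ler_addgt0Pr => e e0.
pose M := 2 * (T - a) ^+ 2 / a ^+ 2 * sT a.
have M0 : 0 <= M by rewrite mulr_ge0 ?sT_ge0// divr_ge0 ?sqr_ge0// mulr_ge0 ?sqr_ge0.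
(* The first summand gives M / n <= e for the accumulated error, the second gives tau <= a / 2. *)
pose n := (Num.truncn (M / e + 2 * (T - a) / a)).+1.
have q0 : 0 <= 2 * (T - a) / a by rewrite divr_ge0 ?(ltW a0)//; lra.
have Me0 : 0 <= M / e by rewrite divr_ge0// ltW.
have hn : M / e + 2 * (T - a) / a < n%:R by exact: truncnS_gt.
have n0 : (0 : R) < n%:R by rewrite ltr0n.
pose tau := (T - a) / n%:R.
have tau0 : 0 < tau by rewrite divr_gt0// subr_gt0.
have taua : tau <= a / 2.
  rewrite /tau ler_pdivrMr//.
  have : 2 * (T - a) / a < n%:R by lra.
  by rewrite ltr_pdivrMr//; lra.
have TE : a + tau * n%:R = T by rewrite /tau; field; rewrite gt_eqF.
have := @heat_iter a tau c n tau0 taua hc x.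
rewrite TE Ww -EFinD lee_fin => /le_trans; apply.
have -> : n%:R * (tau * (C / (2 * lap_const)) + 2 * (tau / a) ^+ 2 * sT a) =
  (T - a) * (C / (2 * lap_const)) + M / n%:R.
  by rewrite /tau /M; field; rewrite !gt_eqF// lap_const_gt0.
suff : M / n%:R <= e by lra.
rewrite ler_pdivrMr// mulrC -ler_pdivrMr//; lra.
Qed.

End heat_comparison.

(** * Gaussian means *)

Section gauss_integral_Rn.
Context {R : realType}.
Local Notation leb := (@lebesgue_measure R).

Lemma measurable_prod_tnth n (g : R -> R) : measurable_fun setT g ->
  measurable_fun setT (fun t : n.-tuple (measurableTypeR R) => \prod_(i < n) g (tnth t i)).
Proof.
move=> mg; elim: n => [|n ih].
  by rewrite (_ : (fun t => _) = cst 1)//; apply/funext => t; rewrite big_ord0.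
rewrite (_ : (fun t => _) = fun t : n.+1.-tuple (measurableTypeR R) => g (thead t) *
    \prod_(i < n) g (tnth [tuple of behead t] i)); last first.
  apply/funext => t; rewrite big_ord_recl; congr (_ * _).
  apply: eq_bigr => i _; rewrite tnth_behead; congr (g (tnth t _)).
  by apply: val_inj; rewrite /= inordK// ltnS.
apply: measurable_funM.
  by apply: (measurableT_comp mg); exact: measurable_tnth.
by apply: (measurableT_comp ih); exact: measurable_behead.
Qed.

Lemma ge0_integral_lebesgue_tuple_prod n (g : R -> R) : measurable_fun setT g ->
  (forall x, 0 <= g x) ->
  (\int[lebesgue_tuple n]_t (\prod_(i < n) g (tnth t i))%:E =
   (\int[leb]_x (g x)%:E) ^+ n)%E.
Proof.
move=> mg g0; elim: n => [|n ih].
  rewrite /= integral_dirac//; last first.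
    by apply/measurable_EFinP; exact: measurable_prod_tnth.
  by rewrite diracT mul1e big_ord0.
rewrite expeS /= /cons_measure ge0_integral_pushforward//; last 2 first.
- by apply/measurable_EFinP; exact: measurable_prod_tnth.
- by move=> t _; rewrite lee_fin prodr_ge0.
rewrite preimage_setT.
have mG : measurable_fun setT (fun z : measurableTypeR R * n.-tuple (measurableTypeR R) =>
    (g z.1 * \prod_(i < n) g (tnth z.2 i))%:E).
  apply/measurable_EFinP; apply: measurable_funM.
    exact: (measurableT_comp mg measurable_fst).
  rewrite [X in measurable_fun _ X](_ : _ =
    (fun t : n.-tuple (measurableTypeR R) => \prod_(i < n) g (tnth t i)) \o snd)//.
  by apply: measurableT_comp; [exact: measurable_prod_tnth|exact: measurable_snd].
rewrite (eq_integral (fun z : measurableTypeR R * n.-tuple (measurableTypeR R) =>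
    (g z.1 * \prod_(i < n) g (tnth z.2 i))%:E)); last first.
  by move=> [x t] _ /=; rewrite big_ord_recl; congr (_ * _)%:E;
    apply: eq_bigr => i _; rewrite tnthS.
rewrite fubini_tonelli1//; last first.
  by move=> z; rewrite lee_fin mulr_ge0// prodr_ge0.
rewrite /fubini_F/=.
under eq_integral => x _.
  under eq_integral do rewrite EFinM.
  rewrite ge0_integralZl//; last 3 first.
  - by apply/measurable_EFinP; exact: measurable_prod_tnth.
  - by move=> t _; rewrite lee_fin prodr_ge0.
  - by rewrite lee_fin.
  rewrite ih; over.
rewrite ge0_integralZr//; last 3 first.
- exact/measurable_EFinP.
- by move=> x _; rewrite lee_fin.
by rewrite expe_ge0// integral_ge0// => x _; rewrite lee_fin.
Qed.

Context {d : nat}.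
Local Notation mu := (@lebesgue_Rn R d).

Definition gauss (x : 'rV[R]_d) : R := expR (- sqn x).

Lemma continuous_gauss : continuous gauss.
Proof.
move=> x; apply: (@continuous_comp _ _ _ (fun x : 'rV[R]_d => - sqn x) expR).
  exact: (cvgN (@continuous_sqn R d x)).
exact: continuous_expR.
Qed.

Lemma measurable_gauss : measurable_fun setT (gauss : borelRn R d -> R).
Proof. exact: continuous_measurable_real continuous_gauss. Qed.

Lemma gauss_ge0 x : 0 <= gauss x. Proof. exact: expR_ge0. Qed.

Definition gaussZ : R := Num.sqrt pi ^+ d.

Lemma gaussZ_gt0 : 0 < gaussZ.
Proof. by rewrite exprn_gt0// sqrtr_gt0 pi_gt0. Qed.

Lemma integral_gauss_Rn : (\int[mu]_x (gauss x)%:E)%E = gaussZ%:E.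
Proof.
rewrite /lebesgue_Rn ge0_integral_pushforward//; last 2 first.
- by apply/measurable_EFinP; exact: measurable_gauss.
- by move=> t _; rewrite lee_fin gauss_ge0.
rewrite preimage_setT.
rewrite (eq_integral (fun t : d.-tuple (measurableTypeR R) =>
   (\prod_(i < d) gauss_fun (tnth t i))%:E)); last first.
  move=> t _ /=; congr EFin; rewrite /gauss /gauss_fun -expR_sum; congr expR.
  by rewrite /sqn -sumrN; apply: eq_bigr => i _; rewrite mxE.
rewrite ge0_integral_lebesgue_tuple_prod; last 2 first.
- exact: measurable_gauss_fun.
- exact: gauss_fun_ge0.
by rewrite integralT_gauss -EFin_expe.
Qed.

(** Since |x| <= 1 + |x|^2 / 2 <= exp (|x|^2 / 2), the integrand is dominated by exp (-|x|^2 / 2), a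
    dilation of [gauss] by sqrt 2. *)
Lemma integral_norm_gauss_lty :
  (\int[mu]_x (`|x : 'rV[R]_d| * gauss x)%:E < +oo)%E.
Proof.
pose g (x : borelRn R d) : \bar R := (expR (- (sqn (x : 'rV[R]_d) / 2)))%:E.
have mg : measurable_fun setT g.
  apply/measurable_EFinP; apply: continuous_measurable_real => x.
  apply: (@continuous_comp _ _ _ (fun x : 'rV[R]_d => - (sqn x / 2)) expR).
    rewrite (_ : (fun x => _) = fun x => (- 2^-1) * sqn x).
      have cs := continuousMR (@cst_continuous _ _ (- 2^-1 : R)) (@continuous_sqn R d).
      exact: cs.
    by apply/funext => y; rewrite mulNr mulrC.
  exact: continuous_expR.
apply: (@le_lt_trans _ _ (\int[mu]_x g x)%E).
  apply: ge0_le_integral => //.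
  - by move=> x _; rewrite lee_fin mulr_ge0 ?gauss_ge0.
  - apply/measurable_EFinP; apply: measurable_funM; last exact: measurable_gauss.
    by apply: continuous_measurable_real; exact: norm_continuous.
  - move=> x _; rewrite lee_fin /gauss.
    rewrite (_ : - sqn (x : 'rV[R]_d) = - (sqn (x : 'rV[R]_d) / 2) - sqn (x : 'rV[R]_d) / 2); last first.
      by rewrite -opprD -splitr.
    rewrite expRD mulrCA; apply: ler_piMr; first exact: expR_ge0.
    rewrite expRN ler_pdivrMr ?expR_gt0// mul1r.
    have h1 := expR_ge1Dx (sqn (x : 'rV[R]_d) / 2).
    apply: le_trans h1; have := norm_sqr_le_sqn (x : 'rV[R]_d).
    have := sqr_ge0 (`|x : 'rV[R]_d| - 1); nra.
pose s : R := Num.sqrt 2.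
have s0 : 0 < s by rewrite sqrtr_gt0.
rewrite (ge0_integral_scale s0 mg); last by move=> x; rewrite lee_fin expR_ge0.
rewrite (eq_integral (fun x : borelRn R d => (gauss x)%:E)); last first.
  move=> x _; rewrite /g sqnZ sqr_sqrtr//; congr (expR (- _))%:E.
  by field.
by rewrite integral_gauss_Rn -EFinM ltry.
Qed.

End gauss_integral_Rn.

(** * Measures with a density *)

Section density.
Local Open Scope ereal_scope.
Context d (T : measurableType d) (R : realType) (mu : {measure set T -> \bar R}).
Variable h : T -> R.
Hypotheses (mh : measurable_fun setT h) (h0 : forall x, (0 <= h x)%R).

(** The two proofs are arguments so that the measure structure can be attached to, and inferred
    from, the term itself. *)
Definition density of measurable_fun setT h & (forall x, (0 <= h x)%R) : set T -> \bar R :=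
  fun A => \int[mu]_(x in A) (h x)%:E.

Local Notation nu := (density mh h0).

Let density0 : nu set0 = 0. Proof. by rewrite /density integral_set0. Qed.

Let density_ge0 A : 0 <= nu A.
Proof. by apply: integral_ge0 => x _; rewrite lee_fin. Qed.

Let density_sigma_additive : semi_sigma_additive nu.
Proof.
move=> /= A mA tA mUA; rewrite /density ge0_integral_bigcup//=.
- by apply: is_cvg_ereal_nneg_natsum_cond => n _ _; exact: density_ge0.
- by apply/measurable_EFinP; exact: measurable_funTS.
- by move=> x _; rewrite lee_fin.
Qed.

HB.instance Definition _ := isMeasure.Build _ _ _ nu density0 density_ge0 density_sigma_additive.

Import HBNNSimple.

Let nnsfun_density (g : {nnsfun T >-> R}) :
  \int[nu]_x (g x)%:E = \int[mu]_x ((g x)%:E * (h x)%:E).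
Proof.
have mhE : measurable_fun setT (EFin \o h) by exact/measurable_EFinP.
have mi r : measurable_fun setT (fun x => (r * \1_(g @^-1` [set r]) x)%:E).
  by apply/measurable_EFinP; exact: measurable_funM.
transitivity (\int[nu]_x (\sum_(y \in range g) (y * \1_(g @^-1` [set y]) x)%:E)).
  by apply: eq_integral => t _; rewrite /= fimfunE -fsumEFin.
rewrite ge0_integral_fsum//; last by move=> m y _; exact: nnfun_muleindic_ge0.
transitivity (\int[mu]_x (\sum_(y \in range g) (y * \1_(g @^-1` [set y]) x)%:E * (h x)%:E)); last first.
  apply: eq_integral => x _.
  rewrite -ge0_mule_fsuml => [|y]; last exact: nnfun_muleindic_ge0.
  by rewrite fsumEFin// -(fimfunE _ x).
rewrite ge0_integral_fsum//; last 2 first.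
- by move=> y; exact: emeasurable_funM.
- by move=> m y _; apply: mule_ge0; [exact: nnfun_muleindic_ge0|rewrite lee_fin].
apply: eq_fsbigr => r rg.
under [LHS]eq_integral do rewrite EFinM.
rewrite integralZl_indic_nnsfun//.
under [RHS]eq_integral do rewrite EFinM -muleA.
have [r0|r0] := leP 0%R r; last first.
  have E : g @^-1` [set r] = set0.
    apply/seteqP; split => // x /= gx; have : (0 <= g x)%R by exact: fun_ge0.
    by rewrite gx leNgt r0.
  by rewrite E; under [RHS]eq_integral do rewrite indic0 mul0e mule0;
    rewrite integral0 integral_indic// set0I measure0 mule0.
rewrite ge0_integralZl//; last 2 first.
- by apply: emeasurable_funM => //; exact/measurable_EFinP.
- by move=> x _; rewrite mule_ge0 ?lee_fin.
congr (_ * _); rewrite integral_indic// setIT.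
transitivity (\int[mu]_(x in g @^-1` [set r]) (h x)%:E); first by [].
rewrite integral_mkcond; apply: eq_integral => x _.
by rewrite /= epatch_indic muleC.
Qed.

(** For indicators this is the definition; simple functions follow by linearity, and monotone
    convergence is then applied on both sides. *)
Lemma ge0_integral_density (f : T -> \bar R) : measurable_fun setT f ->
  (forall x, 0 <= f x) -> \int[nu]_x f x = \int[mu]_x (f x * (h x)%:E).
Proof.
move=> mf f0; have mhE : measurable_fun setT (EFin \o h) by exact/measurable_EFinP.
pose g := nnsfun_approx measurableT mf.
have gf x : (g n x)%:E @[n --> \oo] --> f x by apply: cvg_nnsfun_approx.
have -> : \int[nu]_x f x = limn (fun n => \int[nu]_x (g n x)%:E).
  rewrite -monotone_convergence//.
  - by apply: eq_integral => x _; apply/esym/cvg_lim.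
  - by move=> n; exact/measurable_EFinP/measurable_funP.
  - by move=> n x _; rewrite lee_fin.
  - by move=> x _ m n mn; rewrite lee_fin; exact/lefP/nd_nnsfun_approx.
have -> : \int[mu]_x (f x * (h x)%:E) = limn (fun n => \int[mu]_x ((g n x)%:E * (h x)%:E)).
  rewrite -monotone_convergence//.
  - apply: eq_integral => x _; apply/esym/cvg_lim => //.
    by apply: cvgeZr => //.
  - by move=> n; apply: emeasurable_funM => //; exact/measurable_EFinP/measurable_funP.
  - by move=> n x _; rewrite mule_ge0 ?lee_fin.
  - move=> x _ m n mn; rewrite lee_wpmul2r ?lee_fin//.
    exact/lefP/nd_nnsfun_approx.
by under eq_fun do rewrite nnsfun_density.
Qed.

End density.

Section density_existence.
Local Open Scope ereal_scope.
Context d (T : measurableType d) (R : realType) (mu : {measure set T -> \bar R}).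

Lemma finite_measure_density (h : T -> R) : measurable_fun setT h ->
  (forall x, (0 <= h x)%R) -> \int[mu]_x (h x)%:E < +oo ->
  exists nu : {finite_measure set T -> \bar R}, forall f : T -> \bar R,
    measurable_fun setT f -> (forall x, 0 <= f x) ->
    \int[nu]_x f x = \int[mu]_x (f x * (h x)%:E).
Proof.
move=> mh h0 hoo.
have fin : fin_num_fun (density mu mh h0).
  move=> A mA; rewrite ge0_fin_numE ?measure_ge0//; apply: le_lt_trans hoo.
  apply: ge0_subset_integral => //; first exact/measurable_EFinP.
  by move=> x _; rewrite lee_fin.
pose nuM := Measure_isFinite.Build _ _ _ (density mu mh h0) fin.
pose nu : {finite_measure set T -> \bar R} := HB.pack (density mu mh h0) nuM.
by exists nu => f mf f0; exact: ge0_integral_density.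
Qed.

Lemma probability_density (h : T -> R) : measurable_fun setT h ->
  (forall x, (0 <= h x)%R) -> \int[mu]_x (h x)%:E = 1 ->
  exists P : probability T R, forall f : T -> \bar R,
    measurable_fun setT f -> (forall x, 0 <= f x) ->
    \int[P]_x f x = \int[mu]_x (f x * (h x)%:E).
Proof.
move=> mh h0 h1.
have P1 : density mu mh h0 [set: T] = 1 by [].
pose PM := Measure_isProbability.Build _ _ _ (density mu mh h0) P1.
pose P : probability T R := HB.pack (density mu mh h0) PM.
by exists P => f mf f0; exact: ge0_integral_density.
Qed.

End density_existence.

(** * Lipschitz minorants *)

Section lipschitz_approximation.
Context {R : realType} {d : nat}.
Implicit Types (x z u : 'rV[R]_d).

Lemma lipschitz_continuous (f : 'rV[R]_d -> R) (L : R) :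
  (forall x u, f (x - u) <= f x + L * `|u|) -> continuous f.
Proof.
move=> fL x; apply/(@cvgrPdist_lt _ _ _ (nbhs x) _ f (f x)) => e e0.
pose L' := `|L| + 1; have L'0 : 0 < L' by rewrite ltr_pwDr.
have fL' y z : f y <= f z + L' * `|z - y|.
  have := fL z (z - y); rewrite opprB addrC subrK => /le_trans; apply.
  by rewrite lerD2l ler_wpM2r// (le_trans (ler_norm _))// lerDl.
change (nbhs x [set y | `|f x - f y| < e]).
apply: filterS (nbhsx_ballx x (e / L') (divr_gt0 e0 L'0)) => y.
rewrite -ball_normE/= ltr_pdivlMr// mulrC => h.
rewrite ltr_norml; have := fL' y x; have := fL' x y.
rewrite [`|y - x|]distrC => h1 h2; apply/andP; split; lra.
Qed.

(* The inf-convolutions [inf_z (min (w z) n + n |x - z|)], cut off by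
   [max 0 (n - |x|)]. *)
Lemma lsc_lipschitz_approx (w : 'rV[R]_d -> \bar R) : lower_semicontinuous w ->
  (forall x, 0 <= w x)%E ->
  exists f : nat -> 'rV[R]_d -> R,
  [/\ forall n x, 0 <= f n x <= n%:R,
      forall n x, ((f n x)%:E <= w x)%E,
      forall n x u, f n (x - u) <= f n x + n.+1%:R * `|u|,
      forall n x, n%:R < `|x| -> f n x = 0 &
      (forall x, nondecreasing_seq (f ^~ x)) /\
      (forall x (a : R), (a%:E < w x)%E -> exists n, a <= f n x)].
Proof.
move=> lw w0.
pose wn (n : nat) z : R := fine (mine (w z) n%:R%:E).
have wnE n z : (wn n z)%:E = mine (w z) n%:R%:E.
  rewrite /wn fineK// ge0_fin_numE; last by rewrite le_min w0 lee_fin ler0n.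
  by rewrite gt_min ltry orbT.
have wn0 n z : 0 <= wn n z by rewrite -lee_fin wnE le_min w0 lee_fin ler0n.
have wnn n z : wn n z <= n%:R by rewrite -lee_fin wnE ge_min lexx orbT.
have wnw n z : ((wn n z)%:E <= w z)%E by rewrite wnE ge_min lexx.
have wna n z (a : R) : (a%:E < w z)%E -> a <= n%:R -> a <= wn n z.
  by move=> aw an; rewrite -lee_fin wnE le_min ltW// lee_fin.
have wn_nd m n z : (m <= n)%N -> wn m z <= wn n z.
  by move=> mn; rewrite -lee_fin !wnE le_min ge_min lexx/= ge_min lee_fin ler_nat mn orbT.
pose S n x : set R := [set wn n z + n%:R * `|x - z| | z in [set: 'rV[R]_d]].
have S0 n x : lbound (S n x) 0.
  by move=> _ [z _ <-]; rewrite addr_ge0// mulr_ge0.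
have Sne n x : S n x !=set0 by exists (wn n x + n%:R * `|x - x|), x.
have Slb n x : has_lbound (S n x) by exists 0.
pose g n x : R := inf (S n x).
have g0 n x : 0 <= g n x by apply: lb_le_inf.
have gz n x z : g n x <= wn n z + n%:R * `|x - z|.
  by apply: ge_inf => //; exists z.
have gL n x u : g n (x - u) <= g n x + n%:R * `|u|.
  rewrite -lerBlDr; apply: lb_le_inf => // _ [z _ <-].
  rewrite lerBlDr; apply: le_trans (gz n (x - u) z) _.
  rewrite -[leRHS]addrA lerD2l -mulrDr ler_wpM2l//.
  by rewrite addrAC; exact: ler_normB.
have g_nd m n x : (m <= n)%N -> g m x <= g n x.
  move=> mn; apply: lb_le_inf => // _ [z _ <-].
  apply: le_trans (gz m x z) _; apply: lerD; first exact: wn_nd.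
  by rewrite ler_wpM2r// ler_nat.
(* The cut-off gives compact support, hence Lebesgue integrability, so that each minorant can serve
   as the density of a finite measure. *)
pose chi (n : nat) x : R := Num.max 0 (n%:R - `|x|).
exists (fun n x => Num.min (chi n x) (g n x)); split.
- move=> n x; apply/andP; split.
    by rewrite le_min g0 andbT /chi le_max lexx.
  by rewrite ge_min; apply/orP; left; rewrite /chi ge_max ler0n/= lerBlDr lerDl.
- move=> n x; apply: le_trans (wnw n x); rewrite lee_fin ge_min; apply/orP; right.
  by apply: le_trans (gz n x x) _; rewrite subrr normr0 mulr0 addr0.
(* The cut-off has Lipschitz constant 1 and the inf-convolution constant n; n + 1 covers both,
   including n = 0. *)
- move=> n x u; rewrite -lerBlDr le_min !lerBlDr; apply/andP; split.
    rewrite ge_min; apply/orP; left; rewrite /chi ge_max; apply/andP; split.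
      by rewrite addr_ge0 ?mulr_ge0// le_max lexx.
    apply: (@le_trans _ _ (n%:R - `|x| + `|u|)).
      by have := ler_normD (x - u) u; rewrite subrK; lra.
    apply: lerD; first by rewrite le_max lexx orbT.
    by rewrite ler_peMl// ler1n.
  rewrite ge_min; apply/orP; right; apply: le_trans (gL n x u) _.
  by rewrite lerD2l ler_wpM2r// ler_nat.
- move=> n x nx; rewrite /chi (_ : Num.max _ _ = 0); first by rewrite min_l.
  by rewrite max_l// subr_le0 ltW.
- split=> [x m n mn|x a aw].
    rewrite le_min; apply/andP; split; rewrite ge_min; apply/orP; [left|right].
      by rewrite /chi ge_max le_max lexx/= le_max lerD2r ler_nat mn orbT.
    exact: g_nd.
  have [V Vx Va] := lw _ _ aw.
  have [r /= r0 rV] : exists2 r : R, 0 < r & forall z, `|x - z| < r -> V z.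
    move: Vx => /nbhs_ballP[r /= r0 rV]; exists r => // z xz; apply: rV.
    by rewrite -ball_normE.
  (* n >= |a| + |x| lifts the truncation and the cut-off at [x] to at least [a]. n r >= |a| makes
     the penalty at least [a] at distance r or more from [x]; closer points satisfy w > a. *)
  pose n := (Num.truncn (`|a| + `|x| + `|a| / r)).+1.
  have hn : `|a| + `|x| + `|a| / r < n%:R by exact: truncnS_gt.
  have ar0 : 0 <= `|a| / r by rewrite divr_ge0// ltW.
  have x0 := normr_ge0 x; have a0 := normr_ge0 a; have aa := ler_norm a.
  have an : a <= n%:R by lra.
  exists n; rewrite le_min; apply/andP; split.
    by rewrite /chi le_max; apply/orP; right; lra.
  apply: lb_le_inf => // _ [z _ <-].
  have [xz|xz] := ltP `|x - z| r.
    apply: le_trans (wna n z a (Va _ (rV _ xz)) an) _; by rewrite lerDl mulr_ge0.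
  apply: (@le_trans _ _ (n%:R * r)); last first.
    by apply: (@le_trans _ _ (n%:R * `|x - z|)); [rewrite ler_wpM2l|rewrite lerDr].
  rewrite -ler_pdivrMr//; apply: (@le_trans _ _ (`|a| / r)).
    by rewrite ler_wpM2r// invr_ge0 ltW.
  by lra.
Qed.

End lipschitz_approximation.

(** * Gaussian means of [W] *)

Section gauss_mean.
Context {R : realType} {d : nat}.
Implicit Types (x y z : 'rV[R]_d).
Local Notation mu := (@lebesgue_Rn R d).

(** Variance 1/2 in each coordinate matches the time scale of [gk]: under this law sqrt t times y
    has a density proportional to [gk t]. *)
Lemma gauss_probability : exists N : probability (borelRn R d) R,
  forall f : borelRn R d -> \bar R, measurable_fun setT f -> (forall x, 0 <= f x)%E ->
  (\int[N]_x f x = \int[mu]_x (f x * (gauss (x : 'rV[R]_d) / @gaussZ R d)%:E))%E.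
Proof.
have Z0 := @gaussZ_gt0 R d.
apply: probability_density.
- by apply: measurable_funM => //; exact: measurable_gauss.
- by move=> x; rewrite divr_ge0 ?gauss_ge0// ltW.
under eq_integral do rewrite EFinM muleC.
rewrite ge0_integralZl//; last 3 first.
- by apply/measurable_EFinP; exact: measurable_gauss.
- by move=> x _; rewrite lee_fin gauss_ge0.
- by rewrite lee_fin invr_ge0 ltW.
by rewrite integral_gauss_Rn -EFinM mulVf// gt_eqF.
Qed.

Variable N : probability (borelRn R d) R.
Hypothesis gaussN : forall f : borelRn R d -> \bar R, measurable_fun setT f ->
  (forall x, 0 <= f x)%E ->
  (\int[N]_x f x = \int[mu]_x (f x * (gauss (x : 'rV[R]_d) / @gaussZ R d)%:E))%E.

Lemma continuous_sub_sqrt x (t : R) :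
  continuous (fun y : 'rV[R]_d => x - Num.sqrt t *: y).
Proof.
rewrite (_ : (fun y => _) = fun y => x + (- Num.sqrt t) *: y); first exact: continuous_addZ.
by apply/funext => y; rewrite scaleNr.
Qed.

Lemma measurable_sub_sqrt x (t : R) : measurable_fun setT
  ((fun y : 'rV[R]_d => x - Num.sqrt t *: y) : borelRn R d -> borelRn R d).
Proof. exact: continuous_measurable_row (@continuous_sub_sqrt x t). Qed.

(** Take for [nu] the measure with density f / pi^(d/2) and substitute z = x - sqrt t y: the
    Jacobian cancels the prefactor of [gk]. *)
Lemma hp_gauss (f : 'rV[R]_d -> R) : continuous f -> (forall x, 0 <= f x) ->
  (\int[mu]_x (f (x : 'rV[R]_d))%:E < +oo)%E ->
  exists nu : {finite_measure set (borelRn R d) -> \bar R}, forall t x, 0 < t ->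
    ((hp nu t x)%:E = \int[N]_y (f (x - Num.sqrt t *: (y : 'rV[R]_d)))%:E)%E.
Proof.
move=> cf f0 foo; have Z0 := @gaussZ_gt0 R d.
have mf : measurable_fun setT (f : borelRn R d -> R) by exact: continuous_measurable_real.
have [||| nu nuE] := @finite_measure_density _ (borelRn R d) R mu (fun z => f z / @gaussZ R d).
- by apply: measurable_funM.
- by move=> x; rewrite divr_ge0// ltW.
- under eq_integral do rewrite EFinM.
  rewrite ge0_integralZr//; last 3 first.
  + exact/measurable_EFinP.
  + by move=> x _; rewrite lee_fin.
  + by rewrite lee_fin invr_ge0 ltW.
  by rewrite muleC lte_mul_pinfty// lee_fin invr_ge0 ltW.
exists nu => t x t0.
have s0 : 0 < Num.sqrt t by rewrite sqrtr_gt0.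
have bg : bcont (fun z => gk t (x - z)) by apply: bcont_subl; exact: bcont_gk.
have mg : measurable_fun setT (fun z : borelRn R d => (gk t (x - (z : 'rV[R]_d)))%:E).
  by apply/measurable_EFinP; apply: continuous_measurable_real; exact: bg.1.
rewrite /hp /Rintegral fineK; last first.
  by apply: integrable_fin_num => //; exact: bcont_integrable.
rewrite nuE//; last by move=> z; rewrite lee_fin gk_ge0.
rewrite (@ge0_integral_affine _ _ (fun=> - Num.sqrt t) 1%g x)//; last 3 first.
- by move=> _; rewrite oppr_eq0 gt_eqF.
- apply: emeasurable_funM => //; apply/measurable_EFinP.
  by apply: measurable_funM.
- by move=> z; rewrite mule_ge0// lee_fin ?gk_ge0// divr_ge0// ltW.
have mfx : measurable_fun setT (fun y : borelRn R d => f (x - Num.sqrt t *: (y : 'rV[R]_d))).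
  exact: (measurableT_comp mf (@measurable_sub_sqrt x t)).
rewrite gaussN; last 2 first.
- exact/measurable_EFinP.
- by move=> y; rewrite lee_fin.
rewrite prodr_const card_ord normrN gtr0_norm//.
rewrite -ge0_integralZl//; last 2 first.
- apply: emeasurable_funM.
    apply: (measurableT_comp mg); exact: measurable_affine.
  apply/measurable_EFinP; apply: measurable_funM => //.
  by apply: (measurableT_comp mf); exact: measurable_affine.
- by move=> y _; rewrite mule_ge0// lee_fin ?gk_ge0// divr_ge0// ltW.
apply: eq_integral => y _.
have -> : affine (fun=> - Num.sqrt t) 1%g x y = x - Num.sqrt t *: (y : 'rV[R]_d).
  by apply/rowP => i; rewrite !mxE perm1; ring.
rewrite -!EFinM opprB addrCA subrr addr0; congr EFin.
rewrite /gk sqnZ sqr_sqrtr ?(ltW t0)// /gauss.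
rewrite (_ : t * sqn (y : 'rV[R]_d) / t = sqn (y : 'rV[R]_d)); last by field; rewrite gt_eqF.
rewrite exprVn; field.
by rewrite !gt_eqF// exprn_gt0.
Qed.

Lemma integral_norm_N_lty : (\int[N]_y (`|y : 'rV[R]_d|)%:E < +oo)%E.
Proof.
have Z0 := @gaussZ_gt0 R d.
have mn : measurable_fun setT (fun y : borelRn R d => `|y : 'rV[R]_d|).
  by apply: continuous_measurable_real; exact: norm_continuous.
rewrite gaussN//; last by exact/measurable_EFinP.
rewrite (eq_integral (fun y : borelRn R d =>
    (`|y : 'rV[R]_d| * gauss (y : 'rV[R]_d))%:E * (@gaussZ R d)^-1%:E)%E); last first.
  by move=> y _; rewrite -!EFinM mulrA.
rewrite ge0_integralZr//; last 3 first.
- by apply/measurable_EFinP; apply: measurable_funM => //; exact: measurable_gauss.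
- by move=> y _; rewrite lee_fin mulr_ge0 ?gauss_ge0.
- by rewrite lee_fin invr_ge0 ltW.
by rewrite muleC lte_mul_pinfty ?integral_norm_gauss_lty// lee_fin invr_ge0 ltW.
Qed.

Let m1 : R := fine (\int[N]_y (`|y : 'rV[R]_d|)%:E)%E.

Let m1_ge0 : 0 <= m1.
Proof. by rewrite fine_ge0// integral_ge0. Qed.

(** Initial condition of the comparison: at a small time [a] the mean exceeds [f] by at most a
    multiple of sqrt a. *)
Lemma lipschitz_gauss_mean (f : 'rV[R]_d -> R) (L a : R) x : continuous f ->
  (forall x, 0 <= f x) -> 0 <= L ->
  (forall x u, f (x - u) <= f x + L * `|u|) ->
  (\int[N]_y (f (x - Num.sqrt a *: (y : 'rV[R]_d)))%:E <= (f x + L * Num.sqrt a * m1)%:E)%E.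
Proof.
move=> cf f0 L0 fL.
have mf : measurable_fun setT (f : borelRn R d -> R) by exact: continuous_measurable_real.
have mn : measurable_fun setT (fun y : borelRn R d => (`|y : 'rV[R]_d|)%:E).
  by apply/measurable_EFinP; apply: continuous_measurable_real; exact: norm_continuous.
have La0 : 0 <= L * Num.sqrt a by rewrite mulr_ge0// sqrtr_ge0.
apply: (@le_trans _ _ (\int[N]_y ((f x)%:E + (L * Num.sqrt a)%:E * (`|y : 'rV[R]_d|)%:E))%E).
  apply: ge0_le_integral => //.
  - by move=> y _; rewrite lee_fin.
  - by apply/measurable_EFinP; exact: (measurableT_comp mf (@measurable_sub_sqrt x a)).
  - by apply: emeasurable_funD => //; exact: measurable_funeM.
  - move=> y _; rewrite -EFinM -EFinD lee_fin.
    by have := fL x (Num.sqrt a *: (y : 'rV[R]_d)); rewrite normrZ ger0_norm ?sqrtr_ge0// mulrA.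
rewrite ge0_integralD//; last 3 first.
- by move=> y _; rewrite lee_fin.
- by move=> y _; rewrite mule_ge0// lee_fin.
- exact: measurable_funeM.
rewrite integral_cst// [X in (_ * X + _)%E](probability_setT N) mule1 ge0_integralZl//.
rewrite /m1 [leRHS]EFinD [X in (_ <= _ + X)%E]EFinM fineK// ge0_fin_numE ?integral_norm_N_lty//.
exact: integral_ge0.
Qed.

Variables (W : 'rV[R]_d -> \bar R) (k C : R) (i0 : 'I_d).
Hypotheses (lW : lower_semicontinuous W) (k0 : 0 <= k).
Hypothesis Wk : forall x, ((- k)%:E <= W x)%E.
Hypotheses (C0 : 0 <= C) (WC : forall x, (gen_laplacian W x <= C%:E)%E).
Let C' := C / (2 * @lap_const R d i0).

(** The comparison is started at a positive time [a], where f <= W + k and the Lipschitz bound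
    control the potential; then a tends to 0. *)
Lemma gauss_mean_lipschitz_le (f : 'rV[R]_d -> R) (L T : R) x :
  (forall x, 0 <= f x) -> 0 <= L -> (forall x u, f (x - u) <= f x + L * `|u|) ->
  (\int[mu]_x (f (x : 'rV[R]_d))%:E < +oo)%E ->
  (forall x, (f x)%:E <= W x + k%:E)%E -> 0 < T ->
  (\int[N]_y (f (x - Num.sqrt T *: (y : 'rV[R]_d)))%:E <= W x + (k + T * C')%:E)%E.
Proof.
move=> f0 L0 fL foo fW T0.
have cf : continuous f := lipschitz_continuous fL.
have [nu nuE] := hp_gauss cf f0 foo.
have C'0 : 0 <= C' by rewrite divr_ge0// mulr_ge0// ltW// lap_const_gt0.
have [Wx|Wx] := eqVneq (W x) +oo%E; first by rewrite Wx addye// leey.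
have [w Ww] : exists w, W x = w%:E.
  by move: Wx (Wk x); case: (W x) => [r| |]//; exists r.
rewrite Ww -nuE// -EFinD lee_fin; apply/ler_addgt0Pr => e e0.
pose D := L * m1 + 1; have D0 : 0 < D by rewrite /D; have := mulr_ge0 L0 m1_ge0; lra.
pose q := e / D; have q0 : 0 < q by rewrite divr_gt0.
(* sqrt a <= q makes the initial error L sqrt a m1 at most D q = e. *)
pose a := Num.min (T / 2) (q ^+ 2).
have a0 : 0 < a by rewrite lt_min divr_gt0//= exprn_gt0.
have aT : a < T by rewrite gt_min; apply/orP; left; lra.
have sa : Num.sqrt a <= q.
  rewrite -[leRHS]ger0_norm ?(ltW q0)// -sqrtr_sqr ler_wsqrtr//.
  by rewrite ge_min lexx orbT.
have hc y : ((hp nu a y)%:E <= W y + (k + L * Num.sqrt a * m1)%:E)%E.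
  rewrite nuE//; apply: le_trans (lipschitz_gauss_mean a y cf f0 L0 fL) _.
  by rewrite !EFinD addeA leeD.
have := heat_comparison i0 lW k0 Wk WC a0 aT hc x.
rewrite -/C' Ww -EFinD lee_fin => /le_trans; apply.
have h1 : L * Num.sqrt a * m1 <= e.
  apply: (@le_trans _ _ (D * q)); last by rewrite /q mulrC divfK// gt_eqF.
  rewrite mulrAC; apply: ler_pM => //; first exact: mulr_ge0.
  by rewrite /D lerDl.
have h2 : (T - a) * C' <= T * C' by rewrite ler_wpM2r//; lra.
by rewrite -!addrA !lerD2l addrC; exact: lerD h2 h1.
Qed.

Lemma integral_compact_support_lty (f : 'rV[R]_d -> R) (n : nat) : continuous f ->
  (forall x, 0 <= f x <= n%:R) -> (forall x, n%:R < `|x| -> f x = 0) ->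
  (\int[mu]_x (f (x : 'rV[R]_d))%:E < +oo)%E.
Proof.
move=> cf f01 fn.
pose K : set (borelRn R d) := box (const_mx (- n.+1%:R)) (const_mx n.+1%:R).
have mK : measurable K by exact: measurable_box.
have mf : measurable_fun setT (f : borelRn R d -> R) by exact: continuous_measurable_real.
have Koo : (mu K < +oo)%E.
  rewrite /K lebesgue_Rn_box.
  under eq_bigr => i _.
    rewrite (_ : lebesgue_measure _ =
      (fine (lebesgue_measure (`]- n.+1%:R, n.+1%:R]%classic : set R)))%:E).
      over.
    rewrite !mxE fineK// lebesgue_measure_itv/=; case: ifP => _ //.
  by rewrite /= prodEFin ltry.
apply: (@le_lt_trans _ _ (\int[mu]_(x in K) n%:R%:E)%E); last first.
  by rewrite integral_cst// lte_mul_pinfty.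
rewrite [leRHS]integral_mkcond; apply: ge0_le_integral => //.
- by move=> x _; rewrite lee_fin; have /andP[] := f01 x.
- exact/measurable_EFinP.
- by apply/(measurable_restrictT _ _).1.
move=> x _; rewrite /patch; case: ifPn => [_|/negP xK].
  by rewrite lee_fin; have /andP[] := f01 x.
rewrite lee_fin fn//; rewrite ltNge; apply/negP => xn; apply: xK.
apply/mem_set => i; rewrite /= in_itv/= !mxE.
have := le_trans (ler_coord_norm (x : 'rV[R]_d) i) xn.
have nn : (n%:R : R) < n.+1%:R by rewrite ltr_nat.
rewrite ler_norml => /andP[h1 h2]; apply/andP; split; last exact: le_trans (ltW nn).
by apply: lt_le_trans h1; rewrite ltrN2.
Qed.

(** The bound for Lipschitz minorants does not involve their Lipschitz constants, so it passes to
    their increasing limit W + k by monotone convergence. *)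
Lemma gauss_mean_le (T : R) x : 0 < T ->
  (\int[N]_y (W (x - Num.sqrt T *: (y : 'rV[R]_d))%R + k%:E) <= W x + (k + T * C')%:E)%E.
Proof.
move=> T0.
pose w x := (W x + k%:E)%E.
have w0 z : (0 <= w z)%E by rewrite /w -leeBlDr// sub0e -EFinN.
have lw : lower_semicontinuous w.
  apply: lscD_EFin => //.
    by move=> z; apply: lt_le_trans (Wk z); rewrite ltNyr.
  by move=> z e e0; near=> y; rewrite ltrBlDr ltrDl.
have [f [f01 fw fL fn [f_nd fa]]] := lsc_lipschitz_approx lw w0.
have f0 n z : 0 <= f n z by have /andP[] := f01 n z.
have cf n : continuous (f n) := lipschitz_continuous (fL n).
have limf z : limn (fun n => (f n z)%:E) = w z.
  have nd : nondecreasing_seq (fun n => (f n z)%:E).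
    by move=> m n mn; rewrite lee_fin; exact: f_nd.
  rewrite (cvg_lim _ (ereal_nondecreasing_cvgn nd))//.
  apply/eqP; rewrite eq_le; apply/andP; split.
    by apply: ge_ereal_sup => _ [n _ <-]; exact: fw.
  rewrite leNgt; apply/negP => h.
  have [a [ha aw]] : exists a : R, (ereal_sup (range (fun n => (f n z)%:E)) < a%:E)%E /\ (a%:E < w z)%E.
    have : (0 <= ereal_sup (range (fun n => (f n z)%:E)))%E.
      by apply: (@le_trans _ _ (f 0%N z)%:E); [rewrite lee_fin|apply: ereal_sup_ubound; exists 0%N].
    move: h; case: (ereal_sup _) => [s| |]//; case: (w z) => [v| |]//.
      by rewrite lte_fin => sv _; exists ((s + v) / 2); rewrite !lte_fin; split; lra.
    by move=> _ _; exists (s + 1); rewrite lte_fin ltry; split => //; lra.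
  have [n an] := fa z a aw.
  have := lt_le_trans ha (_ : a%:E <= (f n z)%:E)%E; rewrite lee_fin => /(_ an).
  by rewrite ltNge => /negP; apply; apply: ereal_sup_ubound; exists n.
rewrite (eq_integral (fun y : borelRn R d =>
    limn (fun n => (f n (x - Num.sqrt T *: (y : 'rV[R]_d)))%:E))); last first.
  by move=> y _; rewrite limf.
rewrite monotone_convergence//; last 3 first.
- move=> n; apply/measurable_EFinP.
  by apply: (measurableT_comp _ (@measurable_sub_sqrt x T)); exact: continuous_measurable_real.
- by move=> n y _; rewrite lee_fin.
- by move=> y _ m n mn; rewrite lee_fin; exact: f_nd.
apply: lime_le.
  apply: ereal_nondecreasing_is_cvgn => m n mn; apply: ge0_le_integral => //.
  - by move=> y _; rewrite lee_fin.
  - apply/measurable_EFinP.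
    by apply: (measurableT_comp _ (@measurable_sub_sqrt x T)); exact: continuous_measurable_real.
  - apply/measurable_EFinP.
    by apply: (measurableT_comp _ (@measurable_sub_sqrt x T)); exact: continuous_measurable_real.
  - by move=> y _; rewrite lee_fin; exact: f_nd.
apply: nearW => n.
apply: (gauss_mean_lipschitz_le x (f0 n) _ (fL n)
  (integral_compact_support_lty (cf n) (f01 n) (fn n)) _ T0) => //; exact: fw.
Unshelve. all: by end_near. Qed.

End gauss_mean.

(** * Energies and instability *)

Section sampling.
Local Open Scope ereal_scope.
Context d (T : measurableType d) (R : realType) (P : probability T R).

(** If g exceeded its mean c everywhere, c would be finite and g - c a strictly positive function
    with zero integral, hence the whole space would be negligible. *)
Lemma exists_le_integral (g : T -> \bar R) : measurable_fun setT g ->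
  (forall x, 0 <= g x) -> exists x, g x <= \int[P]_x g x.
Proof.
move=> mg g0; apply: contrapT => /forallNP gI.
have {}gI x : \int[P]_x g x < g x by rewrite ltNge; exact/negP/gI.
have I0 : 0 <= \int[P]_x g x by exact: integral_ge0.
have Ioo : \int[P]_x g x < +oo.
  by apply: lt_le_trans (gI point) _; exact: leey.
case Ic : (\int[P]_x g x) I0 Ioo gI => [c| |]// c0 _ gc.
have mh : measurable_fun setT (fun x => g x - c%:E).
  by apply: emeasurable_funB => //; exact: measurable_cst.
have h0 x : 0 <= g x - c%:E by rewrite sube_ge0 ?ltW.
have E : \int[P]_x (g x - c%:E) + c%:E = c%:E.
  rewrite -[in RHS]Ic -[X in _ + X = _]mule1 -(probability_setT P) -integral_cst//.
  rewrite -ge0_integralD//.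
  by apply: eq_integral => x _; rewrite subeK.
have E0 : \int[P]_x `|g x - c%:E| = 0.
  apply/eqP; rewrite eq_le integral_ge0// andbT -(@leeD2rE _ c%:E)// add0e -[leRHS]E leeD2r//.
  apply: ge0_le_integral => //; first exact: measurableT_comp.
  by move=> x _; rewrite gee0_abs.
have [A [mA PA sA]] := (ae_eq_integral_abs P measurableT mh).1 E0.
have AT : A = setT.
  apply/seteqP; split => // x _; apply: sA => /= /(_ I).
  move: (gc x); case: (g x) => [r| |]//=; rewrite lte_fin => cr /eqP.
  by rewrite -EFinD eqe subr_eq0 => /eqP rc; rewrite rc ltxx in cr.
by have := probability_setT P; rewrite -AT [LHS]PA => /eqP; rewrite eq_sym onee_eq0.
Qed.

Variable K : T * T -> \bar R.
Hypotheses (mK : measurable_fun setT K) (K0 : forall z, 0 <= K z).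
Hypothesis KC : forall x y, K (x, y) = K (y, x).

Let mule_natl_natmul m (y : \bar R) : m%:R%:E * y = (y *+ m)%R.
Proof.
elim: m => [|m ih]; first by rewrite mul0e.
by rewrite [in RHS]mulrS -ih -natr1 EFinD ge0_muleDl ?lee_fin// mul1e addeC.
Qed.

(* Derandomisation: the last point [x] is chosen so that
   [f x + 2 n E K (x, Y)] does not exceed its mean, and its interaction
   [2 K (x, .)] with the remaining points is added to [f]. *)
Lemma sampling n (f : T -> \bar R) : measurable_fun setT f -> (forall x, 0 <= f x) ->
  exists X : 'I_n -> T,
    \sum_i f (X i) + \sum_i \sum_(j | j != i) K (X i, X j) <=
    ((\int[P]_x f x)%E *+ n + (\int[P]_x \int[P]_y K (x, y))%E *+ (n * n.-1))%R.
Proof.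
elim: n f => [|n ih] f mf f0.
  by exists (fun=> point); rewrite !big_ord0.
pose J x := \int[P]_y K (x, y).
have mJ : measurable_fun setT J by exact: measurable_fun_fubini_tonelli_F.
have J0 x : 0 <= J x by exact: integral_ge0.
have nat0 m : 0 <= (m%:R : R)%:E by rewrite lee_fin.
have [x fx] : exists x, f x + (J x *+ (2 * n))%R <=
    \int[P]_x f x + ((\int[P]_x J x)%E *+ (2 * n))%R.
  have mm : measurable_fun setT (fun x => (2 * n)%:R%:E * J x).
    exact: measurable_funeM.
  rewrite -mule_natl_natmul -(ge0_integralZl P measurableT mJ (fun x _ => J0 x))//.
  have mm0 x : setT x -> 0 <= (2 * n)%:R%:E * J x by rewrite mule_ge0.
  rewrite -(ge0_integralD P measurableT (fun x _ => f0 x) mf mm0 mm).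
  have [|x|x fx] := @exists_le_integral (fun x => f x + (2 * n)%:R%:E * J x).
  - exact: emeasurable_funD.
  - by rewrite adde_ge0// mm0.
  - by exists x; rewrite -mule_natl_natmul.
have mKx : measurable_fun setT (fun y => K (x, y)) by exact: measurableT_comp mK _.
pose f' y := f y + 2%:R%:E * K (x, y).
have mK2 : measurable_fun setT (fun y => 2%:R%:E * K (x, y)) by exact: measurable_funeM.
have K20 y : setT y -> 0 <= 2%:R%:E * K (x, y) by rewrite mule_ge0.
have mf' : measurable_fun setT f' by exact: emeasurable_funD.
have f'0 y : 0 <= f' y by rewrite adde_ge0// K20.
have If' : \int[P]_y f' y = \int[P]_y f y + (J x *+ 2)%R.
  rewrite (ge0_integralD P measurableT (fun x _ => f0 x) mf K20 mK2).
  by rewrite ge0_integralZl// mule_natl_natmul.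
have [X XH] := ih f' mf' f'0.
(* The chosen point takes index 0 and the configuration given by induction is shifted. The double
   sum splits into row 0, column 0 and the old sum; by symmetry of [K], row and column combine into
   the term 2 K (x, .) of [f']. *)
exists (fun i => if unlift ord0 i is Some j then X j else x).
rewrite !big_ord_recl unlift_none.
under eq_bigr do rewrite liftK.
under [X in _ + (_ + X)]eq_bigr => i _.
  rewrite liftK big_mkcond big_ord_recl unlift_none/=.
  under eq_bigr do rewrite liftK (inj_eq lift_inj).
  rewrite -big_mkcond/=.
  over.
rewrite [X in _ + (X + _)]big_mkcond big_ord_recl eqxx/= add0r.
under [X in _ + (X + _)]eq_bigr do rewrite liftK/=.
rewrite big_split/=.
under [X in _ + (_ + (X + _))]eq_bigr do rewrite KC.
move: XH; rewrite big_split/= -ge0_sume_distrr// mule_natl_natmul If'.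
set a := \sum_(i < n) f _; set b := \sum_(i < n) K _; set c := \sum_(i < n) \sum_(_ < n | _) _.
set F := \int[P]_y f y; set I := \int[P]_x J x => XH.
have -> : f x + a + (b + (b + c)) = (f x + (a + b *+ 2 + c))%R.
  by rewrite mulr2n !addeA.
have -> : (F *+ n.+1 + I *+ (n.+1 * n) = F + I *+ (2 * n) + (F *+ n + I *+ (n * n.-1)))%R.
  (* The 2n ordered pairs containing the new point, plus the ordered pairs of the others. *)
  rewrite (_ : (n.+1 * n = 2 * n + n * n.-1)%N); last by case: (n) => // m; rewrite /=; ring.
  by rewrite mulrS mulrnDr [RHS]addeACA.
apply: le_trans (leeD2l _ XH) _.
have H (p q r t : \bar R) : p + ((q + r) + t) = (p + r) + (q + t).
  by rewrite (addeC q) !addeA.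
by rewrite mulrnDl -mulrnA [leLHS]H leeD2r.
Qed.

End sampling.

Section mixture.
Local Open Scope ereal_scope.
Context d (T : measurableType d) (R : realType) (P : probability T R).

(** With g_i(u) = x_i + c u this is the empirical measure of the points x_i, smeared by [P] at scale
    c. *)
Lemma mixture_probability n (g : 'I_n.+1 -> T -> T) :
  (forall i, measurable_fun setT (g i)) ->
  exists rho : probability T R, forall f : T -> \bar R,
    measurable_fun setT f -> (forall x, 0 <= f x) ->
    \int[rho]_x f x = (n.+1%:R^-1)%:E * \sum_i \int[P]_x f (g i x).
Proof.
move=> mg.
have c0 : (0 <= n.+1%:R^-1 :> R)%R by [].
(* [msum] is indexed by natural numbers; [inord] is the inverse of the inclusion on the range that
   occurs. *)
pose m (k : nat) : {measure set T -> \bar R} :=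
  measure_function_pushforward__canonical__measure_function_Measure P (mg (inord k)).
pose M : {measure set T -> \bar R} := mscale (NngNum c0) (msum m n.+1).
have HM f : measurable_fun setT f -> (forall x, 0 <= f x) ->
    \int[M]_x f x = (n.+1%:R^-1)%:E * \sum_i \int[P]_x f (g i x).
  move=> mf f0; rewrite ge0_integral_mscale//= ge0_integral_measure_sum//.
  congr (_ * _); apply: eq_bigr => i _.
  rewrite ge0_integral_pushforward//= preimage_setT.
  by apply: eq_integral => x _ /=; rewrite inord_val.
have M1 : M setT = 1.
  have := HM (cst 1) (measurable_cst _) (fun _ => lee01).
  rewrite integral_cst// mul1e => ->.
  have P1 (i : 'I_n.+1) : \int[P]_x (cst 1 (g i x) : \bar R) = 1.
    by rewrite integral_cst// mul1e; exact: probability_setT.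
  under eq_bigr do rewrite P1.
  by rewrite sumEFin -EFinM sumr_const card_ord mulVf.
pose PM := Measure_isProbability.Build _ _ _ M M1.
pose Q : probability T R := HB.pack (Measure.sort M) PM.
by exists Q.
Qed.

End mixture.

Section energies.
Context {R : realType} {d : nat}.
Implicit Types (x y z : 'rV[R]_d).
Local Open Scope ereal_scope.

Variables (W : 'rV[R]_d -> \bar R) (k : R).
Hypotheses (lW : lower_semicontinuous W) (k0 : (0 <= k)%R).
Hypothesis Wk : forall x, (- k)%:E <= W x.
Hypothesis WN : forall x, W (- x)%R = W x.

Let w x := W x + k%:E.

Let w0 x : 0 <= w x.
Proof. by rewrite /w -leeBlDr// add0e -EFinN. Qed.

Let mW : measurable_fun setT (W : borelRn R d -> \bar R).
Proof. exact: lsc_measurable. Qed.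

Let mw : measurable_fun setT (w : borelRn R d -> \bar R).
Proof. by apply: emeasurable_funD => //; exact: measurable_cst. Qed.

Lemma measurable_shift_pair (f g : borelRn R d -> borelRn R d) :
  measurable_fun setT f -> measurable_fun setT g ->
  measurable_fun setT (fun z : borelRn R d * borelRn R d =>
    W ((f z.1 : 'rV[R]_d) - (g z.2 : 'rV[R]_d))%R + k%:E).
Proof.
move=> mf mg.
have mfg : measurable_fun setT (fun z : borelRn R d * borelRn R d => (f z.1, g z.2)).
  apply: measurable_fun_pair.
    by apply: (measurableT_comp mf); exact: measurable_fst.
  by apply: (measurableT_comp mg); exact: measurable_snd.
exact: (measurableT_comp mw (measurableT_comp (@measurable_subRn R d) mfg)).
Qed.

(** All integrands are at least [- k] and [rho] has mass one, so the shift comes out of the inner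
    and then of the outer integral. The remaining integrand is nonnegative, whether or not the
    energy is finite. *)
Lemma energyE (rho : probability (borelRn R d) R) : energy W rho =
  2^-1%:E * (\int[rho]_y \int[rho]_x (W ((x : 'rV[R]_d) - (y : 'rV[R]_d))%R + k%:E) - k%:E).
Proof.
have roo : rho setT < +oo by rewrite [X in X < _](probability_setT rho) ltry.
have mid := @measurable_id _ (borelRn R d) setT.
have mp := measurable_shift_pair mid mid.
have mG : measurable_fun setT (fun y : borelRn R d =>
    \int[rho]_x (W ((x : 'rV[R]_d) - (y : 'rV[R]_d))%R + k%:E)).
  have h := @measurable_fun_fubini_tonelli_G _ _ (borelRn R d) (borelRn R d) R rho _ mp
    (fun p => w0 _).
  exact h.
rewrite /energy; congr (_ * _).
have mWy y : measurable_fun setT (fun x : borelRn R d => W ((x : 'rV[R]_d) - y)%R).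
  have mz : measurable_fun setT (fun x : borelRn R d => (x : 'rV[R]_d) - y : borelRn R d)%R.
    apply: continuous_measurable_row => z.
    exact: (cvgD cvg_id (cvg_cst (- y)%R)).
  exact: measurableT_comp mW mz.
pose G (y : borelRn R d) := \int[rho]_x W ((x : 'rV[R]_d) - (y : 'rV[R]_d))%R.
have GE y : \int[rho]_x (W ((x : 'rV[R]_d) - (y : 'rV[R]_d))%R + k%:E) = G y + k%:E.
  rewrite (integral_shift measurableT roo (mWy y) k0) => [|x _]; last exact: Wk.
  by rewrite [X in _ + _ * X](probability_setT rho) mule1.
have Gk y : (- k)%:E <= G y.
  have : 0 <= G y + k%:E by rewrite -GE; apply: integral_ge0 => x _; exact: w0.
  by rewrite -leeBlDr// add0e -EFinN.
have mGG : measurable_fun setT G.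
  rewrite (_ : G = (fun y => \int[rho]_x
      (W ((x : 'rV[R]_d) - (y : 'rV[R]_d))%R + k%:E) - k%:E)).
    by apply: emeasurable_funB => //; exact: measurable_cst.
  by apply/funext => y; rewrite GE addeK.
under [in RHS]eq_integral => y _ do rewrite GE.
rewrite (integral_shift measurableT roo mGG k0) => [|x _]; last exact: Gk.
by rewrite [X in _ + _ * X - _](probability_setT rho) mule1 addeK.
Qed.

Lemma discrete_energyE n (X : 'I_n.+1 -> 'rV[R]_d) :
  \sum_i \sum_(j | j != i) (W (X i - X j)%R + k%:E) =
  (2 * n.+1%:R ^+ 2)%:E * discrete_energy W X + (n.+1%:R * n%:R * k)%:E.
Proof.
rewrite /discrete_energy muleA -EFinM mulfV ?mul1e; last first.
  by rewrite mulf_neq0// expf_neq0.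
under eq_bigr => i _.
  rewrite big_split/= sumEFin sumr_const.
  rewrite (_ : #|_| = n); last by rewrite (cardC1 i) card_ord.
  over.
rewrite big_split/= sumEFin sumr_const card_ord; congr (_ + _%:E).
by rewrite -mulrnA -[LHS]mulr_natl natrM (mulrC n%:R).
Qed.

End energies.

(** * Smearing point configurations *)

Section smearing.
Context {R : realType} {d : nat}.
Implicit Types (x : 'rV[R]_d).
Local Open Scope ereal_scope.

Variables (W : 'rV[R]_d -> \bar R) (k : R).
Hypotheses (lW : lower_semicontinuous W) (k0 : (0 <= k)%R).
Hypothesis Wk : forall x, (- k)%:E <= W x.

Let w0 x : 0 <= W x + k%:E.
Proof. by rewrite -leeBlDr// add0e -EFinN. Qed.

Section smear.
Variables (P : probability (borelRn R d) R) (c : R).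

Let dil (x : 'rV[R]_d) : borelRn R d -> borelRn R d :=
  fun u => (x + c *: (u : 'rV[R]_d))%R.

Let mdil x : measurable_fun setT (dil x).
Proof. by apply: continuous_measurable_row; exact: continuous_addZ. Qed.

Let pair_energy x y : \bar R := \int[P]_v \int[P]_u
  (W ((x + c *: (u : 'rV[R]_d)) - (y + c *: (v : 'rV[R]_d)))%R + k%:E).

Lemma smear_double_integral n (X : 'I_n.+1 -> 'rV[R]_d) :
  exists rho : probability (borelRn R d) R,
    \int[rho]_y \int[rho]_x (W ((x : 'rV[R]_d) - (y : 'rV[R]_d))%R + k%:E) =
    ((n.+1%:R ^+ 2)^-1)%:E * \sum_i \sum_j pair_energy (X i) (X j).
Proof.
have [rho Hrho] := mixture_probability P (fun i => mdil (X i)).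
exists rho.
have mid := @measurable_id _ (borelRn R d) setT.
have mG : measurable_fun setT (fun y : borelRn R d =>
    \int[rho]_x (W ((x : 'rV[R]_d) - (y : 'rV[R]_d))%R + k%:E)).
  have h := @measurable_fun_fubini_tonelli_G _ _ (borelRn R d) (borelRn R d) R rho _
    (measurable_shift_pair k lW mid mid) (fun p => w0 _).
  exact h.
rewrite Hrho; [|exact: mG|by move=> y; apply: integral_ge0 => x _; exact: w0].
have mwy (y : 'rV[R]_d) : measurable_fun setT (fun x : borelRn R d =>
    W ((x : 'rV[R]_d) - y)%R + k%:E).
  apply: emeasurable_funD; last exact: measurable_cst.
  have mz : measurable_fun setT (fun x : borelRn R d => (x : 'rV[R]_d) - y : borelRn R d)%R.
    apply: continuous_measurable_row => z.
    exact: (cvgD cvg_id (cvg_cst (- y)%R)).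
  exact: measurableT_comp (lsc_measurable lW) mz.
have mI i j : measurable_fun setT (fun v : borelRn R d =>
    \int[P]_u (W (dil (X i) u - dil (X j) v)%R + k%:E)).
  have h := @measurable_fun_fubini_tonelli_G _ _ (borelRn R d) (borelRn R d) R P _
    (measurable_shift_pair k lW (mdil (X i)) (mdil (X j))) (fun p => w0 _).
  exact h.
have I0 i j v : setT v -> 0 <= \int[P]_u (W (dil (X i) u - dil (X j) v)%R + k%:E).
  by move=> _; apply: integral_ge0 => u _; exact: w0.
have c0 : 0 <= (n.+1%:R^-1 : R)%:E by rewrite lee_fin.
have E j : \int[P]_v \int[rho]_x (W ((x : 'rV[R]_d) - dil (X j) v)%R + k%:E) =
    (n.+1%:R^-1)%:E * \sum_i pair_energy (X i) (X j).
  under eq_integral => v _.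
    rewrite Hrho; [|exact: mwy|by move=> x; exact: w0].
    over.
  rewrite (ge0_integralZl P measurableT); last 3 first.
  - by apply: emeasurable_sum => i; exact: mI.
  - by move=> v _; apply: sume_ge0 => i _; exact: I0.
  - exact: c0.
  congr (_ * _).
  exact: (@ge0_integral_sum _ _ _ P setT measurableT _
    (fun i v => \int[P]_u (W (dil (X i) u - dil (X j) v)%R + k%:E))
    (fun i => mI i j) (fun i v => I0 i j v)).
under eq_bigr => j _ do rewrite E.
rewrite -ge0_sume_distrr; last first.
  by move=> j _; apply: sume_ge0 => i _; apply: integral_ge0 => v _; exact: I0.
have E2 : (n.+1%:R^-1)%:E * (n.+1%:R^-1)%:E = ((n.+1%:R ^+ 2)^-1 : R)%:E.
  by rewrite -EFinM -invfM -expr2.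
rewrite muleA E2.
rewrite [in LHS]exchange_big.
reflexivity.
Qed.

(** Of the (n+1)^2 ordered pairs, the n (n+1) off-diagonal ones each lose at most [a], and the n+1
    diagonal ones contribute at most D - k each once the shift is removed. Dividing by 2 (n+1)^2
    gives the bound, with a n/(n+1) rounded up to a. *)
Lemma smear_energy_le (a D : R) n (X : 'I_n.+1 -> 'rV[R]_d) : (0 <= a)%R ->
  (forall i j, j != i -> pair_energy (X i) (X j) <= W (X i - X j)%R + (k + a)%:E) ->
  (forall x, pair_energy x x <= D%:E) ->
  exists rho : probability (borelRn R d) R,
    energy W rho <= discrete_energy W X + (a / 2 + (D - k) / (2 * n.+1%:R))%:E.
Proof.
move=> a0 Xa HD; have [rho rhoE] := smear_double_integral X; exists rho.
rewrite (energyE lW k0 Wk) rhoE.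
set S := \sum_i _.
have SD : S <= (2 * n.+1%:R ^+ 2)%:E * discrete_energy W X +
    (n.+1%:R * n%:R * k + (n.+1%:R * n%:R * a + n.+1%:R * D))%:E.
  rewrite EFinD addeA -discrete_energyE.
  apply: (@le_trans _ _ (\sum_(i < n.+1) (D%:E +
      \sum_(j < n.+1 | j != i) (W (X i - X j)%R + k%:E + a%:E)))).
    apply: lee_sum => i _; rewrite (bigD1 i)//= leeD//.
    by apply: lee_sum => j ji; rewrite -addeA -EFinD Xa.
  rewrite big_split/=.
  under [X in _ + X <= _]eq_bigr => i _.
    rewrite big_split/= sumEFin sumr_const.
    rewrite (_ : #|_| = n); last by rewrite (cardC1 i) card_ord.
    over.
  rewrite big_split/= !sumEFin !sumr_const !card_ord.
  rewrite addeC -addeA -EFinD leeD2l// lee_fin.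
  by rewrite -mulrnA -[X in (X + _)%R]mulr_natl natrM (mulrC n%:R) -[X in (_ + X)%R]mulr_natl.
have S0 : 0 <= S.
  apply: sume_ge0 => i _; apply: sume_ge0 => j _; apply: integral_ge0 => v _.
  by apply: integral_ge0 => u _; exact: w0.
move: SD; case: (discrete_energy W X) => [e| |]; last 2 first.
- by rewrite addye// leey.
- rewrite mulrNy gtr0_sg ?mul1e; last by rewrite mulr_gt0// exprn_gt0.
  by rewrite addNye leeNy_eq => /eqP SN; rewrite SN in S0.
rewrite -EFinM -EFinD; case: S S0 => [s| |]// _.
rewrite [X in _ -> X <= _](_ : _ = (2^-1 * ((n.+1%:R ^+ 2)^-1 * s - k))%:E)// -EFinD !lee_fin => se.
have n1 : (0 < n.+1%:R :> R)%R by [].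
have n0 : (0 <= n%:R :> R)%R by [].
move: se; rewrite (_ : n%:R = n.+1%:R - 1)%R; last by rewrite -natr1 addrK.
move: (n.+1%:R : R)%R n1 => m m0 se.
apply: (@le_trans _ _ (2^-1 * ((m ^+ 2)^-1 * (2 * m ^+ 2 * e +
    (m * (m - 1) * k + (m * (m - 1) * a + m * D))) - k))%R).
  by rewrite ler_pM2l ?invr_gt0// lerD2r ler_pM2l// invr_gt0 exprn_gt0.
have -> : (2^-1 * ((m ^+ 2)^-1 * (2 * m ^+ 2 * e +
    (m * (m - 1) * k + (m * (m - 1) * a + m * D))) - k) =
  e + (a / 2 + (D - k) / (2 * m)) - a / (2 * m))%R.
  by field; rewrite gt_eqF.
by rewrite gerBl divr_ge0// mulr_ge0// ltW.
Qed.

End smear.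

(** The degenerate smearing: scale 0, so off-diagonal pairs lose nothing and the self-energy is the
    value of [W] at 0. *)
Lemma empirical_energy_le n (X : 'I_n.+1 -> 'rV[R]_d) (b : R) : W 0%R <= b%:E ->
  exists rho : probability (borelRn R d) R,
    energy W rho <= discrete_energy W X + (b / (2 * n.+1%:R))%:E.
Proof.
move=> Wb; pose P : probability (borelRn R d) R := \d_(0%R : borelRn R d).
have pe x y : \int[P]_v \int[P]_u (W ((x + 0 *: (u : 'rV[R]_d)) -
    (y + 0 *: (v : 'rV[R]_d)))%R + k%:E) = W (x - y)%R + k%:E.
  under eq_integral => v _.
    under eq_integral do rewrite !scale0r !addr0.
    rewrite integral_cst// [X in _ * X](probability_setT P) mule1.
    over.
  by rewrite integral_cst// [X in _ * X](probability_setT P) mule1.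
have [|i j ji|x|rho H] := @smear_energy_le P 0%R 0%R (b + k)%R n X.
- by [].
- by rewrite pe addr0.
- by rewrite pe subrr EFinD leeD2r.
by exists rho; rewrite mul0r add0r addrK in H.
Qed.

End smearing.

(** * Gaussian smearing *)

Section gauss_smearing.
Context {R : realType} {d : nat}.
Implicit Types (x y : 'rV[R]_d).
Local Open Scope ereal_scope.
Local Notation mu := (@lebesgue_Rn R d).

(** The difference of the two sides is |y - q x|^2. *)
Lemma sqn_sub_scale_ge (q : R) x y : (q ^+ 2 = 2)%R ->
  (sqn y - sqn x <= sqn (x - q *: y))%R.
Proof.
move=> q2; have : (0 <= sqn (y - q *: x))%R by exact: sqn_ge0.
rewrite !sqnB !sqnZ !dotpZr q2.
have -> : dotp y x = dotp x y by rewrite /dotp; apply: eq_bigr => i _; rewrite mulrC.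
move: (sqn x) (sqn y) (q * dotp x y)%R => X Y z.
by lra.
Qed.

Variable N : probability (borelRn R d) R.
Hypothesis gaussN : forall f : borelRn R d -> \bar R, measurable_fun setT f ->
  (forall x, 0 <= f x)%E ->
  (\int[N]_x f x = \int[mu]_x (f x * (gauss (x : 'rV[R]_d) / @gaussZ R d)%:E))%E.

Variables (W : 'rV[R]_d -> \bar R) (k C : R) (i0 : 'I_d).
Hypotheses (lW : lower_semicontinuous W) (k0 : (0 <= k)%R).
Hypothesis Wk : forall x, (- k)%:E <= W x.
Hypotheses (C0 : (0 <= C)%R) (WC : forall x, gen_laplacian W x <= C%:E).
Hypothesis WN : forall x, W (- x)%R = W x.
Let C' := (C / (2 * @lap_const R d i0))%R.

Let w0 x : 0 <= W x + k%:E.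
Proof. by rewrite -leeBlDr// add0e -EFinN. Qed.

Let C'0 : (0 <= C')%R.
Proof. by rewrite /C' divr_ge0// mulr_ge0// ltW// lap_const_gt0. Qed.

Let mWs (z : 'rV[R]_d) (c : R) : measurable_fun setT (fun v : borelRn R d =>
  W (z + c *: (v : 'rV[R]_d))%R + k%:E).
Proof.
apply: emeasurable_funD; last exact: measurable_cst.
have mz := continuous_measurable_row (@continuous_addZ R d z c).
exact: measurableT_comp (lsc_measurable lW) mz.
Qed.

Section time.
Variable T : R.
Hypothesis T0 : (0 < T)%R.
Local Notation s := (Num.sqrt T).
Let pair_energy x y := \int[N]_v \int[N]_u
  (W ((x + s *: (u : 'rV[R]_d)) - (y + s *: (v : 'rV[R]_d)))%R + k%:E).

(** For fixed v the inner integral is, by symmetry of [W], a Gaussian mean around -((x - y) - s v),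
    to which [gauss_mean_le] applies. The outer mean is kept here for the diagonal, where W(0) may
    be infinite; for distinct indices a second application removes it. *)
Lemma gauss_pair_energy_le_mean x y : pair_energy x y <=
  \int[N]_v (W ((x - y) - s *: (v : 'rV[R]_d))%R + k%:E) + (T * C')%:E.
Proof.
have TC0 : (0 <= T * C')%R by rewrite mulr_ge0// ltW.
have mm := mWs (x - y) (- s).
have {}mm : measurable_fun setT (fun v : borelRn R d =>
    W ((x - y) - s *: (v : 'rV[R]_d))%R + k%:E).
  rewrite (_ : (fun v => _) = (fun v : borelRn R d =>
    W ((x - y) + (- s) *: (v : 'rV[R]_d))%R + k%:E))//.
  by apply/funext => v; rewrite scaleNr.
rewrite -[X in _ + X]mule1 -(probability_setT N) -[X in _ <= _ + X](@integral_cst _ _ _ N setT measurableT).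
rewrite -(ge0_integralD N measurableT (fun v _ => w0 _) mm); last 2 first.
- by move=> v _; rewrite lee_fin.
- exact: measurable_cst.
apply: ge0_le_integral => //.
- by move=> v _; apply: integral_ge0 => u _; exact: w0.
- have h := @measurable_fun_fubini_tonelli_G _ _ (borelRn R d) (borelRn R d) R N _
    (measurable_shift_pair k lW (continuous_measurable_row (@continuous_addZ R d x s))
      (continuous_measurable_row (@continuous_addZ R d y s))) (fun p => w0 _).
  exact h.
- by apply: (@emeasurable_funD _ _ _ _ _ _ mm); exact: measurable_cst.
move=> v _; set z := ((x - y) - s *: (v : 'rV[R]_d))%R.
have := gauss_mean_le gaussN i0 lW k0 Wk C0 WC (- z)%R T0.
rewrite WN -addeA -EFinD; apply: le_trans.
rewrite le_eqVlt; apply/orP; left; apply/eqP.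
apply: eq_integral => u _; rewrite -[in RHS]WN; congr (W _ + _).
apply/rowP => i; rewrite !mxE.
move: (x 0%R i) (y 0%R i) (s * v 0%R i)%R (s * u 0%R i)%R => a1 a2 a3 a4.
by ring.
Qed.

Lemma gauss_pair_energy_le x y :
  pair_energy x y <= W (x - y)%R + (k + 2 * T * C')%:E.
Proof.
apply: le_trans (gauss_pair_energy_le_mean x y) _.
apply: le_trans (leeD2r _ (gauss_mean_le gaussN i0 lW k0 Wk C0 WC (x - y)%R T0)) _.
by rewrite -addeA -EFinD leeD2l// lee_fin -/C'; lra.
Qed.

(* A Harnack-type comparison: for [v = e/sqrt T - sqrt 2 y] one has
   [|y|^2 <= |v|^2 + |e|^2/T], so the mean of [W] around [0] at time [T] is
   dominated by a multiple of the mean around [e] at time [2T]. *)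
Lemma gauss_mean0_lty (e : 'rV[R]_d) : W e < +oo ->
  \int[N]_v (W (s *: (v : 'rV[R]_d))%R + k%:E) < +oo.
Proof.
move=> We; have s0 : (0 < s)%R by rewrite sqrtr_gt0.
pose q : R := Num.sqrt 2; have q0 : (0 < q)%R by rewrite sqrtr_gt0.
have qq : (q ^+ 2 = 2)%R by rewrite sqr_sqrtr.
have sq : Num.sqrt (2 * T) = (s * q)%R by rewrite mulrC sqrtrM// ltW.
have T20 : (0 < 2 * T)%R by rewrite mulr_gt0.
have H : \int[N]_y (W (e - Num.sqrt (2 * T) *: (y : 'rV[R]_d))%R + k%:E) < +oo.
  apply: le_lt_trans (gauss_mean_le gaussN i0 lW k0 Wk C0 WC e T20) _.
  by rewrite lte_add_pinfty// ltry.
have m1 : measurable_fun setT (fun v : borelRn R d => W (s *: (v : 'rV[R]_d))%R + k%:E).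
  rewrite (_ : (fun v => _) = (fun v : borelRn R d =>
    W (0 + s *: (v : 'rV[R]_d))%R + k%:E)); last by apply/funext => v; rewrite add0r.
  exact: mWs.
have m2 : measurable_fun setT (fun y : borelRn R d =>
    W (e - Num.sqrt (2 * T) *: (y : 'rV[R]_d))%R + k%:E).
  rewrite (_ : (fun v => _) = (fun v : borelRn R d =>
    W (e + (- Num.sqrt (2 * T)) *: (v : 'rV[R]_d))%R + k%:E)); last first.
    by apply/funext => v; rewrite scaleNr.
  exact: mWs.
have mg : measurable_fun setT (fun v : borelRn R d => (gauss (v : 'rV[R]_d) / @gaussZ R d)%:E).
  by apply/measurable_EFinP; apply: measurable_funM => //; exact: measurable_gauss.
have g0 (v : borelRn R d) : 0 <= (gauss (v : 'rV[R]_d) / @gaussZ R d)%:E.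
  by rewrite lee_fin divr_ge0 ?gauss_ge0// ltW// gaussZ_gt0.
rewrite (gaussN m1 (fun v => w0 _)); rewrite (gaussN m2 (fun v => w0 _)) in H.
pose b : 'rV[R]_d := (s^-1 *: e)%R.
rewrite (@ge0_integral_affine R d (fun=> - q)%R 1%g b); last 3 first.
- by move=> _; rewrite oppr_eq0 gt_eqF.
- by apply: emeasurable_funM.
- by move=> v; apply: mule_ge0.
apply: lte_mul_pinfty; [by rewrite lee_fin; apply: prodr_ge0|by []|].
(* The constant exp (|e|^2 / T): it bounds the quotient of the Gaussian weights at b - q y and at
   y. *)
pose M := expR (sqn b).
apply: (@le_lt_trans _ _ (M%:E * \int[mu]_y
    ((W (e - Num.sqrt (2 * T) *: (y : 'rV[R]_d))%R + k%:E) *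
     (gauss (y : 'rV[R]_d) / @gaussZ R d)%:E))); last first.
  by apply: lte_mul_pinfty; [rewrite lee_fin expR_ge0|by []|exact: H].
have m2g := emeasurable_funM m2 mg.
rewrite -(ge0_integralZl mu measurableT m2g); last 2 first.
- by move=> y _; apply: mule_ge0.
- by rewrite lee_fin expR_ge0.
have affE (y : 'rV[R]_d) : affine (fun=> - q)%R 1%g b y = (b - q *: y)%R.
  by apply/rowP => i; rewrite !mxE perm1 addrC mulNr.
apply: ge0_le_integral => //.
- by move=> y _; apply: mule_ge0.
- have maff := measurable_affine (fun=> - q)%R 1%g b.
  have h := measurableT_comp (emeasurable_funM m1 mg) maff.
  exact h.
- by apply: measurable_funeM.
move=> y _; rewrite affE muleCA.
have -> : (s *: (b - q *: y) = e - Num.sqrt (2 * T) *: y)%R.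
  by rewrite scalerBr !scalerA mulfV ?gt_eqF// scale1r sq.
apply: lee_wpmul2l; first exact: w0.
rewrite -EFinM lee_fin mulrA ler_pM2r ?invr_gt0 ?gaussZ_gt0//.
rewrite /gauss /M -expRD ler_expR.
by rewrite lerNl opprB sqn_sub_scale_ge.
Qed.

End time.
End gauss_smearing.

(** Here j - k is twice the energy of the measure and w + k - j the gap. Sampling gives 2e <= (1 -
    1/m)(j - k); when j - k < 0 the loss |j - k| / m is paid by half of the gap. *)
Lemma sampling_energy_lt (R : realFieldType) (m e w k j : R) : 0 < m ->
  2 * `|j - k| < m * (w + k - j) ->
  2 * m ^+ 2 * e + m * (m - 1) * k <= m * (m - 1) * j ->
  e < 2^-1 * w - (w + k - j) / 4.
Proof.
move=> m0 mw me.
have {}me : 2 * m * e <= (m - 1) * (j - k).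
  by rewrite -(ler_pM2l m0); lra.
have jk := ler_norm (- (j - k)); rewrite normrN in jk.
have : m * (2 * e) < m * (j - k + (w + k - j) / 2) by lra.
by rewrite ltr_pM2l//; lra.
Qed.

(** * Implications between the notions of instability *)

Section instability.
Context {R : realType} {d : nat}.
Implicit Types (x y : 'rV[R]_d).
Local Open Scope ereal_scope.

Variables (W : 'rV[R]_d -> \bar R) (k : R) (Winf : \bar R).
Hypotheses (lW : lower_semicontinuous W) (k0 : (0 <= k)%R).
Hypothesis Wk : forall x, (- k)%:E <= W x.
Hypothesis WN : forall x, W (- x)%R = W x.

Lemma exists_nat_bound (c : R) (m : nat) : exists n : nat, (m <= n)%N /\
  forall p, (n < p)%N -> (c < p%:R)%R.
Proof.
exists (maxn m (Num.truncn c)); split; first exact: leq_maxl.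
move=> p np; apply: lt_le_trans (truncnS_gt c) _.
by rewrite ler_nat (leq_ltn_trans _ np)// leq_maxr.
Qed.

Lemma unstable_discretely_unstable : (0 < d)%N -> Winf != -oo ->
  (forall x, x != 0%R -> W x < +oo) -> unstable W Winf -> discretely_unstable W Winf.
Proof.
move=> d0; case: Winf => [w| |]// _ Wfin; last first.
  move=> _; exists 1%R; split => //; exists 2%N; split => // N _.
  (* The target is [+oo], so any configuration of finite energy will do; these points are distinct
     because d >= 1, and [W] is finite away from 0. *)
  exists (fun i => const_mx (i%:R)).
  rewrite mulry gtr0_sg ?invr_gt0// mul1e/=.
  rewrite /discrete_energy; apply: lte_mul_pinfty; [by rewrite lee_fin invr_ge0 mulr_ge0|by []|].
  apply: lte_sum_pinfty => i _; apply: lte_sum_pinfty => j ji; apply: Wfin.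
  apply/eqP => /rowP /(_ (Ordinal d0)); rewrite !mxE => /eqP.
  by rewrite subr_eq0 eqr_nat => /eqP ij; move: ji; rewrite -(inj_eq val_inj)/= ij eqxx.
move=> [rho]; rewrite (energyE lW k0 Wk).
set I := \int[rho]_y _ => IW.
have mid := @measurable_id _ (borelRn R d) setT.
pose K (z : borelRn R d * borelRn R d) := W ((z.1 : 'rV[R]_d) - (z.2 : 'rV[R]_d))%R + k%:E.
have mK : measurable_fun setT K by exact: (measurable_shift_pair k lW mid mid).
have K0 z : 0 <= K z by rewrite /K -leeBlDr// add0e -EFinN.
have KC (x y : borelRn R d) : K (x, y) = K (y, x).
  by rewrite /K/= -WN opprB.
have IE : \int[rho]_x \int[rho]_y K (x, y) = I.
  by apply: eq_integral => x _; apply: eq_integral => y _; rewrite KC.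
have [j jE] : exists j : R, I = j%:E.
  have : 0 <= I by apply: integral_ge0 => x _; apply: integral_ge0 => y _; exact: (K0 (_, _)).
  clear IE; case: I IW => [j| |]//; first by move=> _ _; exists j.
  by rewrite addye// mulry gtr0_sg ?invr_gt0// mul1e.
rewrite jE in IW IE; clear jE I.
have {}IW : (j - k < w)%R.
  by move: IW; rewrite -EFinB -!EFinM lte_fin ltr_pM2l// invr_gt0.
pose dl := (w + k - j)%R.
have dl0 : (0 < dl)%R by rewrite /dl; lra.
exists (dl / 4)%R; split; first by rewrite divr_gt0.
have [n0 [n02 n0P]] := exists_nat_bound (2 * `|j - k| / dl)%R 2.
exists n0; split; first exact: n02.
move=> [|n]; [by rewrite ltn0|move/n0P => n0n].
have [X XH] := sampling rho mK K0 KC n.+1 (measurable_cst (0 : \bar R)) (fun _ => lexx 0).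
exists X.
rewrite big1 in XH; last by [].
rewrite add0e in XH.
rewrite integral0 mul0rn add0r IE in XH.
have {}XH : \sum_i \sum_(j | j != i) (W (X i - X j)%R + k%:E) <= (n.+1%:R * n%:R * j)%:E.
  apply: le_trans XH _; rewrite le_eqVlt; apply/orP; left; apply/eqP.
  rewrite -natrM mulr_natl.
  by elim: (n.+1 * n)%N => [//|p ih]; rewrite !mulrS EFinD ih.
rewrite discrete_energyE in XH; move: XH.
case: (discrete_energy W X) => [e| |] XH; last 2 first.
- by rewrite mulry gtr0_sg ?mul1e ?addye// in XH; rewrite mulr_gt0// exprn_gt0.
- by rewrite -EFinM -EFinB ltNyr.
move: XH; rewrite -EFinM -EFinD lee_fin => XH.
rewrite -EFinM -EFinB lte_fin.
have n1 : (0 < n.+1%:R :> R)%R by [].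
rewrite (ltr_pdivrMr _ _ dl0) in n0n.
apply: (sampling_energy_lt n1 n0n).
have nE : (n%:R = n.+1%:R - 1 :> R)%R by rewrite -natr1 addrK.
by rewrite nE in XH; exact: XH.
Qed.

(** Once N > B / (2s), the fixed gap [s] exceeds B / (2N). *)
Lemma discretely_unstable_H_unstable :
  discretely_unstable W Winf -> H_unstable W Winf.
Proof.
move=> [s [s0 [Nbar [Nbar2 H]]]] B.
have [n [Nn nP]] := exists_nat_bound (B / (2 * s))%R Nbar.
have [X EX] := H n.+1 (leq_ltn_trans Nn (ltnSn n)).
exists n.+1; split; first by rewrite (leq_trans Nbar2)// ltnW.
exists X; apply: lt_le_trans EX _; rewrite leeB// lee_fin.
have := nP _ (ltnSn n); rewrite ltr_pdivrMr ?mulr_gt0// => /ltW Bn.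
by rewrite ler_pdivrMr ?mulr_gt0// [leRHS]mulrCA (mulrC s) mulrCA.
Qed.

(** With B = W(0) the defect B / (2N) is exactly what the diagonal adds to the energy of the
    empirical measure. *)
Lemma H_unstable_unstable : bounded_above W -> H_unstable W Winf -> unstable W Winf.
Proof.
move=> [M WM] H.
have [b Wb] : exists b : R, W 0%R = b%:E.
  have := WM 0%R; have := Wk 0%R; case: (W 0%R) => [b| |]//; by exists b.
have [[|n] [// _ [X EX]]] := H b.
have Wb' : W 0%R <= b%:E by rewrite Wb.
have [rho Hrho] := empirical_energy_le lW k0 Wk X Wb'.
by exists rho; apply: le_lt_trans Hrho _; rewrite -lteBrDr.
Qed.

(** The order of choices matters: first [T], so that smearing distinct points costs at most s/2;
    this fixes the self-energy bound [D], which depends on [T] but not on the configuration; then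
    the number of points, so that the diagonal costs at most s/2. *)
Lemma discretely_unstable_unstable (C : R) : (0 < d)%N -> (0 <= C)%R ->
  (forall x, gen_laplacian W x <= C%:E) -> (exists e, W e < +oo) ->
  discretely_unstable W Winf -> unstable W Winf.
Proof.
move=> d0 C0 WC [e We] [s [s0 [Nbar [_ H]]]].
pose i0 := Ordinal d0.
have [N gaussN] := @gauss_probability R d.
pose C' := (C / (2 * @lap_const R d i0))%R.
have C'0 : (0 <= C')%R by rewrite /C' divr_ge0// mulr_ge0// ltW// lap_const_gt0.
have [T T0 TC] : exists2 T : R, (0 < T)%R & (T * C' <= s / 2)%R.
  exists (s / (2 * (C' + 1)))%R; first by rewrite divr_gt0// mulr_gt0// ltr_wpDl.
  rewrite mulrAC ler_pdivrMr; last by rewrite mulr_gt0// ltr_wpDl.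
  by rewrite [leRHS]mulrA divfK// ler_wpM2l ?(ltW s0)// lerDl.
have Jfin := gauss_mean0_lty gaussN i0 lW k0 Wk C0 WC T0 We.
set J := \int[N]_v _ in Jfin.
have J0 : 0 <= J.
  by apply: integral_ge0 => v _; rewrite -leeBlDr// add0e -EFinN; exact: Wk.
pose D := (fine J + T * C')%R.
have [n [Nn nP]] := exists_nat_bound (`|D - k| / s)%R Nbar.
have [X EX] := H n.+1 (leq_ltn_trans Nn (ltnSn n)).
have [|i j _|x|rho Hrho] := @smear_energy_le R d W k lW k0 Wk N (Num.sqrt T)
  (2 * T * C')%R D n X.
- by apply: mulr_ge0 => //; apply: mulr_ge0 => //; exact: ltW.
- exact: (gauss_pair_energy_le gaussN i0 lW k0 Wk C0 WC WN T0).
- apply: le_trans (gauss_pair_energy_le_mean gaussN i0 lW k0 Wk C0 WC WN T0 x x) _.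
  rewrite /D EFinD fineK ?ge0_fin_numE// leeD2r// le_eqVlt; apply/orP; left; apply/eqP.
  by apply: eq_integral => v _; rewrite subrr add0r WN.
exists rho; apply: le_lt_trans Hrho _; rewrite -lteBrDr//.
apply: lt_le_trans EX _; rewrite leeB// lee_fin.
have := nP _ (ltnSn n); rewrite ltr_pdivrMr// => Dn.
have Dk : (D - k <= `|D - k|)%R by exact: ler_norm.
have : ((D - k) / (2 * n.+1%:R) <= s / 2)%R.
  rewrite ler_pdivrMr ?mulr_gt0//.
  apply: le_trans Dk (le_trans (ltW Dn) _).
  by rewrite mulrA divfK// mulrC.
move: TC; move: ((D - k) / (2 * n.+1%:R))%R => q TC qs.
have -> : (2 * T * C' / 2 = T * C')%R by field.
by rewrite (splitr s) lerD.
Qed.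

End instability.

Theorem proposition5p4 (R : realType) (d : nat) (hd : (1 <= d)%N)
  (W : 'rV[R]_d -> \bar R) (Winf : \bar R) (RW : R)
  (hlsc : lower_semicontinuous W)
  (hbelow : bounded_below W)
  (hloc : loc_integrable W)
  (hsym : forall x, W (- x) = W x)
  (hWinf : Winf != -oo%E)
  (hlim : W x @[x --> at_infinity] --> Winf)
  (hRW : 0 < RW)
  (hincr : radially_strictly_increasing W RW) :
  (bounded_above W -> upper_semicontinuous W ->
     (unstable W Winf <-> discretely_unstable W Winf) /\
     (discretely_unstable W Winf <-> H_unstable W Winf)) /\
  (forall beta CW : R,
     2 < beta -> beta < d%:R ->
     beta_repulsive beta W ->
     C1_on (~` [set 0]) W ->
     0 < CW ->
     (forall x, (gen_laplacian W x <= CW%:E)%E) ->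
     (forall x, enorm x <= 1 ->
        (W x <= CW%:E * neg_pow (enorm x) (2 - beta))%E) ->
     (forall x, 0 < enorm x <= 1 ->
        enorm (gradient (fine \o W) x) <= CW * enorm x `^ (1 - beta)) ->
     (unstable W Winf <-> discretely_unstable W Winf) /\
     (discretely_unstable W Winf -> H_unstable W Winf)).
Proof.
have [m Wm] := hbelow.
have k0 : 0 <= `|m| by [].
have Wk x : ((- `|m|)%:E <= W x)%E.
  by apply: le_trans (Wm x); rewrite lee_fin lerNl; have := ler_norm (- m); rewrite normrN.
have dH := @discretely_unstable_H_unstable R d W Winf.
split=> [Wa _|beta CW _ _ _ WC1 CW0 WC _ _].
  have Wfin x : x != 0 -> (W x < +oo)%E.
    by have [M WM] := Wa => _; rewrite (le_lt_trans (WM x))// ltry.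
  have ud := unstable_discretely_unstable hlsc k0 Wk hsym hd hWinf Wfin.
  have Hu := H_unstable_unstable hlsc k0 Wk Wa (Winf := Winf).
  (* The three implications form a cycle. *)
  by split; split=> [|h]//; [exact: Hu (dH h)|exact: ud (Hu h)].
(* Under (B), finiteness away from the origin is part of [C1_on]; W(0) may be infinite, so the
   diagonal is treated by Gaussian smearing. *)
have Wfin x : x != 0 -> (W x < +oo)%E.
  by move=> /eqP x0; have [+ _ _] := WC1 x x0; rewrite fin_numE ltey => /andP[_ ->].
split; last exact: dH.
split; first exact: (unstable_discretely_unstable hlsc k0 Wk hsym hd hWinf Wfin).
apply: (discretely_unstable_unstable hlsc k0 Wk hsym hd (ltW CW0) WC).
exists (const_mx 1); apply: Wfin; apply/eqP => /rowP /(_ (Ordinal hd)).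
by rewrite !mxE => /eqP; rewrite oner_eq0.
Qed.
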